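(* The measure $\mu$ is invariant under the linear flow $L(t)$: for all $t\in\mathbb R$ and all measurable sets $A\subset H^{1/2-}_{\mathrm{loc}}$, $$\mu(L(t)^{-1}(A))=\mu(A).$$
   Context: $L(t)$ is the Fourier multiplier $\widehat{L(t)f}(n)=e^{-it\sqrt{1+n^2}}\hat f(n)$ (the flow of $i\partial_tu=\sqrt{1-\partial_x^2}\,u$ on $\mathbb R$). $D^s=(1-\partial_x^2)^{s/2}$ is the Fourier multiplier $(1+n^2)^{s/2}$ on tempered distributions. $p_{R,s}(u)=\big(\int_{-R}^R|D^su|^2dx\big)^{1/2}$. $H^{1/2-}_{\mathrm{loc}}$ is the space of (complex-valued) tempered distributions $u$ on $\mathbb R$ with $p_{R,s}(u)<\infty$ for all $R>0$, $s<1/2$, with the distance $d(u,v)=\sum_{k,l\ge1}2^{-(k+l)}\frac{p_{k,1/2-1/l}(u-v)}{1+p_{k,1/2-1/l}(u-v)}$ and its Borel $\sigma$-algebra. $(\Omega,\mathcal F,\mathbb P)$ is a probability space with a two-sided complex Brownian motion $(W_n)_{n\in\mathbb R}$, normalized by $\mathbb E|W_a-W_b|^2=|a-b|$. For integers $N,R\ge1$, $$\varphi_{N,R}(\omega,x)=\sum_{j=-NR}^{NR-1}\big(W_{\frac{j+1}N}-W_{\frac jN}\big)(\omega)\Big(1+\frac{j^2}{N^2}\Big)^{-1/2}e^{ijx/N}.$$ The random variable $\varphi$ is the limit of $\phi_k=\varphi_{2^k,k}$ as $k\to\infty$, in the sense that for every $s<1/2$, $\sup_{x}(1+x^2)^{-1/2}\|D^s\phi_k(x)-D^s\varphi(x)\|_{L^2_\Omega}\to0$.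 The measure $\mu$ is the law of $\varphi$ on $H^{1/2-}_{\mathrm{loc}}$: $\mu(A)=\mathbb P(\varphi^{-1}(A))$. *)

(* Defs.v *)
From HB Require Import structures.
From mathcomp Require Import all_boot all_order all_algebra.
From mathcomp Require Import complex.
From mathcomp Require Import all_classical all_reals all_analysis.

Set Implicit Arguments.
Unset Strict Implicit.
Unset Printing Implicit Defensive.

Import Order.TTheory GRing.Theory Num.Theory.
Import numFieldNormedType.Exports.

Local Open Scope classical_set_scope.
Local Open Scope ring_scope.
Local Open Scope complex_scope.

Local Notation Re := (@complex.Re _).
Local Notation Im := (@complex.Im _).

Section complex_valued_functions.
Context {R : realType}.

Definition normc (z : R[i]) : R := ComplexField.Normc.normc z.

Definition expi (theta : R) : R[i] := cos theta +i* sin theta.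

Definition ccontinuous (f : R -> R[i]) : Prop :=
  continuous (Re \o f) /\ continuous (Im \o f).

Definition cderiven (n : nat) (f : R -> R[i]) : R -> R[i] :=
  fun x => derive1n n (Re \o f) x +i* derive1n n (Im \o f) x.

Definition csmooth (f : R -> R[i]) : Prop :=
  forall (n : nat) (x : R),
    derivable (derive1n n (Re \o f)) x 1 /\
    derivable (derive1n n (Im \o f)) x 1.

Definition cmeasurable_fun d (T : measurableType d) (D : set T)
    (f : T -> R[i]) : Prop :=
  measurable_fun D (Re \o f) /\ measurable_fun D (Im \o f).

Definition cintegral (D : set R) (f : R -> R[i]) : R[i] :=
  \int[lebesgue_measure]_(x in D) Re (f x) +i*
  \int[lebesgue_measure]_(x in D) Im (f x).

Definition L2norm d (T : measurableType d) (m : {measure set T -> \bar R})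
    (D : set T) (f : T -> R[i]) : \bar R :=
  ((\int[m]_(x in D) (normc (f x) ^+ 2)%:E) `^ 2^-1)%E.

End complex_valued_functions.

Section tempered_distributions.
Context {R : realType}.

Definition schwartz_seminorm (a b : nat) (f : R -> R[i]) : \bar R :=
  ereal_sup (range (fun x => (`|x| ^+ a * normc (cderiven b f x))%:E)).

Definition schwartz (f : R -> R[i]) : Prop :=
  csmooth f /\ forall a b, (schwartz_seminorm a b f < +oo)%E.

(* A distribution is encoded as a functional on all functions, with the
   convention that it vanishes outside the Schwartz space; thus Leibniz
   equality is equality in the dual of the Schwartz space. *)
Definition functional := (R -> R[i]) -> R[i].

Definition on_schwartz (u : functional) : functional :=
  fun f => if `[< schwartz f >] then u f else 0.

(* The Schwartz space is metrizable, so sequential continuity at 0 of a linear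
   form is its continuity. *)
Definition tempered (u : functional) : Prop :=
  [/\ forall f, ~ schwartz f -> u f = 0,
      forall (a : R[i]) f g, schwartz f -> schwartz g ->
        u (fun x => a * f x + g x) = a * u f + u g
    & forall f_ : nat -> R -> R[i],
        (forall n, schwartz (f_ n)) ->
        (forall a b,
          schwartz_seminorm a b (f_ n) @[n --> \oo] --> (0 : \bar R)) ->
        normc (u (f_ n)) @[n --> \oo] --> (0 : R)].

Definition distr_of (f : R -> R[i]) : functional :=
  on_schwartz (fun g => cintegral setT (fun x => f x * g x)).

Definition fourier (f : R -> R[i]) : R -> R[i] :=
  fun n => cintegral setT (fun x => expi (- (n * x)) * f x).

Definition inv_fourier (f : R -> R[i]) : R -> R[i] :=
  fun x => ((2 * pi)^-1)%:C * cintegral setT (fun n => expi (n * x) * f n).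

Definition dfourier (u : functional) : functional :=
  on_schwartz (fun f => u (fourier f)).

Definition dinv_fourier (u : functional) : functional :=
  on_schwartz (fun f => u (inv_fourier f)).

Definition dmul (m : R -> R[i]) (u : functional) : functional :=
  on_schwartz (fun f => u (fun n => m n * f n)).

Definition fourier_multiplier (m : R -> R[i]) (u : functional) : functional :=
  dinv_fourier (dmul m (dfourier u)).

Definition D (s : R) : functional -> functional :=
  fourier_multiplier (fun n => ((1 + n ^+ 2) `^ (s / 2))%:C).

Definition L (t : R) : functional -> functional :=
  fourier_multiplier (fun n => expi (- (t * Num.sqrt (1 + n ^+ 2)))).

Definition sym_itv (r : R) : set R := `]- r, r[.

Definition test_function (r : R) (g : R -> R[i]) : Prop :=
  schwartz g /\ exists2 r' : R, r' < r & forall x, r' <= `|x| -> g x = 0.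

(* [u] is given on the interval ]-r, r[ by the square integrable function [f] *)
Definition locally_L2 (r : R) (u : functional) (f : R -> R[i]) : Prop :=
  [/\ cmeasurable_fun (sym_itv r) f,
      (L2norm lebesgue_measure (sym_itv r) f < +oo)%E
    & forall g, test_function r g ->
        u g = cintegral (sym_itv r) (fun x => f x * g x)].

(* The set below is empty when the restriction of [D s u] to ]-r, r[ is not
   square integrable (the infimum is then +oo), and otherwise has a single
   element. *)
Definition seminorm (r s : R) (u : functional) : \bar R :=
  ereal_inf [set L2norm lebesgue_measure (sym_itv r) f
            | f in locally_L2 r (D s u)].

End tempered_distributions.

Arguments functional : clear implicits.

Section Hloc.
Variable R : realType.

Definition Hloc_set : set (functional R) :=
  [set u | tempered u /\
    forall r s : R, 0 < r -> s < 2^-1 -> (seminorm r s u < +oo)%E].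

Definition Hloc_dist (u v : functional R) : \bar R :=
  (\sum_(1 <= k <oo) \sum_(1 <= l <oo)
    let p : R :=
      fine (seminorm k%:R (2^-1 - l%:R^-1) (fun f => (u f - v f)%R)) in
    (2 ^- (k + l) * (p / (1 + p)))%:E)%E.

Definition Hloc := set_type Hloc_set.

Definition Hloc_open : set (set Hloc) :=
  [set U | forall u, U u -> exists2 e : R, 0 < e &
    forall v, (Hloc_dist (val u) (val v) < e%:E)%E -> U v].

HB.instance Definition _ := gen_eqMixin Hloc.
HB.instance Definition _ := gen_choiceMixin Hloc.

Lemma Hloc_openT : Hloc_open setT.
Proof. by move=> u _; exists 1. Qed.

Lemma Hloc_openI : setI_closed Hloc_open.
Proof.
move=> U V oU oV u [/oU[e e0 eU] /oV[f f0 fV]].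
exists (Num.min e f); first by rewrite lt_min e0.
move=> v; rewrite EFin_min lt_min => /andP[ue uf].
by split; [exact: eU | exact: fV].
Qed.

Lemma Hloc_open_bigU (I : Type) (f : I -> set Hloc) :
  (forall i, Hloc_open (f i)) -> Hloc_open (\bigcup_i f i).
Proof.
move=> fo u [i _ /fo[e e0 ef]]; exists e => // v /ef fv.
by exists i.
Qed.

HB.instance Definition _ :=
  isOpenTopological.Build Hloc Hloc_openT Hloc_openI Hloc_open_bigU.

Lemma Hloc_set0 : Hloc_set (fun=> 0).
Proof.
have cint0 (A : set R) (g : R -> R[i]) :
    cintegral A (fun x => 0 * g x) = 0.
  rewrite /cintegral (_ : (fun x => Re _) = cst 0); last first.
    by apply/funext => x; rewrite mul0r.
  rewrite (_ : (fun x => Im _) = cst 0); last first.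
    by apply/funext => x; rewrite mul0r.
  by rewrite /Rintegral integral0.
have L20 r : L2norm lebesgue_measure (sym_itv r) (fun=> 0 : R[i]) = 0%E.
  rewrite /L2norm (_ : (fun x => _) = cst 0%E); last first.
    apply/funext => x.
    by rewrite /normc ComplexField.Normc.normc0 expr0n.
  by rewrite integral0 poweR0r.
split; first split=> //.
- by move=> a f g _ _; rewrite mulr0 addr0.
- move=> f_ _ _; rewrite /normc ComplexField.Normc.normc0; exact: cvg_cst.
move=> r s _ _; apply: (@le_lt_trans _ _ 0%E) => //.
apply: ereal_inf_lbound; exists (fun=> 0) => //; split.
- by split; exact: measurable_cst.
- by rewrite L20.
move=> g _; rewrite cint0 /D /fourier_multiplier /dinv_fourier /dmul /dfourier.
by rewrite /on_schwartz; do !case: ifP.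
Qed.

HB.instance Definition _ := isPointed.Build Hloc
  (exist _ (fun=> 0) (mem_set Hloc_set0)).

Definition borel_Hloc := g_sigma_algebraType (@open Hloc).
HB.instance Definition _ := Measurable.on borel_Hloc.

Definition L_preimage (t : R) (A : set borel_Hloc) : set borel_Hloc :=
  [set u | exists2 v, A v & val v = L t (val u)].

End Hloc.

Section randomization.
Context {R : realType} d {T : measurableType d} (P : probability T R).

Definition mutually_independent (I : finType) (X : I -> T -> R) : Prop :=
  forall B : I -> set R, (forall i, measurable (B i)) ->
    P [set w | forall i, B i (X i w)] =
    (\prod_(i : I) P (X i @^-1` B i))%E.

Definition part (b : bool) (z : R[i]) : R :=
  if b then Re z else Im z.

(* The real and imaginary parts of [W b - W a] have variance (b - a) / 2, so
   that E |W b - W a|^2 = b - a. [normal_prob] takes the standard deviation. *)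
Definition complex_brownian_motion (W : R -> T -> R[i]) : Prop :=
  [/\ forall a, cmeasurable_fun setT (W a),
      {ae P, forall w, W 0 w = 0 /\ ccontinuous (W ^~ w)},
      forall (t : nat -> R), {homo t : m n / (m < n)%N >-> m < n} ->
        forall n, mutually_independent (fun (i : 'I_n * bool) w =>
          part i.2 (W (t i.1.+1) w - W (t i.1) w))
    & forall a b, a < b -> forall (c : bool) (B : set R), measurable B ->
        P [set w | B (part c (W b w - W a w))] =
        normal_prob 0 (Num.sqrt ((b - a) / 2)) B].

Definition phi_NR (W : R -> T -> R[i]) (N M : nat) (w : T) (x : R) : R[i] :=
  \sum_(i < (N * M).*2)
    let j : R := i%:R - (N * M)%:R in
    (W ((j + 1) / N%:R) w - W (j / N%:R) w) *
    ((1 + j ^+ 2 / N%:R ^+ 2) `^ (- 2^-1))%:C * expi (j * x / N%:R).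

(* [D s (phi_ k w)] is read as a continuous function, which is unique, and
   [D s (phi w)] as an element of L2_loc; [F] is a version of the latter which
   gives a meaning to its value at each point [x]. *)
Definition is_limit (phi_ : nat -> T -> R -> R[i]) (phi : T -> functional R)
    : Prop :=
  forall s : R, s < 2^-1 ->
  exists (F_ : nat -> T -> R -> R[i]) (F : T -> R -> R[i]),
  [/\ forall k w, ccontinuous (F_ k w) /\
        forall r, 0 < r -> locally_L2 r (D s (distr_of (phi_ k w))) (F_ k w),
      cmeasurable_fun setT (fun z : T * R => F z.1 z.2),
      {ae P, forall w, forall r, 0 < r -> locally_L2 r (D s (phi w)) (F w)}
    & (fun k => ereal_sup (range (fun x : R =>
        ((Num.sqrt (1 + x ^+ 2))^-1)%:E *
        L2norm P setT (fun w => (F_ k w x - F w x)%R))))%E @ \oo -->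
      (0 : \bar R)].

End randomization.

(* Main.v *)
From HB Require Import structures.
Require Import Defs.
From mathcomp Require Import all_boot all_order all_algebra.
From mathcomp Require Import complex.
From mathcomp Require Import all_classical all_reals all_analysis.
From mathcomp Require Import measurable_realfun ring lra.

Set Implicit Arguments.
Unset Strict Implicit.
Unset Printing Implicit Defensive.

Import Order.TTheory GRing.Theory Num.Theory.
Import numFieldNormedType.Exports.

Local Open Scope classical_set_scope.
Local Open Scope ring_scope.
Local Open Scope complex_scope.

Local Notation Re := (@complex.Re _).
Local Notation Im := (@complex.Im _).
Local Notation normc := (@Defs.normc _).

(** * Complex numbers *)

Section complex_numbers.
Context {R : realType}.
Implicit Types (z w : R[i]) (x y : R).

Lemma ReD z w : Re (z + w) = Re z + Re w. Proof. by case: z; case: w. Qed.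
Lemma ImD z w : Im (z + w) = Im z + Im w. Proof. by case: z; case: w. Qed.
Lemma ReN z : Re (- z) = - Re z. Proof. by case: z. Qed.
Lemma ImN z : Im (- z) = - Im z. Proof. by case: z. Qed.
Lemma ReB z w : Re (z - w) = Re z - Re w. Proof. by rewrite ReD ReN. Qed.
Lemma ImB z w : Im (z - w) = Im z - Im w. Proof. by rewrite ImD ImN. Qed.
Lemma ReM z w : Re (z * w) = Re z * Re w - Im z * Im w.
Proof. by case: z; case: w. Qed.
Lemma ImM z w : Im (z * w) = Re z * Im w + Im z * Re w.
Proof. by case: z; case: w. Qed.
Lemma complex_eqP z w : Re z = Re w -> Im z = Im w -> z = w.
Proof. by case: z; case: w => /= a b c d -> ->. Qed.

Lemma normcD z w : normc (z + w) <= normc z + normc w.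
Proof. exact: le_normcD. Qed.
Lemma normcM z w : normc (z * w) = normc z * normc w.
Proof. exact: ComplexField.Normc.normcM. Qed.
Lemma normcN z : normc (- z) = normc z. Proof. exact: normcN. Qed.
Lemma normc0 : normc (0 : R[i]) = 0.
Proof. exact: ComplexField.Normc.normc0. Qed.
Lemma normc1 : normc (1 : R[i]) = 1.
Proof. exact: ComplexField.Normc.normc1. Qed.
Lemma normcE z : normc z = Num.sqrt (Re z ^+ 2 + Im z ^+ 2).
Proof. by case: z. Qed.
Lemma normc_ge0 z : 0 <= normc z. Proof. by rewrite normcE sqrtr_ge0. Qed.
Lemma sqr_normc z : normc z ^+ 2 = Re z ^+ 2 + Im z ^+ 2.
Proof. by rewrite normcE sqr_sqrtr// addr_ge0// sqr_ge0. Qed.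
Lemma normcR x : normc x%:C = `|x|.
Proof. by rewrite normcE /= expr0n addr0 sqrtr_sqr. Qed.
Lemma normcB z w : normc (z - w) <= normc z + normc w.
Proof. by rewrite (le_trans (normcD _ _))// normcN. Qed.
Lemma normc_distC z w : normc (z - w) = normc (w - z).
Proof. by rewrite -normcN opprB. Qed.
Lemma le_Re_normc z : `|Re z| <= normc z.
Proof. by rewrite normcE -sqrtr_sqr ler_wsqrtr// lerDl sqr_ge0. Qed.
Lemma le_Im_normc z : `|Im z| <= normc z.
Proof. by rewrite normcE -sqrtr_sqr ler_wsqrtr// lerDr sqr_ge0. Qed.
Lemma normc_le z : normc z <= `|Re z| + `|Im z|.
Proof.
rewrite -(@ler_pXn2r _ 2%N)// ?nnegrE ?normc_ge0 ?addr_ge0//.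
rewrite sqr_normc sqrrD !real_normK ?num_real// addrAC lerDl.
by rewrite mulrn_wge0// mulr_ge0.
Qed.
Lemma normc_conj z : normc z^* = normc z.
Proof. by rewrite !normcE; case: z => a b /=; rewrite sqrrN. Qed.
Lemma normc_expi x : normc (expi x) = 1.
Proof. by rewrite normcE /= cos2Dsin2 sqrtr1. Qed.
Lemma expiD x y : expi (x + y) = expi x * expi y :> R[i].
Proof.
apply: complex_eqP; rewrite ?ReM ?ImM /= ?cosD ?sinD// addrC mulrC.
by rewrite [sin x * cos y]mulrC.
Qed.
Lemma expi0 : expi 0 = 1 :> R[i].
Proof. by rewrite /expi cos0 sin0. Qed.
Lemma conj_expi x : (expi x)^* = expi (- x).
Proof. by rewrite /expi /= cosN sinN. Qed.
Lemma normc_sum (I : Type) (r : seq I) (F : I -> R[i]) :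
  normc (\sum_(i <- r) F i) <= \sum_(i <- r) normc (F i).
Proof.
elim: r => [|i r IH]; first by rewrite !big_nil normc0.
by rewrite !big_cons (le_trans (normcD _ _))// lerD2l.
Qed.
Lemma normc_eq0 z : normc z = 0 -> z = 0.
Proof. exact: ComplexField.Normc.eq0_normc. Qed.
Lemma realCM x y : (x * y)%:C = x%:C * y%:C. Proof. exact: rmorphM. Qed.
Lemma realCD x y : (x + y)%:C = x%:C + y%:C. Proof. exact: rmorphD. Qed.
Lemma realCN x : (- x)%:C = - x%:C. Proof. exact: rmorphN. Qed.

End complex_numbers.

(** * Differentiation of complex-valued functions *)

Section complex_derivative.
Context {R : realType}.
Implicit Types (f g : R -> R[i]) (h q : R -> R).

Definition is_cder f f' : Prop := forall x : R,
  is_derive x 1 (Re \o f) (Re (f' x)) /\ is_derive x 1 (Im \o f) (Im (f' x)).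

Definition cder f : R -> R[i] :=
  fun x => derive1 (Re \o f) x +i* derive1 (Im \o f) x.

Lemma is_derive_ext (F G : R -> R) (x l m : R) :
  F =1 G -> l = m -> is_derive x 1 F l -> is_derive x 1 G m.
Proof. by move=> /funext -> ->. Qed.

Lemma is_cderE f f' : is_cder f f' -> f' = cder f.
Proof.
move=> h; apply/funext => x; have [[_ h1] [_ h2]] := h x.
by apply: complex_eqP; rewrite /= derive1E.
Qed.

Lemma is_cder_eq f f' f1 f1' :
  f =1 f1 -> f' =1 f1' -> is_cder f f' -> is_cder f1 f1'.
Proof. by move=> /funext -> /funext ->. Qed.

Lemma is_cder_cst (c : R[i]) : is_cder (fun=> c) (fun=> 0).
Proof. by move=> x; split; exact: is_derive_cst. Qed.

Lemma is_cderD f g f' g' : is_cder f f' -> is_cder g g' ->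
  is_cder (fun x => f x + g x) (fun x => f' x + g' x).
Proof.
move=> hf hg x; have [f1 f2] := hf x; have [g1 g2] := hg x; split.
- by apply: is_derive_ext (is_deriveD f1 g1) => [y|]; rewrite /= ReD.
- by apply: is_derive_ext (is_deriveD f2 g2) => [y|]; rewrite /= ImD.
Qed.

Lemma is_cderM f g f' g' : is_cder f f' -> is_cder g g' ->
  is_cder (fun x => f x * g x) (fun x => f' x * g x + f x * g' x).
Proof.
move=> hf hg x; have [f1 f2] := hf x; have [g1 g2] := hg x; split.
- apply: is_derive_ext (is_deriveB (is_deriveM f1 g1) (is_deriveM f2 g2)).
    by move=> y; rewrite /= ReM.
  by rewrite ReD !ReM /= /GRing.scale/=; ring.
- apply: is_derive_ext (is_deriveD (is_deriveM f1 g2) (is_deriveM f2 g1)).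
    by move=> y; rewrite /= ImM.
  by rewrite ImD !ImM /= /GRing.scale/=; ring.
Qed.

Lemma is_cderZ (c : R[i]) f f' : is_cder f f' ->
  is_cder (fun x => c * f x) (fun x => c * f' x).
Proof.
move=> hf; apply: is_cder_eq (is_cderM (is_cder_cst c) hf) => x //=.
by rewrite mul0r add0r.
Qed.

Lemma is_cder_real h h' : (forall x : R, is_derive x 1 h (h' x)) ->
  is_cder (fun x => (h x)%:C) (fun x => (h' x)%:C).
Proof. by move=> hh x; split => //=; exact: is_derive_cst. Qed.

Lemma is_cder_id : is_cder (fun x => x%:C) (fun=> 1).
Proof. by apply: is_cder_eq (is_cder_real (fun x => is_derive_id x 1)). Qed.

Lemma is_cder_expi q q' : (forall x : R, is_derive x 1 q (q' x)) ->
  is_cder (fun x => expi (q x)) (fun x => 'i * (q' x)%:C * expi (q x)).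
Proof.
move=> hq x; split.
- apply: is_derive_ext (is_derive1_comp (is_derive_cos (q x)) (hq x)) => //.
  by rewrite !(ReM, ImM) /=; ring.
- apply: is_derive_ext (is_derive1_comp (is_derive_sin (q x)) (hq x)) => //.
  by rewrite !(ReM, ImM) /=; ring.
Qed.

Lemma is_cder_affine f f' (c b : R) : is_cder f f' ->
  is_cder (fun x => f (c * x + b)) (fun x => c%:C * f' (c * x + b)).
Proof.
move=> hf x.
have hq : is_derive x 1 (fun y : R => c * y + b : R) c.
  have h := is_deriveD (is_deriveM (is_derive_cst c x 1) (is_derive_id x 1))
    (is_derive_cst b x 1).
  by apply: (is_derive_eq h); rewrite /GRing.scale/= mulr0 !addr0 mulr1.
have [h1 h2] := hf (c * x + b); split.
- by apply: is_derive_eq (is_derive1_comp (g := fun y : R => c * y + b) h1 hq) _; rewrite ReM /=; ring.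
- by apply: is_derive_eq (is_derive1_comp (g := fun y : R => c * y + b) h2 hq) _; rewrite ImM /=; ring.
Qed.

Lemma is_cder_continuous f f' : is_cder f f' -> ccontinuous f.
Proof.
move=> hf; split=> x; have [[h1 _] [h2 _]] := hf x;
  by apply: differentiable_continuous; exact/derivable1_diffP.
Qed.

Lemma cderivenS n f : cderiven n.+1 f = cder (cderiven n f).
Proof. by apply/funext. Qed.

Lemma cderivenSr n f : cderiven n.+1 f = cderiven n (cder f).
Proof.
by apply/funext => x; rewrite /cderiven /derive1n !iterSr.
Qed.

Lemma cderiven0 f : cderiven 0 f = f.
Proof. by apply/funext => x; rewrite /cderiven /=; case: (f x). Qed.

Lemma csmoothP f : csmooth f <-> (is_cder f (cder f) /\ csmooth (cder f)).
Proof.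
split=> [sf|[hf sf]].
- split; last first.
    by move=> n x; have := sf n.+1 x; rewrite /derive1n !iterSr.
  by move=> x; have [/= h1 h2] := sf 0%N x; split; rewrite derive1E;
    exact: derivableP.
- case=> [|n] x; first by have [[h1 _] [h2 _]] := hf x.
  by have := sf n x; rewrite /derive1n !iterSr.
Qed.

End complex_derivative.

(** * Symbols *)

Section weight.
Context {R : realType}.
Implicit Types (a b x : R).

Definition jb a x : R := (1 + x ^+ 2) `^ (a / 2).

Lemma onesqr_gt0 x : 0 < 1 + x ^+ 2. Proof. by rewrite ltr_pwDl// sqr_ge0. Qed.
Lemma jb_gt0 a x : 0 < jb a x. Proof. by rewrite powR_gt0// onesqr_gt0. Qed.
Lemma jb_ge0 a x : 0 <= jb a x. Proof. exact/ltW/jb_gt0. Qed.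
Lemma jb_neq0 a x : jb a x != 0. Proof. exact/lt0r_neq0/jb_gt0. Qed.
Lemma jb0 x : jb 0 x = 1. Proof. by rewrite /jb mul0r powRr0. Qed.
Lemma jbD a b x : jb (a + b) x = jb a x * jb b x.
Proof.
rewrite /jb mulrDl powRD//; apply/implyP => _; exact/lt0r_neq0/onesqr_gt0.
Qed.
Lemma jbN a x : jb (- a) x = (jb a x)^-1.
Proof. by rewrite /jb mulNr powRN. Qed.
Lemma jb_le a b x : a <= b -> jb a x <= jb b x.
Proof.
move=> ab; apply: ler_powR; first by rewrite lerDl sqr_ge0.
by rewrite ler_pM2r// invr_gt0.
Qed.
Lemma jb2 x : jb 2 x = 1 + x ^+ 2.
Proof. by rewrite /jb divff// powRr1// ltW// onesqr_gt0. Qed.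
Lemma jb1 x : jb 1 x = Num.sqrt (1 + x ^+ 2).
Proof. by rewrite /jb div1r powR12_sqrt// ltW// onesqr_gt0. Qed.
Lemma jb_even a x : jb a (- x) = jb a x.
Proof. by rewrite /jb sqrrN. Qed.
Lemma normr_le_jb1 x : `|x| <= jb 1 x.
Proof. by rewrite jb1 -sqrtr_sqr ler_wsqrtr// lerDr. Qed.
Lemma jb_ge1 a x : 0 <= a -> 1 <= jb a x.
Proof. by move=> a0; rewrite -(jb0 x) jb_le. Qed.
Lemma jb_nat n x : jb n%:R x = jb 1 x ^+ n.
Proof.
elim: n => [|n IH]; first by rewrite jb0.
by rewrite -natr1 jbD IH exprSr.
Qed.

Lemma is_derive_jb a x : is_derive x 1 (jb a) (a * x * jb (a - 2) x).
Proof.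
have hq : is_derive x 1 (fun y : R => 1 + y ^+ 2 : R) (2 * x).
  have h := is_deriveD (is_derive_cst (1 : R) x 1)
    (is_deriveM (is_derive_id x 1) (is_derive_id x 1)).
  by apply: (is_derive_eq h); rewrite /GRing.scale/= !mulr1 add0r mulr2n mulrDl !mul1r.
have h := is_derive1_comp (g := fun y : R => 1 + y ^+ 2)
    (is_derive1_powR (a / 2) (onesqr_gt0 x)) hq.
apply: is_derive_ext h => //.
rewrite /jb [(a - 2) / 2]mulrBl divff//.
by field.
Qed.

End weight.

Section symbols.
Context {R : realType}.
Implicit Types (f g : R -> R[i]) (A : set R) (a b c rho : R) (k : nat).

(** With [rho = 1] these are the symbols of a pseudo-differential operator of
    order [a], with [rho = 0] the functions all of whose derivatives have size
    [a]; on the empty set only smoothness remains. Keeping the constant [c] and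
    the number [k] of derivatives explicit turns every closure property into a
    continuity estimate. *)
Fixpoint sym A rho k a c f : Prop :=
  (forall x, A x -> normc (f x) <= c * jb a x) /\
  if k is k'.+1 then exists2 f', is_cder f f' & sym A rho k' (a - rho) c f'
  else True.

Definition symbol A rho a f :=
  forall k, exists2 c, 0 <= c & sym A rho k a c f.

Lemma sym_bound A rho k a c f : sym A rho k a c f ->
  forall x, A x -> normc (f x) <= c * jb a x.
Proof. by case: k => [|k] []. Qed.

Lemma sym_der A rho k a c f f' : sym A rho k.+1 a c f -> is_cder f f' ->
  sym A rho k (a - rho) c f'.
Proof.
by move=> [_ [g hg sg]] hf; rewrite (is_cderE hf) -(is_cderE hg).
Qed.

Lemma symS A rho k a c f f' : (forall x, A x -> normc (f x) <= c * jb a x) ->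
  is_cder f f' -> sym A rho k (a - rho) c f' -> sym A rho k.+1 a c f.
Proof. by move=> h hf sf; split=> //; exists f'. Qed.

Lemma sym_weaken A A' rho rho' k k' a a' c c' f :
  A' `<=` A -> rho' <= rho -> (k' <= k)%N -> a <= a' -> c <= c' -> 0 <= c' ->
  sym A rho k a c f -> sym A' rho' k' a' c' f.
Proof.
move=> AA rr; elim: k' k a a' f => [|k' IH] k a a' f kk aa cc c0 sf.
  split=> // x /AA Ax; apply: le_trans (sym_bound sf Ax) _.
  apply: le_trans (ler_wpM2r (jb_ge0 _ _) cc) _.
  by rewrite ler_wpM2l// jb_le.
case: k kk sf => [//|k] kk [h [f' hf sf]]; split.
  move=> x /AA Ax; apply: le_trans (h _ Ax) _.
  apply: le_trans (ler_wpM2r (jb_ge0 _ _) cc) _.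
  by rewrite ler_wpM2l// jb_le.
by exists f' => //; apply: IH sf => //; lra.
Qed.

Lemma sym_eq A rho k a c f g : f =1 g -> sym A rho k a c f -> sym A rho k a c g.
Proof. by move=> /funext ->. Qed.

Lemma symD A rho k a c c' f g : sym A rho k a c f -> sym A rho k a c' g ->
  sym A rho k a (c + c') (fun x => f x + g x).
Proof.
elim: k a f g => [|k IH] a f g /= [bf hf] [bg hg]; split=> //.
- by move=> x Ax; rewrite (le_trans (normcD _ _))// mulrDl lerD ?bf ?bg.
- by move=> x Ax; rewrite (le_trans (normcD _ _))// mulrDl lerD ?bf ?bg.
case: hf => f' hf sf; case: hg => g' hg sg.
by exists (fun x => f' x + g' x); [exact: is_cderD|exact: IH].
Qed.

Lemma symM A rho k a b c c' f g : 0 <= c -> 0 <= c' ->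
  sym A rho k a c f -> sym A rho k b c' g ->
  sym A rho k (a + b) (2 ^+ k * (c * c')) (fun x => f x * g x).
Proof.
move=> c0 c'0; elim: k a b f g => [|k IH] a b f g sf sg.
  split=> // x Ax; rewrite normcM expr0 mul1r jbD mulrACA.
  by rewrite ler_pM ?normc_ge0 ?(sym_bound sf) ?(sym_bound sg).
have [_ [f' hf sf']] := sf; have [_ [g' hg sg']] := sg.
split; last first.
  exists (fun x => f' x * g x + f x * g' x); first exact: is_cderM.
  rewrite exprS mulr2n mulrDl !mul1r mulrDl; apply: symD.
  - have -> : a + b - rho = (a - rho) + b by ring.
    by apply: IH => //; exact: sym_weaken sg.
  - have -> : a + b - rho = a + (b - rho) by ring.
    by apply: IH => //; exact: sym_weaken sf.
move=> x Ax; rewrite normcM jbD.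
apply: (@le_trans _ _ ((c * jb a x) * (c' * jb b x))).
  by rewrite ler_pM ?normc_ge0 ?(sym_bound sf) ?(sym_bound sg).
rewrite mulrACA -[leRHS]mulrA ler_peMl ?mulr_ge0 ?jb_ge0//.
by rewrite exprn_ege1// ler1n.
Qed.

Lemma sym_cst A rho k (z : R[i]) : 0 <= rho ->
  sym A rho k 0 (normc z) (fun=> z).
Proof.
move=> r0.
have H0 j a : sym A rho j a (normc z) (fun=> 0).
  elim: j a => [|j IH] a.
    by split=> // x Ax; rewrite normc0 mulr_ge0 ?normc_ge0 ?jb_ge0.
  apply: (symS _ (is_cder_cst 0)) => // x _.
  by rewrite normc0 mulr_ge0 ?normc_ge0 ?jb_ge0.
case: k => [|k]; first by split=> // x _; rewrite jb0 mulr1.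
by apply: (symS _ (is_cder_cst z)) => // x _; rewrite jb0 mulr1.
Qed.

Lemma symZ A rho k a c (z : R[i]) f : sym A rho k a c f ->
  sym A rho k a (normc z * c) (fun x => z * f x).
Proof.
elim: k a f => [|k IH] a f /= [bf hf]; split=> //.
- by move=> x Ax; rewrite normcM -mulrA ler_wpM2l ?normc_ge0 ?bf.
- by move=> x Ax; rewrite normcM -mulrA ler_wpM2l ?normc_ge0 ?bf.
case: hf => f' hf sf.
by exists (fun x => z * f' x); [exact: is_cderZ|exact: IH].
Qed.

Lemma symbol_eq A rho a f g : f =1 g -> symbol A rho a f -> symbol A rho a g.
Proof. by move=> /funext ->. Qed.

Lemma symbol_weaken A A' rho rho' a a' f : A' `<=` A -> rho' <= rho -> a <= a' ->
  symbol A rho a f -> symbol A' rho' a' f.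
Proof.
by move=> AA rr aa hf k; have [c c0 h] := hf k; exists c => //; exact: sym_weaken h.
Qed.

Lemma symbolD A rho a f g : symbol A rho a f -> symbol A rho a g ->
  symbol A rho a (fun x => f x + g x).
Proof.
move=> hf hg k; have [c c0 sf] := hf k; have [c' c'0 sg] := hg k.
by exists (c + c'); [exact: addr_ge0|exact: symD].
Qed.

Lemma symbolM A rho a b f g : symbol A rho a f -> symbol A rho b g ->
  symbol A rho (a + b) (fun x => f x * g x).
Proof.
move=> hf hg k; have [c c0 sf] := hf k; have [c' c'0 sg] := hg k.
exists (2 ^+ k * (c * c')); last exact: symM.
by rewrite !mulr_ge0// exprn_ge0.
Qed.

Lemma symbolZ A rho a (z : R[i]) f : symbol A rho a f ->
  symbol A rho a (fun x => z * f x).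
Proof.
move=> hf k; have [c c0 sf] := hf k.
by exists (normc z * c); [rewrite mulr_ge0 ?normc_ge0|exact: symZ].
Qed.

Lemma symbol_cst A rho (z : R[i]) : 0 <= rho -> symbol A rho 0 (fun=> z).
Proof. by move=> r0 k; exists (normc z); [exact: normc_ge0|exact: sym_cst]. Qed.

Lemma symbol_der A rho a f : symbol A rho a f ->
  is_cder f (cder f) /\ symbol A rho (a - rho) (cder f).
Proof.
move=> hf; have hd : is_cder f (cder f).
  by have [c _ [_ [f' h _]]] := hf 1%N; rewrite -(is_cderE h).
by split=> // k; have [c c0 h] := hf k.+1; exists c => //; exact: sym_der h hd.
Qed.

Lemma symbol_of_der A rho a c f f' : (forall x, A x -> normc (f x) <= c * jb a x) ->
  is_cder f f' -> symbol A rho (a - rho) f' -> symbol A rho a f.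
Proof.
move=> bf hf sf'.
have bf' (m : R) x : A x -> normc (f x) <= (`|c| + `|m|) * jb a x.
  move=> /bf/le_trans; apply; rewrite ler_wpM2r ?jb_ge0//.
  by rewrite (le_trans (ler_norm c))// lerDl.
case=> [|k]; first by exists (`|c| + `|0 : R|) => //; split=> //; exact: bf'.
have [m m0 sk] := sf' k; exists (`|c| + `|m|); first exact: addr_ge0.
apply: (symS (bf' m) hf); apply: sym_weaken sk => //.
  by rewrite (ger0_norm m0) lerDr.
Qed.

(** A linear equation [f' = p f] whose coefficient has order at most [- rho]
    propagates the bound on [f] to all its derivatives. *)
Lemma symbol_ode A rho a c f p : (forall x, A x -> normc (f x) <= c * jb a x) ->
  symbol A rho (- rho) p -> is_cder f (fun x => p x * f x) ->
  symbol A rho a f.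
Proof.
move=> bf sp hf; elim=> [|k [m m0 IH]].
  exists `|c| => //; split=> // x /bf/le_trans-> //.
  by rewrite ler_wpM2r ?jb_ge0// ler_norm.
have [p0 p00 sk] := sp k.
exists (`|c| + 2 ^+ k * (p0 * m)).
  by rewrite addr_ge0// !mulr_ge0// exprn_ge0.
apply: (symS _ hf).
  move=> x /bf/le_trans; apply; rewrite ler_wpM2r ?jb_ge0//.
  by rewrite (le_trans (ler_norm c))// lerDl !mulr_ge0// exprn_ge0.
rewrite addrC; apply: sym_weaken (symM p00 m0 sk IH) => //.
- by rewrite lerDr.
- by rewrite addr_ge0// !mulr_ge0// exprn_ge0.
Qed.

Lemma symbol_smooth A rho a f : symbol A rho a f -> csmooth f.
Proof.
move=> sf n; elim: n rho a f sf => [|n IH] rho a f /symbol_der[hf sf'] x.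
  by have [[h1 _] [h2 _]] := hf x.
by have := IH _ _ _ sf' x; rewrite /derive1n !iterSr.
Qed.

Lemma csmooth_symbol f : csmooth f -> symbol set0 0 0 f.
Proof.
move=> sf k; exists 0 => //.
have H j a g : csmooth g -> sym set0 0 j a 0 g.
  elim: j a g => [|j IH] a g sg; first by split.
  by have [hg sg'] := (csmoothP g).1 sg; apply: (symS _ hg) => //; exact: IH.
exact: H.
Qed.

Lemma csmoothM f g : csmooth f -> csmooth g -> csmooth (fun x => f x * g x).
Proof.
move=> /csmooth_symbol hf /csmooth_symbol hg.
exact: symbol_smooth (symbolM hf hg).
Qed.

Lemma csmoothD f g : csmooth f -> csmooth g -> csmooth (fun x => f x + g x).
Proof.
move=> /csmooth_symbol hf /csmooth_symbol hg.
exact: symbol_smooth (symbolD hf hg).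
Qed.

Lemma csmooth_cst (z : R[i]) : csmooth (fun=> z).
Proof. exact: symbol_smooth (@symbol_cst set0 0 z (lexx _)). Qed.

Lemma csmooth_affine f c b : csmooth f -> csmooth (fun x => f (c * x + b)).
Proof.
move=> /csmooth_symbol sf; apply: (@symbol_smooth set0 0 0) => k.
exists 0 => //; have [m _] := sf k.
have H j a d g : sym set0 0 j a d g -> sym set0 0 j a 0 (fun x => g (c * x + b)).
  elim: j a d g => [|j IH] a d g; first by split.
  move=> [_ [g' hg sg']]; apply: (symS _ (is_cder_affine c b hg)) => //.
  by have := symZ c%:C (IH _ _ _ sg'); rewrite mulr0.
exact: H.
Qed.

End symbols.

(** * Smooth cutoffs *)

Section bump.
Context {R : realType}.
Implicit Types (x : R) (j k : nat).

(** All the derivatives of [exp (-1/x)] are combinations of these functions,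
    each of which is [o(x)] at the origin. *)
Definition flat j x : R := if 0 < x then x^-1 ^+ j * expR (- x^-1) else 0.

Lemma flat_ge0 j x : 0 <= flat j x.
Proof.
rewrite /flat; case: ltP => // x0.
by rewrite mulr_ge0 ?expR_ge0// exprn_ge0// invr_ge0 ltW.
Qed.

Lemma flat_le j x : flat j x <= (j.+1)`!%:R * `|x|.
Proof.
rewrite /flat; case: ltP => x0; last by rewrite mulr_ge0.
have y0 : 0 < x^-1 by rewrite invr_gt0.
have := expR_ge1Dxn j (ltW y0); set y := x^-1 in y0 *.
rewrite gtr0_norm// -(invrK x) -/y expRN => h.
rewrite ler_pdivrMr ?expR_gt0//.
have f0 : 0 < j.+1`!%:R :> R by rewrite ltr0n fact_gt0.
apply: le_trans (_ : j.+1`!%:R / y * (y ^+ j.+1 / j.+1`!%:R) <= _); last first.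
  apply: ler_wpM2l; first by rewrite divr_ge0// ltW.
  by apply: le_trans h; rewrite lerDr.
rewrite exprS le_eqVlt; apply/orP; left; apply/eqP; field.
by rewrite !lt0r_neq0.
Qed.

Lemma flat_eq0 j x : x <= 0 -> flat j x = 0.
Proof. by move=> x0; rewrite /flat ltNge x0. Qed.

Lemma flatS j x : flat j x = flat j.+1 x * x.
Proof.
rewrite /flat; case: ltP => x0; last by rewrite mul0r.
by rewrite exprS; field; exact: lt0r_neq0.
Qed.

Lemma is_derive_flat j x :
  is_derive x 1 (flat j) (flat j.+2 x - j%:R * flat j.+1 x).
Proof.
case: (ltgtP x 0) => x0.
- apply: (@near_eq_is_derive _ _ _ (cst 0)).
    near=> y; rewrite /flat ltNge ifF//; apply/negbF/ltW.
    by near: y; exact: lt_nbhsl.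
  by apply: is_derive_eq; rewrite /flat ltNge (ltW x0)/= mulr0 subr0.
- have hV : is_derive x 1 (fun y : R => y^-1 : R) (- x^-1 ^+ 2).
    have h := is_deriveV (lt0r_neq0 x0) (is_derive_id x 1).
    by apply: (is_derive_eq h); rewrite /GRing.scale /= mulr1 exprVn.
  have hN : is_derive x 1 (fun y : R => - y^-1 : R) (x^-1 ^+ 2).
    by apply: (is_derive_eq (is_deriveN hV)); rewrite opprK.
  have hE := is_derive1_comp (g := fun y : R => - y^-1)
    (is_derive_expR (- x^-1)) hN.
  have hM := is_deriveM (is_deriveX j hV) hE.
  apply: (near_eq_is_derive _ (is_derive_eq hM _)).
    near=> y; rewrite exprfctE /flat /= ifT//.
    by near: y; exact: lt_nbhsr.
  rewrite exprfctE /flat x0 /GRing.scale /=.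
  case: (j) => [|i]; last by rewrite !exprS /=; ring.
  by rewrite !mul0r mulr0 !expr0 subr0 addr0 expr2; ring.
rewrite x0; apply/is_derive1_caratheodory; exists (flat j.+1); split.
- by move=> z; rewrite subr0 -flatS /flat ltxx subr0.
- have c0 : flat j.+1 z @[z --> (0 : R)] --> (0 : R).
    apply/cvgrPdist_le => e e0; near=> y.
    rewrite sub0r normrN ger0_norm ?flat_ge0// (le_trans (flat_le _ _))//.
    rewrite -ler_pdivlMl ?ltr0n ?fact_gt0//.
    near: y; apply: (@nbhs0_le _ R^o).
    by rewrite mulr_gt0// invr_gt0 ltr0n fact_gt0.
  by move: c0; rewrite -[X in _ --> X](flat_eq0 j.+1 (lexx 0)).
- by rewrite !flat_eq0// mulr0 subr0.
Unshelve. all: by end_near. Qed.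

Lemma csmooth_flat j : csmooth (fun x => (flat j x)%:C).
Proof.
apply: (@symbol_smooth _ set0 0 0) => k; exists 0 => //.
have H a : sym set0 0 k a 0 (fun x => (flat j x)%:C).
  elim: k j a => [|k IH] j a; first by split.
  apply: (symS _ (is_cder_real (is_derive_flat j))) => //.
  have := symD (IH j.+2 (a - 0)) (symZ (- j%:R%:C) (IH j.+1 (a - 0))).
  rewrite mulr0 addr0; apply: sym_eq => x.
  by rewrite -realCN -realCM -realCD mulNr.
exact: H.
Qed.

Lemma sym_set0 (a a' c c' : R) k (f : R -> R[i]) :
  sym set0 0 k a c f -> sym set0 0 k a' c' f.
Proof.
elim: k a a' f => [|k IH] a a' f; first by split.
by move=> [_ [f' hf sf]]; apply: (symS _ hf) => //; exact: IH sf.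
Qed.

Lemma csmooth_inv (h : R -> R) : (forall x, h x != 0) ->
  csmooth (fun x => (h x)%:C) -> csmooth (fun x => ((h x)^-1)%:C).
Proof.
move=> h0 sh; have [hh sh'] := (csmoothP _).1 sh.
pose h' x := Re (cder (fun x => (h x)%:C) x).
have dh x : is_derive x 1 h (h' x).
  by have [hx _] := hh x; exact: hx.
have dg x : is_derive x 1 (fun y => (h y)^-1 : R) (- h' x * (h x)^-1 * (h x)^-1).
  apply: (is_derive_eq (is_deriveV (h0 x) (dh x))).
  by rewrite /GRing.scale /= expr2 invfM; ring.
have sh'' : csmooth (fun x => (h' x)%:C).
  have -> : (fun x => (h' x)%:C) = cder (fun x => (h x)%:C).
    apply/funext => x; apply: complex_eqP => //=.
    by rewrite derive1E derive_cst.
  exact: sh'.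
apply: (@symbol_smooth _ set0 0 0) => k; exists 0 => //.
have H a : sym set0 0 k a 0 (fun x => ((h x)^-1)%:C).
  elim: k a => [|k IH] a; first by split.
  apply: (symS _ (is_cder_real dg)) => //.
  have [c c0 s1] := csmooth_symbol sh'' k.
  have s1' := sym_set0 0 0 (symZ (-1) s1).
  have l0 := lexx (0 : R).
  have := symM l0 l0 (sym_set0 0 0 (symM l0 l0 s1' (IH 0))) (IH (a - 0)).
  rewrite !(mulr0,add0r); apply: sym_eq => x.
  by rewrite mulN1r -realCN -!realCM.
exact: H.
Qed.

(** Smooth, zero on [x <= 0], one on [1 <= x], with values in [[0, 1]]. *)
Definition smoothstep x : R := flat 0 x / (flat 0 x + flat 0 (1 - x)).

Lemma flat_gt0 j x : 0 < x -> 0 < flat j x.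
Proof. by move=> x0; rewrite /flat x0 mulr_gt0 ?expR_gt0// exprn_gt0// invr_gt0. Qed.

Lemma smoothstep_den x : 0 < flat 0 x + flat 0 (1 - x).
Proof.
have [x0|x0] := ltP 0 x; first by rewrite ltr_pwDl ?flat_gt0 ?flat_ge0.
by rewrite ltr_wpDl ?flat_ge0// flat_gt0//; lra.
Qed.

Lemma smoothstep0 x : x <= 0 -> smoothstep x = 0.
Proof. by move=> x0; rewrite /smoothstep flat_eq0// mul0r. Qed.

Lemma smoothstep1 x : 1 <= x -> smoothstep x = 1.
Proof.
move=> x1; rewrite /smoothstep (@flat_eq0 _ (1 - x)) ?addr0 ?divff//; last lra.
by rewrite lt0r_neq0// flat_gt0//; lra.
Qed.

Lemma smoothstep_ge0 x : 0 <= smoothstep x.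
Proof. by rewrite divr_ge0 ?flat_ge0// ltW// smoothstep_den. Qed.

Lemma smoothstep_le1 x : smoothstep x <= 1.
Proof. by rewrite ler_pdivrMr ?smoothstep_den// mul1r lerDl flat_ge0. Qed.

Lemma csmooth_smoothstep : csmooth (fun x => (smoothstep x)%:C).
Proof.
have s0 := csmooth_flat 0.
have s1 : csmooth (fun x => (flat 0 (1 - x))%:C).
  have -> : (fun x => (flat 0 (1 - x))%:C) =
            (fun x => (flat 0 ((-1) * x + 1))%:C).
    by apply/funext => x; rewrite mulN1r addrC.
  exact: (csmooth_affine (-1) 1 s0).
have s2 : csmooth (fun x => (flat 0 x + flat 0 (1 - x))%:C).
  have -> : (fun x => (flat 0 x + flat 0 (1 - x))%:C) =
     (fun x => (flat 0 x)%:C + (flat 0 (1 - x))%:C :> R[i]).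
    by apply/funext => x; rewrite realCD.
  exact: csmoothD.
have := csmoothM s0 (csmooth_inv (fun x => lt0r_neq0 (smoothstep_den x)) s2).
congr csmooth; apply/funext => x; exact/esym/realCM.
Qed.

Definition cutoff x : R := smoothstep (2 - x) * smoothstep (2 + x).

Lemma cutoff1 x : `|x| <= 1 -> cutoff x = 1.
Proof.
by rewrite ler_norml => /andP[x1 x2]; rewrite /cutoff !smoothstep1 ?mulr1//; lra.
Qed.

Lemma cutoff0 x : 2 <= `|x| -> cutoff x = 0.
Proof.
rewrite ler_normr => /orP[x1|x1]; rewrite /cutoff.
  by rewrite smoothstep0 ?mul0r//; lra.
by rewrite [X in _ * X]smoothstep0 ?mulr0//; lra.
Qed.

Lemma cutoff_ge0 x : 0 <= cutoff x.
Proof. by rewrite mulr_ge0 ?smoothstep_ge0. Qed.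

Lemma cutoff_le1 x : cutoff x <= 1.
Proof. by rewrite mulr_ile1 ?smoothstep_ge0 ?smoothstep_le1. Qed.

Lemma csmooth_cutoff : csmooth (fun x => (cutoff x)%:C).
Proof.
have := csmoothM (csmooth_affine (-1) 2 csmooth_smoothstep)
  (csmooth_affine 1 2 csmooth_smoothstep).
congr csmooth; apply/funext => x.
by rewrite /cutoff realCM mulN1r mul1r ![_ + 2]addrC.
Qed.

End bump.

(** * Concrete symbols *)

Section concrete_symbols.
Context {R : realType}.
Implicit Types (f g : R -> R[i]) (A : set R) (a b c rho : R) (k : nat).

Lemma is_cder_vanish (O : set R) f f' : open O -> (forall x, O x -> f x = 0) ->
  is_cder f f' -> forall x, O x -> f' x = 0.
Proof.
move=> oO fO hf x Ox; have [h1 h2] := hf x.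
have nO : \forall y \near x, O y by exact: open_nbhs_nbhs.
have k1 : is_derive x 1 (cst (0 : R)) (Re (f' x)).
  apply: near_eq_is_derive h1; near=> y.
  by rewrite /= fO//; near: y.
have k2 : is_derive x 1 (cst (0 : R)) (Im (f' x)).
  apply: near_eq_is_derive h2; near=> y.
  by rewrite /= fO//; near: y.
apply: complex_eqP.
- by have [_ <-] := k1; rewrite derive_cst.
- by have [_ <-] := k2; rewrite derive_cst.
Unshelve. all: by end_near. Qed.

Lemma sym_extend A (O : set R) rho k a c f : open O -> ~` A `<=` O ->
  (forall x, O x -> f x = 0) -> 0 <= c ->
  sym A rho k a c f -> sym setT rho k a c f.
Proof.
move=> oO AO + c0; elim: k a f => [|k IH] a f fO sf.
  split=> // x _; have [Ax|/AO Ox] := pselect (A x); first exact: (sym_bound sf).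
  by rewrite fO// normc0 mulr_ge0// jb_ge0.
have [bf [f' hf sf']] := sf; apply: (symS _ hf).
  move=> x _; have [Ax|/AO Ox] := pselect (A x); first exact: bf.
  by rewrite fO// normc0 mulr_ge0// jb_ge0.
by apply: IH => //; exact: is_cder_vanish hf.
Qed.

Lemma csmooth_continuous f : csmooth f -> ccontinuous f.
Proof. by move=> /csmoothP[hf _]; exact: is_cder_continuous hf. Qed.

Lemma symbol_id A rho : 0 <= rho <= 1 ->
  symbol A rho 1 (fun x => x%:C).
Proof.
move=> /andP[r0 r1]; apply: (symbol_of_der (c := 1)) is_cder_id _.
  by move=> x _; rewrite mul1r normcR normr_le_jb1.
by apply: symbol_weaken (symbol_cst A 1 r0) => //; rewrite subr_ge0.
Qed.

Lemma symbol_jb A rho a : 0 <= rho <= 1 ->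
  symbol A rho a (fun x => (jb a x)%:C).
Proof.
move=> /andP[r0 r1] k; elim: k a => [|k IH] a.
  by exists 1 => //; split=> // x _; rewrite mul1r normcR ger0_norm ?jb_ge0.
have [c c0 sc] := IH (a - 2).
have r01 : 0 <= rho <= 1 by rewrite r0.
have [d d0 sd] := symbol_id A r01 k.
pose e := normc a%:C * (2 ^+ k * (d * c)).
have e0 : 0 <= e by rewrite !mulr_ge0 ?normc_ge0// exprn_ge0.
exists (1 + e); first by rewrite addr_ge0.
apply: (symS _ (is_cder_real (is_derive_jb a))).
  move=> x _; rewrite normcR ger0_norm ?jb_ge0// ler_peMl ?jb_ge0//.
  by rewrite lerDl.
apply: (sym_eq (f := fun x => a%:C * (x%:C * (jb (a - 2) x)%:C))).
  by move=> x; rewrite -!realCM mulrA.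
apply: sym_weaken (symZ a%:C (symM d0 c0 sd sc)) => //; rewrite ?lerDr//.
- by lra.
- by rewrite addr_ge0.
Qed.

Lemma csmooth_jb a : csmooth (fun x => (jb a x)%:C).
Proof. by apply: (symbol_smooth (symbol_jb set0 (rho := 0) a _)); rewrite lexx ler01. Qed.

Lemma ccontinuous_bounded f (r : R) : 0 <= r -> ccontinuous f ->
  exists2 c, 0 <= c & forall x, `|x| <= r -> normc (f x) <= c.
Proof.
move=> r0 [cf1 cf2].
have H (g : R -> R) : continuous g ->
    exists2 c, 0 <= c & forall x, `|x| <= r -> `|g x| <= c.
  move=> cg; have rr : - r <= r by lra.
  have cng : {within `[- r, r], continuous (fun x => `|g x|)}.
    apply: continuous_subspaceT => x.
    by apply: continuous_comp; [exact: cg|exact: norm_continuous].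
  have [c _ hc] := EVT_max rr cng; exists `|g c| => // x.
  by rewrite ler_norml => xr; apply: hc; rewrite in_itv.
have [c1 c10 h1] := H _ cf1; have [c2 c20 h2] := H _ cf2.
exists (c1 + c2); first exact: addr_ge0.
by move=> x xr; rewrite (le_trans (normc_le _))// lerD ?h1 ?h2.
Qed.

Lemma open_abs_gt (r : R) : open [set x : R | r < `|x|].
Proof.
apply: (@open_comp _ _ (@Num.norm R R^o) [set x | r < x]); last exact: open_gt.
by move=> x _; apply: (@norm_continuous _ R^o).
Qed.

Lemma open_abs_lt (r : R) : open [set x : R | `|x| < r].
Proof.
apply: (@open_comp _ _ (@Num.norm R R^o) [set x | x < r]); last exact: open_lt.
by move=> x _; apply: (@norm_continuous _ R^o).
Qed.

(** All derivatives of a smooth function of compact support are rapidly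
    decreasing. *)
Lemma symbol_compact f (r : R) rho a : csmooth f ->
  (forall x, r < `|x| -> f x = 0) -> symbol setT rho a f.
Proof.
move=> sf f0 k.
wlog r0 : r f0 / 0 <= r.
  move=> /(_ (Num.max r 0)); apply; last by rewrite le_max lexx orbT.
  by move=> x; rewrite gt_max => /andP[/f0].
have oO := @open_abs_gt r.
have H b g : csmooth g -> (forall x, r < `|x| -> g x = 0) ->
    exists2 c, 0 <= c & forall x, normc (g x) <= c * jb b x.
  move=> sg g0.
  have cg := csmooth_continuous (csmoothM sg (csmooth_jb (- b))).
  have [c c0 h] := ccontinuous_bounded r0 cg; exists c => // x.
  have [xr|rx] := leP `|x| r; last first.
    by rewrite g0// normc0 mulr_ge0// jb_ge0.
  have := h _ xr; rewrite normcM normcR ger0_norm ?jb_ge0// jbN.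
  by rewrite ler_pdivrMr ?jb_gt0.
elim: k a f sf f0 => [|k IH] a f sf f0; have [c c0 h] := H a f sf f0.
  by exists c => //; split.
have [hf sf'] := (csmoothP f).1 sf.
have [c' c'0 h'] := IH (a - rho) _ sf' (is_cder_vanish oO f0 hf).
exists (c + c'); first exact: addr_ge0.
apply: (symS _ hf).
  by move=> x _; rewrite (le_trans (h _))// ler_wpM2r ?jb_ge0// lerDl.
by apply: sym_weaken h'; rewrite ?lerDr ?addr_ge0.
Qed.

End concrete_symbols.

(** * The phase of the flow *)

Section wave.
Context {R : realType}.
Implicit Types (A : set R) (t x n : R).

Definition wave t (n : R) : R[i] := expi (- (t * Num.sqrt (1 + n ^+ 2))).

Lemma waveE t n : wave t n = expi (- t * jb 1 n).
Proof. by rewrite /wave jb1 mulNr. Qed.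

Lemma normc_wave t n : normc (wave t n) = 1. Proof. exact: normc_expi. Qed.

Lemma wave_opp t n : wave (- t) n * wave t n = 1.
Proof. by rewrite /wave -expiD mulNr opprK subrr expi0. Qed.

Lemma is_cder_expi_linear t : is_cder (fun n => expi (t * n))
  (fun n => 'i * t%:C * expi (t * n)).
Proof.
apply: is_cder_expi => x.
apply: (is_derive_eq (is_deriveM (is_derive_cst t x 1) (is_derive_id x 1))).
by rewrite /GRing.scale /= mulr0 addr0 mulr1.
Qed.

Lemma is_derive_mulc (t : R) (q : R -> R) (q' x : R) : is_derive x 1 q q' ->
  is_derive x 1 (fun n => t * q n : R) (t * q').
Proof.
move=> hq; apply: (is_derive_eq (is_deriveM (is_derive_cst t x 1) hq)).
by rewrite /GRing.scale /= mulr0 addr0.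
Qed.

Lemma symbol_wave t : symbol setT 0 0 (wave t).
Proof.
have r01 : (0 : R) <= 0 <= (1 : R) by rewrite lexx ler01.
pose p (x : R) := 'i * (- t * (1 * x * jb (1 - 2) x))%:C.
have hd : is_cder (wave t) (fun x => p x * wave t x).
  have := is_cder_expi (fun x => is_derive_mulc (- t) (is_derive_jb 1 x)).
  by apply: is_cder_eq => x; rewrite waveE.
apply: (symbol_ode (c := 1)) hd.
- by move=> x _; rewrite normc_wave jb0 mulr1.
- apply: (symbol_eq (f := fun x => ('i * (- t)%:C) * (x%:C * (jb (1 - 2) x)%:C))).
    by move=> x; rewrite /p mul1r -mulrA -!realCM.
  apply/symbolZ.
  apply: symbol_weaken (symbolM (symbol_id setT r01) (symbol_jb setT (1 - 2) r01)) => //.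
  by rewrite oppr0; lra.
Qed.

Lemma symbol_smoothstep : symbol setT 1 0 (fun x : R => (smoothstep x)%:C).
Proof.
have [hf sf'] := (csmoothP _).1 (@csmooth_smoothstep R).
apply: (symbol_of_der (c := 1) _ hf).
  move=> x _; rewrite normcR jb0 mulr1 ger0_norm ?smoothstep_ge0//.
  exact: smoothstep_le1.
apply: (@symbol_compact _ _ 1) => // x.
rewrite ltr_normr => /orP[x1|x1].
  have := is_cder_vanish (open_gt (y := 1)) _ (is_cderD hf (is_cder_cst (-1))).
  move=> /(_ _ x x1); rewrite addr0; apply => y y1.
  by rewrite smoothstep1 ?ltW// subrr.
apply: (is_cder_vanish (open_lt (y := 0)) _ hf) => [y y0|/=]; last by lra.
by rewrite smoothstep0// ltW.
Qed.

Lemma jb1_sub x : 0 <= x -> jb 1 x - x <= jb (-1) x.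
Proof.
move=> x0; have h := jb_gt0 1 x.
rewrite jbN -div1r ler_pdivlMr// mulrBl -expr2 -(jb_nat 2) jb2.
have : x * x <= x * jb 1 x.
  by rewrite ler_wpM2l// (le_trans (ler_norm x))// normr_le_jb1.
by rewrite -expr2; lra.
Qed.

(** The half of the wave symbol carried by positive frequencies, with the
    transport phase [expi (- t n)] removed; [wave_minus] is the other half. *)
Definition wave_plus t n : R[i] :=
  (smoothstep n)%:C * expi (- t * (jb 1 n - n)).

Definition wave_minus t n : R[i] :=
  (1 - smoothstep n)%:C * expi (- t * (jb 1 n + n)).

Lemma wave_decomp t n :
  wave t n = expi (- t * n) * wave_plus t n + expi (t * n) * wave_minus t n.
Proof.
rewrite /wave_plus /wave_minus !(mulrCA (expi _)) -!expiD waveE.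
have -> : - t * n + - t * (jb 1 n - n) = - t * jb 1 n by ring.
have -> : t * n + - t * (jb 1 n + n) = - t * jb 1 n by ring.
by rewrite -mulrDl -realCD addrC subrK mul1r.
Qed.

(** On a half line where [q = jb 1 n -+ n] is [O(1/n)], the equation
    [q' = -+ q / jb 1 n] makes [q], hence [expi (- t q)], a symbol. *)
Lemma symbol_half_phase A t (e c : R) :
  (e = 1 \/ e = -1) -> (forall x, A x -> jb 1 x + e * x <= c * jb (-1) x) ->
  symbol A 1 0 (fun n => expi (- t * (jb 1 n + e * n))).
Proof.
move=> he hq.
have r01 : (0 : R) <= 1 <= (1 : R) by rewrite lexx ler01.
have ee : e * e = 1 by case: he => ->; rewrite ?mulrNN mulr1.
have e1 : `|e| = 1 by case: he => ->; rewrite ?normrN normr1.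
pose q x := jb 1 x + e * x.
have dq x : is_derive x 1 (q : R -> R) (e * jb (-1) x * q x).
  apply: (is_derive_eq (is_deriveD (is_derive_jb 1 x)
    (is_derive_mulc e (is_derive_id x 1)))).
  rewrite /q mul1r mulr1 -mulrA mulrDr -jbD addrC.
  rewrite (_ : -1 + 1 = 0 :> R); last by ring.
  rewrite (_ : 1 - 2 = -1 :> R); last by ring.
  rewrite jb0 mulrDr mulr1; congr (_ + _).
  by rewrite mulrCA (mulrA e) ee mul1r mulrC.
have q0 x : 0 <= q x.
  have := normr_le_jb1 x; have : `|e * x| = `|x| by rewrite normrM e1 mul1r.
  by rewrite /q; have := ler_norm (- (e * x)); rewrite normrN; lra.
have sq : symbol A 1 (-1) (fun x => (q x)%:C).
  have hd : is_cder (fun x => (q x)%:C)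
      (fun x => (e%:C * (jb (-1) x)%:C) * (q x)%:C).
    by apply: is_cder_eq (is_cder_real dq) => // x; rewrite !realCM.
  apply: (symbol_ode (c := c)) hd.
  - by move=> x Ax; rewrite normcR ger0_norm// hq.
  - exact: (symbolZ e%:C (symbol_jb A (-1) r01)).
have he' := is_cder_expi (fun x => is_derive_mulc (- t) (dq x)).
apply: (symbol_ode (c := 1)) he'.
- by move=> x _; rewrite normc_expi jb0 mulr1.
- apply: (symbol_eq
    (f := fun x => ('i * (- t * e)%:C) * ((jb (-1) x)%:C * (q x)%:C))).
    by move=> x; rewrite -!mulrA -!realCM !mulrA.
  by apply: symbol_weaken (symbolZ _ (symbolM (symbol_jb A (-1) r01) sq)) => //; lra.
Qed.

Lemma symbol_wave_plus t : symbol setT 1 0 (wave_plus t).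
Proof.
pose A := [set x : R | 0 <= x].
have s1 := symbol_weaken (@subsetT _ A) (lexx 1) (lexx 0) symbol_smoothstep.
have s2 : symbol A 1 0 (fun n => expi (- t * (jb 1 n - n))).
  apply: (symbol_eq (f := fun n => expi (- t * (jb 1 n + (-1) * n)))).
    by move=> n; rewrite mulN1r.
  apply: (symbol_half_phase t (c := 1) (or_intror erefl)) => x Ax.
  by rewrite mulN1r mul1r jb1_sub.
move=> k; have [c c0 h] := symbolM s1 s2 k; exists c => //.
rewrite addr0 in h; apply: (sym_extend (open_lt (y := 0))) h => //.
- by move=> x /negP; rewrite -ltNge.
- by move=> x x0; rewrite /wave_plus smoothstep0 ?mul0r// ltW.
Qed.

Lemma symbol_wave_minus t : symbol setT 1 0 (wave_minus t).
Proof.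
pose A := [set x : R | x <= 1].
have s1 : symbol A 1 0 (fun x : R => (1 - smoothstep x)%:C).
  have := symbolD (symbol_cst A 1 ler01) (symbolZ (-1)
    (symbol_weaken (@subsetT _ A) (lexx 1) (lexx 0) symbol_smoothstep)).
  by apply: symbol_eq => x; rewrite mulN1r -realCN -realCD.
have s2 : symbol A 1 0 (fun n => expi (- t * (jb 1 n + n))).
  apply: (symbol_eq (f := fun n => expi (- t * (jb 1 n + 1 * n)))).
    by move=> n; rewrite mul1r.
  apply: (symbol_half_phase t (c := 6) (or_introl erefl)) => x Ax.
  rewrite mul1r; have [x0|x0] := leP x 0.
    have := @jb1_sub (- x); rewrite !jb_even opprK oppr_ge0 => /(_ x0).
    have := jb_gt0 (-1) x; lra.
  have h : jb 1 x <= 2.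
    rewrite jb1 -[leRHS]ger0_norm// -sqrtr_sqr ler_wsqrtr//.
    have : x * x <= 1 by rewrite mulr_ile1// ltW.
    by rewrite -expr2; lra.
  rewrite jbN ler_pdivlMr ?jb_gt0//.
  have := jb_gt0 1 x => ?.
  apply: le_trans (_ : (2 + 1) * 2 <= _); last by lra.
  by rewrite ler_pM ?lerD ?addr_ge0// ltW.
move=> k; have [c c0 h] := symbolM s1 s2 k; exists c => //.
rewrite addr0 in h; apply: (sym_extend (open_gt (y := 1))) h => //.
- by move=> x /negP; rewrite -ltNge.
- by move=> x x0; rewrite /wave_minus smoothstep1 ?subrr ?mul0r// ltW.
Qed.

End wave.

(** * The Schwartz space *)

Section schwartz_space.
Context {R : realType}.
Implicit Types (f g : R -> R[i]) (A : set R) (a c : R) (k : nat).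

Lemma sym_of_cderiven A k a c f : csmooth f ->
  (forall j x, (j <= k)%N -> A x -> normc (cderiven j f x) <= c * jb a x) ->
  sym A 0 k a c f.
Proof.
elim: k a f => [|k IH] a f sf h.
  by split=> // x Ax; have := h 0%N x (leqnn _) Ax; rewrite cderiven0.
have [hf sf'] := (csmoothP f).1 sf; apply: (symS _ hf).
  by move=> x Ax; have := h 0%N x isT Ax; rewrite cderiven0.
by apply: IH => // j x jk Ax; rewrite subr0 -cderivenSr; exact: h.
Qed.

Lemma sym_cderiven A k a c f j x : sym A 0 k a c f -> (j <= k)%N -> A x ->
  normc (cderiven j f x) <= c * jb a x.
Proof.
elim: j k a f => [|j IH] k a f sf jk Ax.
  by rewrite cderiven0; exact: (sym_bound sf).
case: k sf jk => [//|k] sf jk.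
have [_ [f' hf sf']] := sf; rewrite cderivenSr -(is_cderE hf).
by rewrite -(subr0 a); exact: IH sf' _ _.
Qed.

Lemma jb_nat_le (N : nat) x : jb N%:R x <= 2 ^+ N * Num.max 1 (`|x| ^+ N) :> R.
Proof.
rewrite jb_nat; have [x1|x1] := leP `|x| 1.
  apply: le_trans (_ : 2 ^+ N * 1 <= _).
    rewrite mulr1 lerXn2r ?nnegrE ?jb_ge0//.
    rewrite jb1 -[leRHS]ger0_norm// -sqrtr_sqr ler_wsqrtr//.
    have : `|x| ^+ 2 <= 1 by rewrite exprn_ile1.
    by rewrite real_normK ?num_real//; lra.
  by rewrite ler_wpM2l ?exprn_ge0// le_max lexx.
apply: le_trans (_ : 2 ^+ N * `|x| ^+ N <= _).
  rewrite -exprMn lerXn2r ?nnegrE ?jb_ge0 ?mulr_ge0//.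
  rewrite jb1 -[leRHS]ger0_norm ?mulr_ge0// -sqrtr_sqr ler_wsqrtr//.
  have : 1 <= `|x| ^+ 2 by rewrite exprn_ege1// ltW.
  by rewrite exprMn real_normK ?num_real//; lra.
by rewrite ler_wpM2l ?exprn_ge0// le_max lexx orbT.
Qed.

Lemma seminorm_leP (a b : nat) (f : R -> R[i]) (e : R) :
  (schwartz_seminorm a b f <= e%:E)%E <->
  forall x, `|x| ^+ a * normc (cderiven b f x) <= e.
Proof.
split=> [h x|h]; last first.
  by apply: ge_ereal_sup => _ [x _ <-]; rewrite lee_fin.
by rewrite -lee_fin; apply: le_trans h; apply: ereal_sup_ubound; exists x.
Qed.

Lemma seminorm_ge0 (a b : nat) (f : R -> R[i]) :
  (0 <= schwartz_seminorm a b f)%E.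
Proof.
apply: le_trans (ereal_sup_ubound _); last by exists 0.
by rewrite lee_fin mulr_ge0 ?normc_ge0// exprn_ge0.
Qed.

Lemma sym_of_seminorm (N k : nat) (e : R) f : csmooth f ->
  (forall j, (j <= k)%N -> (schwartz_seminorm 0 j f <= e%:E)%E) ->
  (forall j, (j <= k)%N -> (schwartz_seminorm N j f <= e%:E)%E) ->
  sym setT 0 k (- N%:R) (2 ^+ N * e) f.
Proof.
move=> sf h0 hN; apply: sym_of_cderiven => // j x jk _.
rewrite jbN ler_pdivlMr ?jb_gt0//.
apply: le_trans (ler_wpM2l (normc_ge0 _) (jb_nat_le N x)) _.
rewrite mulrCA ler_wpM2l ?exprn_ge0// mulrC.
rewrite /Num.max; case: ifP => _; first exact: (seminorm_leP _ _ _ _).1 (hN _ jk) x.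
by have := (seminorm_leP _ _ _ _).1 (h0 _ jk) x; rewrite expr0.
Qed.

Lemma seminorm_of_sym (N k j : nat) (e : R) f : (j <= k)%N ->
  sym setT 0 k (- N%:R) e f -> (schwartz_seminorm N j f <= e%:E)%E.
Proof.
move=> jk sf; apply/seminorm_leP => x.
have := sym_cderiven sf jk (I : setT x).
rewrite jbN ler_pdivlMr ?jb_gt0//; apply: le_trans.
rewrite mulrC ler_wpM2l ?normc_ge0// jb_nat lerXn2r ?nnegrE ?jb_ge0//.
exact: normr_le_jb1.
Qed.

Lemma exists_natN_le a : exists N : nat, - N%:R <= a.
Proof.
exists (Num.bound `|a|); rewrite lerNl ltW//.
by rewrite (@le_lt_trans _ _ `|a|) ?archi_boundP// -normrN ler_norm.
Qed.

Lemma schwartzP f : schwartz f <-> forall a, symbol setT 0 a f.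
Proof.
split=> [[sf h] a k|h].
  have [N aN] := exists_natN_le a.
  pose e := \sum_(j < k.+1)
    (fine (schwartz_seminorm 0 j f) + fine (schwartz_seminorm N j f)).
  have s0 i j : 0 <= fine (schwartz_seminorm i j f).
    by rewrite fine_ge0 ?seminorm_ge0.
  have fs i j : (schwartz_seminorm i j f = (fine (schwartz_seminorm i j f))%:E)%E.
    by rewrite fineK// ge0_fin_numE ?seminorm_ge0// h.
  have e0 : 0 <= e by apply: sumr_ge0 => j _; rewrite addr_ge0.
  have H i j : (i = 0 \/ i = N)%N -> (j <= k)%N ->
      (schwartz_seminorm i j f <= e%:E)%E.
    move=> hi jk; rewrite fs lee_fin /e -ltnS in jk *.
    rewrite (bigD1 (Ordinal jk))//= ler_wpDr//.
      by apply: sumr_ge0 => l _; rewrite addr_ge0.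
    by case: hi => ->; rewrite ?lerDl ?lerDr.
  exists (2 ^+ N * e); first by rewrite mulr_ge0// exprn_ge0.
  apply: sym_weaken (sym_of_seminorm (N := N) (k := k) (e := e) sf _ _) => //.
  - by rewrite mulr_ge0// exprn_ge0.
  - by move=> j; apply: H; left.
  - by move=> j; apply: H; right.
split; first exact: symbol_smooth (h 0).
move=> N j; have [c c0 sc] := h (- N%:R) j.
by rewrite (le_lt_trans (seminorm_of_sym (leqnn j) sc))// ltry.
Qed.

Definition szero (f_ : nat -> R -> R[i]) := forall k a (e : R), 0 < e ->
  \forall n \near \oo, sym setT 0 k a e (f_ n).

Lemma szero_cvg (f_ : nat -> R -> R[i]) (a b : nat) : szero f_ ->
  schwartz_seminorm a b (f_ n) @[n --> \oo] --> (0 : \bar R).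
Proof.
move=> sf; apply/fine_cvgP; split.
  near=> n.
  have h : (schwartz_seminorm a b (f_ n) <= 1%:E)%E.
    by apply: (seminorm_of_sym (leqnn b)); near: n; exact: sf.
  by rewrite ge0_fin_numE ?seminorm_ge0// (le_lt_trans h)// ltry.
apply/cvgrPdist_le => e e0; near=> n.
have h : (schwartz_seminorm a b (f_ n) <= e%:E)%E.
  by apply: (seminorm_of_sym (leqnn b)); near: n; exact: sf.
rewrite /= sub0r normrN ger0_norm ?fine_ge0 ?seminorm_ge0//.
by rewrite -lee_fin fineK// ge0_fin_numE ?seminorm_ge0// (le_lt_trans h)// ltry.
Unshelve. all: by end_near. Qed.

Lemma cvg_szero (f_ : nat -> R -> R[i]) : (forall n, schwartz (f_ n)) ->
  (forall a b : nat, schwartz_seminorm a b (f_ n) @[n --> \oo] --> (0 : \bar R)) ->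
  szero f_.
Proof.
move=> sf h k a e e0.
have [N aN] := exists_natN_le a.
have e'0 : 0 < e / 2 ^+ N by rewrite divr_gt0// exprn_gt0.
have H1 i j : \forall n \near \oo,
    (schwartz_seminorm i j (f_ n) <= (e / 2 ^+ N)%:E)%E.
  have /fine_cvgP[h1 /cvgrPdist_le h2] := h i j; near=> n.
  have fn : schwartz_seminorm i j (f_ n) \is a fin_num by near: n.
  rewrite -(fineK fn) lee_fin.
  apply: le_trans (ler_norm _) _; rewrite -normrN -sub0r.
  by near: n; exact: h2.
have H i : \forall n \near \oo, forall j, (j <= k)%N ->
    (schwartz_seminorm i j (f_ n) <= (e / 2 ^+ N)%:E)%E.
  elim: k => [|k IH].
    by have := H1 i 0%N; apply: filterS => n hn j; rewrite leqn0 => /eqP ->.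
  have := H1 i k.+1; apply: filterS2 IH => n hn hn' j.
  by rewrite leq_eqVlt => /orP[/eqP -> //|]; exact: hn.
near=> n.
have [s1 s2] : sym setT 0 k (- N%:R) (2 ^+ N * (e / 2 ^+ N)) (f_ n) /\ True.
  split=> //; apply: sym_of_seminorm; first exact: (sf n).1.
    by near: n; exact: H.
  by near: n; exact: H.
apply: sym_weaken s1 => //; last exact: ltW.
by rewrite mulrC divfK// lt0r_neq0// exprn_gt0.
Unshelve. all: by end_near. Qed.

Lemma tempered_cvg (u : functional R) (f_ : nat -> R -> R[i]) : tempered u ->
  (forall n, schwartz (f_ n)) -> szero f_ ->
  normc (u (f_ n)) @[n --> \oo] --> (0 : R).
Proof. by move=> [_ _ h] sf zf; apply: h => // a b; exact: szero_cvg. Qed.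

(** Continuity of an operator on the Schwartz space, in the quantitative form
    that survives composition. *)
Definition scont (T : (R -> R[i]) -> R -> R[i]) := forall k a,
  exists k' a' C, 0 <= C /\ forall f c, 0 <= c -> schwartz f ->
    sym setT 0 k' a' c f -> sym setT 0 k a (C * c) (T f).

Lemma scont_schwartz T f : scont T -> schwartz f -> schwartz (T f).
Proof.
move=> hT sf; apply/schwartzP => a k; have [k' [a' [C [C0 h]]]] := hT k a.
have [c c0 sc] := (schwartzP f).1 sf a' k'.
by exists (C * c); [rewrite mulr_ge0|exact: h].
Qed.

Lemma scont_szero T (f_ : nat -> R -> R[i]) : scont T ->
  (forall n, schwartz (f_ n)) -> szero f_ -> szero (fun n => T (f_ n)).
Proof.
move=> hT sf zf k a e e0; have [k' [a' [C [C0 h]]]] := hT k a.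
have e'0 : 0 < e / (C + 1) by rewrite divr_gt0// ltr_wpDl.
have := zf k' a' _ e'0; apply: filterS => n sn.
have := h _ _ (ltW e'0) (sf n) sn; apply: sym_weaken => //; last exact: ltW.
rewrite mulrA ler_pdivrMr ?ltr_wpDl// mulrC ler_wpM2l ?lerDl// ltW//.
Qed.

Lemma scont_comp T U : scont T -> scont U -> scont (fun f => T (U f)).
Proof.
move=> hT hU k a; have [k1 [a1 [C1 [C10 h1]]]] := hT k a.
have [k2 [a2 [C2 [C20 h2]]]] := hU k1 a1.
exists k2, a2, (C1 * C2); split; first by rewrite mulr_ge0.
move=> f c c0 sf s2; rewrite -mulrA; apply: h1; rewrite ?mulr_ge0//.
  exact: scont_schwartz.
exact: h2.
Qed.

Lemma scont_mul a (m : R -> R[i]) : symbol setT 0 a m ->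
  scont (fun f x => m x * f x).
Proof.
move=> sm k b; have [c c0 sc] := sm k.
exists k, (b - a), (2 ^+ k * c); split; first by rewrite mulr_ge0// exprn_ge0.
move=> f d d0 sf sd; rewrite -mulrA.
by have := symM c0 d0 sc sd; rewrite addrC subrK.
Qed.

Lemma schwartzD f g : schwartz f -> schwartz g -> schwartz (fun x => f x + g x).
Proof.
by move=> /schwartzP hf /schwartzP hg; apply/schwartzP => a; exact: symbolD.
Qed.

Lemma schwartzZ (z : R[i]) f : schwartz f -> schwartz (fun x => z * f x).
Proof. by move=> /schwartzP hf; apply/schwartzP => a; exact: symbolZ. Qed.

Lemma schwartz0 : schwartz (fun=> 0 : R[i]).
Proof.
apply/schwartzP => a k; exists 0 => //; elim: k a => [|k IH] a.
  by split=> // x _; rewrite normc0 mul0r.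
by apply: (symS _ (is_cder_cst 0)) => // x _; rewrite normc0 mul0r.
Qed.

Lemma schwartz_compact f (r : R) : csmooth f ->
  (forall x, r < `|x| -> f x = 0) -> schwartz f.
Proof. by move=> sf f0; apply/schwartzP => a; exact: symbol_compact f0. Qed.

Lemma schwartz_smooth f : schwartz f -> csmooth f. Proof. by case. Qed.

End schwartz_space.

(** * Integrals of complex-valued functions *)

Section complex_integral.
Context {R : realType}.
Let mu := @lebesgue_measure R.
Implicit Types (f g : R -> R[i]) (D : set R) (h : R -> R).

Local Notation mR D := (@measurable _ (measurableTypeR R) D).

Definition cintegrable D f : Prop :=
  mu.-integrable D (EFin \o (Re \o f)) /\ mu.-integrable D (EFin \o (Im \o f)).

Lemma cintegrable_meas D f : cintegrable D f -> cmeasurable_fun D f.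
Proof.
move=> [h1 h2]; split; apply/measurable_EFinP.
- exact: (measurable_int mu h1).
- exact: (measurable_int mu h2).
Qed.

Lemma cmeasurable_ext d (T : measurableType d) (D : set T) (f g : T -> R[i]) :
  f =1 g -> cmeasurable_fun D f -> cmeasurable_fun D g.
Proof. by move=> /funext ->. Qed.

Lemma cmeasurableS d (T : measurableType d) (D E : set T) (f : T -> R[i]) :
  measurable E -> D `<=` E -> cmeasurable_fun E f -> cmeasurable_fun D f.
Proof.
by move=> mE DE [h1 h2]; split; exact: (measurable_funS mE DE).
Qed.

Lemma cmeasurable_cst d (T : measurableType d) (D : set T) (z : R[i]) :
  cmeasurable_fun D (fun=> z).
Proof. by split; exact: measurable_cst. Qed.

Lemma cmeasurableD d (T : measurableType d) (D : set T) (f g : T -> R[i]) :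
  cmeasurable_fun D f -> cmeasurable_fun D g ->
  cmeasurable_fun D (fun x => f x + g x).
Proof.
move=> [f1 f2] [g1 g2]; split.
- by rewrite (_ : _ \o _ = (Re \o f) \+ (Re \o g)); [exact: measurable_funD|
    apply/funext => x /=; rewrite ReD].
- by rewrite (_ : _ \o _ = (Im \o f) \+ (Im \o g)); [exact: measurable_funD|
    apply/funext => x /=; rewrite ImD].
Qed.

Lemma cmeasurableM d (T : measurableType d) (D : set T) (f g : T -> R[i]) :
  cmeasurable_fun D f -> cmeasurable_fun D g ->
  cmeasurable_fun D (fun x => f x * g x).
Proof.
move=> [f1 f2] [g1 g2]; split.
- rewrite (_ : _ \o _ = ((Re \o f) \* (Re \o g)) \- ((Im \o f) \* (Im \o g))).
    by apply: measurable_funB; exact: measurable_funM.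
  by apply/funext => x /=; rewrite ReM.
- rewrite (_ : _ \o _ = ((Re \o f) \* (Im \o g)) \+ ((Im \o f) \* (Re \o g))).
    by apply: measurable_funD; exact: measurable_funM.
  by apply/funext => x /=; rewrite ImM.
Qed.

Lemma cmeasurableB d (T : measurableType d) (D : set T) (f g : T -> R[i]) :
  cmeasurable_fun D f -> cmeasurable_fun D g ->
  cmeasurable_fun D (fun x => f x - g x).
Proof.
move=> mf mg; have := cmeasurableD mf (cmeasurableM (cmeasurable_cst D (-1)) mg).
by apply: cmeasurable_ext => x; rewrite mulN1r.
Qed.

Lemma cmeasurable_sum d (T : measurableType d) (D : set T) (I : Type)
    (r : seq I) (F : I -> T -> R[i]) :
  (forall i, cmeasurable_fun D (F i)) ->
  cmeasurable_fun D (fun x => \sum_(i <- r) F i x).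
Proof.
move=> mF; elim: r => [|i r IH].
  by under [X in cmeasurable_fun _ X]funext do rewrite big_nil;
    exact: cmeasurable_cst.
have := cmeasurableD (mF i) IH; apply: cmeasurable_ext => x.
by rewrite big_cons.
Qed.

Lemma continuous_measurable (h : R -> R) : continuous h -> measurable_fun setT h.
Proof. exact: continuous_measurable_fun. Qed.

Lemma measurable_normc d (T : measurableType d) (D : set T) (f : T -> R[i]) :
  cmeasurable_fun D f -> measurable_fun D (fun x => normc (f x)).
Proof.
move=> [f1 f2].
rewrite (_ : (fun x => _) =
    Num.sqrt \o (fun x => (Re \o f) x ^+ 2 + (Im \o f) x ^+ 2)).
  apply: measurableT_comp.
    by apply: continuous_measurable; exact: sqrt_continuous.
  by apply: measurable_funD; apply: measurable_funX.
by apply/funext => x; rewrite normcE.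
Qed.

Lemma ccontinuous_measurable D f : mR D -> ccontinuous f ->
  cmeasurable_fun D f.
Proof.
move=> mD [h1 h2]; split; apply: (measurable_funS measurableT) => //;
  exact: continuous_measurable.
Qed.

Lemma cintegrable_le D f h : mR D -> cmeasurable_fun D f ->
  (forall x, D x -> normc (f x) <= h x) -> mu.-integrable D (EFin \o h) ->
  cintegrable D f.
Proof.
move=> mD [m1 m2] fh ih; split; apply: le_integrable ih => //;
  do ?exact/measurable_EFinP; move=> x Dx /=; rewrite lee_fin;
  (apply: le_trans (le_trans (fh _ Dx) (ler_norm _))).
- exact: le_Re_normc.
- exact: le_Im_normc.
Qed.

Lemma integrable_normc D f : mR D -> cintegrable D f ->
  mu.-integrable D (fun x => (normc (f x))%:E).
Proof.
move=> mD fi; have [i1 i2] := fi.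
have n1 : mu.-integrable D (EFin \o ((fun x => `|Re (f x)|) : R -> R)) by exact: integrable_norm.
have n2 : mu.-integrable D (EFin \o ((fun x => `|Im (f x)|) : R -> R)) by exact: integrable_norm.
have i12 := integrableD mD n1 n2.
apply: (le_integrable mD _ _ i12).
  by apply/measurable_EFinP; apply: measurable_normc; exact: cintegrable_meas.
move=> x Dx; rewrite /= lee_fin ger0_norm ?normc_ge0//.
by rewrite ger0_norm ?addr_ge0// normc_le.
Qed.

Lemma eq_cintegral D f g : (forall x, D x -> f x = g x) ->
  cintegral D f = cintegral D g.
Proof.
by move=> fg; apply: complex_eqP; apply: eq_Rintegral => x /set_mem Dx; rewrite fg.
Qed.

Lemma eq_cintegrable D f g : (forall x, D x -> f x = g x) ->
  mR D -> cintegrable D f -> cintegrable D g.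
Proof.
move=> fg mD [h1 h2]; split; [apply: eq_integrable h1|apply: eq_integrable h2] => //;
  by move=> x /set_mem Dx; rewrite /= fg.
Qed.

Lemma cintegrableD D f g : mR D -> cintegrable D f -> cintegrable D g ->
  cintegrable D (fun x => f x + g x).
Proof.
move=> mD [f1 f2] [g1 g2]; split.
- by apply: eq_integrable (integrableD mD f1 g1) => // x _; rewrite /= ReD.
- by apply: eq_integrable (integrableD mD f2 g2) => // x _; rewrite /= ImD.
Qed.

Lemma cintegralD D f g : mR D -> cintegrable D f -> cintegrable D g ->
  cintegral D (fun x => f x + g x) = cintegral D f + cintegral D g.
Proof.
move=> mD [f1 f2] [g1 g2]; apply: complex_eqP; rewrite ?ReD ?ImD /=.
- by rewrite -RintegralD//; apply: eq_Rintegral => x _; rewrite ReD.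
- by rewrite -RintegralD//; apply: eq_Rintegral => x _; rewrite ImD.
Qed.

Lemma cintegrableZ D (z : R[i]) f : mR D -> cintegrable D f ->
  cintegrable D (fun x => z * f x).
Proof.
move=> mD [f1 f2]; split.
- apply: eq_integrable (integrableB mD (integrableZl mD (Re z) f1)
    (integrableZl mD (Im z) f2)) => // x _.
  by rewrite /= ReM EFinB !EFinM.
- apply: eq_integrable (integrableD mD (integrableZl mD (Re z) f2)
    (integrableZl mD (Im z) f1)) => // x _.
  by rewrite /= ImM EFinD !EFinM.
Qed.

Lemma cintegralZ D (z : R[i]) f : mR D -> cintegrable D f ->
  cintegral D (fun x => z * f x) = z * cintegral D f.
Proof.
move=> mD [f1 f2].
have i1 (a : R) := integrableZl mD a f1; have i2 (a : R) := integrableZl mD a f2.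
apply: complex_eqP; rewrite ?ReM ?ImM /cintegral /=.
- rewrite -!RintegralZl// -RintegralB//; [|exact: i1|exact: i2].
  by apply: eq_Rintegral => x _; rewrite ReM.
- rewrite -!RintegralZl// -RintegralD//; [|exact: i2|exact: i1].
  by apply: eq_Rintegral => x _; rewrite ImM.
Qed.

Lemma cintegralB D f g : mR D -> cintegrable D f -> cintegrable D g ->
  cintegral D (fun x => f x - g x) = cintegral D f - cintegral D g.
Proof.
move=> mD fi gi; rewrite -mulN1r -(cintegralZ _ mD gi).
rewrite -(cintegralD mD fi (cintegrableZ _ mD gi)).
by apply: eq_cintegral => x _; rewrite mulN1r.
Qed.

Lemma normc_cintegral D f : mR D -> cintegrable D f ->
  normc (cintegral D f) <= \int[mu]_(x in D) normc (f x).
Proof.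
move=> mD fi; have inf := integrable_normc mD fi.
set z := cintegral D f; have [z0|z0] := eqVneq (normc z) 0.
  by rewrite z0 Rintegral_ge0// => x _; exact: normc_ge0.
have zp : 0 < normc z by rewrite lt_neqAle eq_sym z0 normc_ge0.
rewrite -(ler_pM2l zp) -RintegralZl// -expr2 sqr_normc.
have -> : Re z ^+ 2 + Im z ^+ 2 = Re (cintegral D (fun x => z^* * f x)).
  rewrite cintegralZ// -/z; case: (z) => a b /=; ring.
have [i1 _] := cintegrableZ (z^*) mD fi.
apply: le_Rintegral => //; first exact: (integrableZl mD _ inf).
move=> x Dx; apply: le_trans (ler_norm _) _.
by rewrite (le_trans (le_Re_normc _))// normcM normc_conj.
Qed.

Lemma normc_cintegral_le D f h : mR D -> cmeasurable_fun D f ->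
  (forall x, D x -> normc (f x) <= h x) -> mu.-integrable D (EFin \o h) ->
  normc (cintegral D f) <= \int[mu]_(x in D) h x.
Proof.
move=> mD mf fh ih; have fi := cintegrable_le mD mf fh ih.
apply: le_trans (normc_cintegral mD fi) _.
by apply: le_Rintegral => //; exact: integrable_normc.
Qed.

Lemma jb_continuous a : continuous (jb a : R -> R).
Proof.
move=> x; apply: differentiable_continuous; apply/derivable1_diffP.
by have [] := is_derive_jb a x.
Qed.

Lemma jbm2E x : jb (-2) x = (oneDsqr x)^-1 :> R.
Proof. by rewrite jbN jb2. Qed.

Lemma integrable_jb : mu.-integrable setT (EFin \o (jb (-2) : R -> R)).
Proof.
apply/integrableP; split.
  by apply/measurable_EFinP; apply: continuous_measurable; exact: jb_continuous.
under eq_integral do rewrite /= ger0_norm ?jb_ge0//.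
rewrite ge0_symfun_integralT//; last 3 first.
- by move=> x; exact: jb_ge0.
- exact: jb_continuous.
- by move=> x; rewrite /= jb_even.
under eq_integral do rewrite jbm2E.
by rewrite -set_itvcy integral0y_oneDsqr -EFinM ltry.
Qed.

Definition jb_mass : R := \int[mu]_x jb (-2) x.

Lemma jb_mass_ge0 : 0 <= jb_mass.
Proof. by apply: Rintegral_ge0 => x _; exact: jb_ge0. Qed.

Lemma cintegrable_jb f c : ccontinuous f ->
  (forall x, normc (f x) <= c * jb (-2) x) -> cintegrable setT f.
Proof.
move=> cf h; apply: (cintegrable_le (h := fun x => c * jb (-2) x)) => //.
  exact: ccontinuous_measurable.
exact: (integrableZl measurableT c integrable_jb).
Qed.

Lemma normc_cintegral_jb f c : ccontinuous f ->
  (forall x, normc (f x) <= c * jb (-2) x) ->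
  normc (cintegral setT f) <= c * jb_mass.
Proof.
move=> cf h; rewrite /jb_mass -RintegralZl//; last exact: integrable_jb.
apply: normc_cintegral_le => //.
  exact: ccontinuous_measurable.
exact: (integrableZl measurableT c integrable_jb).
Qed.

Lemma schwartz_continuous f : schwartz f -> ccontinuous f.
Proof. by move=> [/csmooth_continuous]. Qed.

Lemma schwartz_bound a f : schwartz f ->
  exists2 c, 0 <= c & forall x, normc (f x) <= c * jb a x.
Proof.
move=> /schwartzP/(_ a 0%N)[c c0 h]; exists c => // x; exact: (sym_bound h).
Qed.

Lemma schwartz_cintegrable f : schwartz f -> cintegrable setT f.
Proof.
move=> sf; have [c _ h] := schwartz_bound (-2) sf.
exact: cintegrable_jb (schwartz_continuous sf) h.
Qed.

End complex_integral.

(** * The Fourier transform of Schwartz functions *)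

Section fourier_schwartz.
Context {R : realType}.
Let mu := @lebesgue_measure R.
Implicit Types (f g : R -> R[i]) (h : R -> R).

Lemma ccontinuousM f g : ccontinuous f -> ccontinuous g ->
  ccontinuous (fun x => f x * g x).
Proof.
move=> [f1 f2] [g1 g2]; split.
- rewrite (_ : _ \o _ = (fun x => (Re \o f) x * (Re \o g) x - (Im \o f) x * (Im \o g) x)).
    by move=> x; apply: cvgB; apply: cvgM; [exact: f1|exact: g1|exact: f2|exact: g2].
  by apply/funext => x /=; rewrite ReM.
- rewrite (_ : _ \o _ = (fun x => (Re \o f) x * (Im \o g) x + (Im \o f) x * (Re \o g) x)).
    by move=> x; apply: cvgD; apply: cvgM; [exact: f1|exact: g2|exact: f2|exact: g1].
  by apply/funext => x /=; rewrite ImM.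
Qed.

Lemma ccontinuous_ext f g : f =1 g -> ccontinuous f -> ccontinuous g.
Proof. by move=> /funext ->. Qed.

Lemma ccontinuous_expi (t : R) : ccontinuous (fun x => expi (t * x)).
Proof. exact: is_cder_continuous (is_cder_expi_linear t). Qed.

Lemma ccontinuous_id : ccontinuous (fun x : R => x%:C).
Proof. exact: is_cder_continuous is_cder_id. Qed.

Lemma ccontinuous_cst (z : R[i]) : ccontinuous (fun _ : R => z).
Proof. exact: is_cder_continuous (is_cder_cst z). Qed.

Lemma is_derive_integral (F F' : R -> R -> R) (G : R -> R) (a : R) :
  (forall n, mu.-integrable setT (EFin \o F n)) ->
  (forall n y : R, is_derive n 1 (F ^~ y) (F' n y)) ->
  (forall n y, `|F' n y| <= G y) -> mu.-integrable setT (EFin \o G) ->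
  is_derive a 1 (fun n => \int[mu]_y F n y) (\int[mu]_y F' a y).
Proof.
move=> iF dF F'G iG.
have Ia : `](a - 1), (a + 1)[%classic a by rewrite /= in_itv /= ltrBlDr !ltrDl ltr01.
have dE n y : partial1of2 F n y = F' n y.
  by rewrite partial1of2E; have [_ ->] := dF n y.
have G0 y : 0 <= G y by exact: le_trans (normr_ge0 _) (F'G a y).
have h1 : forall n y, `](a - 1), (a + 1)[%classic n -> [set: R] y ->
    `|partial1of2 F n y| <= G y by move=> n y _ _; rewrite dE.
have h2 : forall n y, `](a - 1), (a + 1)[%classic n -> [set: R] y ->
    derivable (F ^~ y) n 1 by move=> n y _ _; have [] := dF n y.
apply: DeriveDef.
  exact: (derivable_under_integral measurableT Ia (fun n _ => iF n) h2 G0 iG h1).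
rewrite -derive1E.
rewrite (differentiation_under_integral measurableT Ia (fun n _ => iF n) h2 G0 iG h1).
by apply: eq_Rintegral => y _; rewrite dE.
Qed.

Lemma is_cder_cintegral (F F' : R -> R -> R[i]) (G : R -> R) :
  (forall n, cmeasurable_fun setT (F n)) ->
  (forall y, is_cder (F ^~ y) (F' ^~ y)) ->
  (forall n y, normc (F n y) <= G y) -> (forall n y, normc (F' n y) <= G y) ->
  mu.-integrable setT (EFin \o G) ->
  is_cder (fun n => cintegral setT (F n)) (fun n => cintegral setT (F' n)).
Proof.
move=> mF dF FG F'G iG a.
have iF n := cintegrable_le measurableT (mF n) (fun x _ => FG n x) iG.
split.
- apply: (is_derive_integral (F := fun n y => Re (F n y))
    (F' := fun n y => Re (F' n y))) iG.
  + by move=> n; have [] := iF n.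
  + by move=> n y; have [] := dF y n.
  + by move=> n y; exact: le_trans (le_Re_normc _) (F'G n y).
- apply: (is_derive_integral (F := fun n y => Im (F n y))
    (F' := fun n y => Im (F' n y))) iG.
  + by move=> n; have [] := iF n.
  + by move=> n y; have [] := dF y n.
  + by move=> n y; exact: le_trans (le_Im_normc _) (F'G n y).
Qed.

Lemma Rintegral_derive0 (h h' : R -> R) (c : R) :
  (forall x : R, is_derive x 1 h (h' x)) -> continuous h' ->
  (forall x, `|h x| <= c * jb (-2) x) -> (forall x, `|h' x| <= c * jb (-2) x) ->
  \int[mu]_x h' x = 0.
Proof.
move=> dh ch' bh bh'.
have c0 : 0 <= c.
  by rewrite -(pmulr_lge0 _ (jb_gt0 (-2) 0)) (le_trans (normr_ge0 _) (bh 0)).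
pose I (n : nat) : set R := `[- n%:R, n%:R]%classic.
pose h_ n x := (h' \_ (I n)) x.
have ch x : {for x, continuous h}.
  by apply: differentiable_continuous; apply/derivable1_diffP; have [] := dh x.
have mh' : measurable_fun setT h' by exact: continuous_measurable.
have ic : mu.-integrable setT (EFin \o (fun x => c * jb (-2) x)).
  exact: (integrableZl measurableT c integrable_jb).
have H1 : (\int[mu]_x (h_ n x)%:E)%E @[n --> \oo] --> (\int[mu]_x (h' x)%:E)%E.
  have [] := @dominated_convergence _ _ _ mu setT measurableT
    (fun n x => (h_ n x)%:E) (fun x => (h' x)%:E) (fun x => (c * jb (-2) x)%:E) _ _ _ ic _.
  - move=> n; apply/measurable_EFinP.
    by apply/(measurable_restrictT _ _).1; [exact: measurable_itv|exact: measurable_funS mh'].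
  - exact/measurable_EFinP.
  - apply: aeW => x _; apply: cvg_near_cst.
    near=> n; rewrite /h_ patchE mem_set//.
    rewrite /I /= in_itv /= -ler_norml.
    by near: n; exact: nbhs_infty_ger.
  - apply: aeW => x n _; rewrite lee_fin /h_ patchE; case: ifP => _; first exact: bh'.
    by rewrite normr0 (le_trans (normr_ge0 _) (bh' x)).
  - by [].
have H2 : (\int[mu]_x (h_ n x)%:E)%E @[n --> \oo] --> (0 : \bar R).
  have E n : (\int[mu]_x (h_ n.+1 x)%:E)%E = (h n.+1%:R - h (- n.+1%:R))%:E.
    have n0 : - n.+1%:R < n.+1%:R :> R by rewrite gt0_cp// ltr0n.
    rewrite EFinB -(continuous_FTC2 (f := h') n0).
    - rewrite [RHS]integral_mkcond; apply: eq_integral => x _.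
      by rewrite /h_ /I restrict_EFin.
    - exact: continuous_subspaceT.
    - split.
      + by move=> x _; have [] := dh x.
      + by apply: cvg_at_right_filter; exact: ch.
      + by apply: cvg_at_left_filter; exact: ch.
    - by move=> x _; rewrite derive1E; have [] := dh x.
  rewrite -(cvg_shiftS (fun n => (\int[mu]_x (h_ n x)%:E)%E)).
  under eq_fun do rewrite /= E.
  have hz (e : R) : `|e| = 1 -> h (e * n.+1%:R) @[n --> \oo] --> (0 : R).
    move=> e1; apply/cvgr0Pnorm_le => d d0.
    have c1 : 0 < c + 1 by rewrite ltr_wpDl.
    have /cvgrPdist_le/(_ _ (divr_gt0 d0 c1))[N _ hN] := @cvg_harmonic R.
    exists N => // n /= /hN; rewrite sub0r normrN /= ger0_norm ?invr_ge0//.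
    rewrite ler_pdivlMr// => hn.
    apply: le_trans (bh _) _; apply: le_trans (_ : (c + 1) * (n.+1%:R)^-1 <= _); last first.
      by rewrite mulrC.
    apply: ler_pM; rewrite ?jb_ge0 ?lerDl//.
    rewrite jbm2E lef_pV2 ?posrE ?onesqr_gt0 ?ltr0n//.
    rewrite -[oneDsqr _]/(1 + (e * n.+1%:R) ^+ 2) exprMn -(real_normK (num_real e)) e1 expr1n mul1r -natrX -natr1 addrC.
    by rewrite lerD2l ler_nat expnS expn1 (leq_trans (leqnSn n))// leq_pmulr.
  have e1 : `|-1 : R| = 1 by rewrite normrN normr1.
  have := cvgB (hz 1 (normr1 _)) (hz (-1) e1); rewrite subrr => h0.
  apply: cvg_EFin.
    by near=> n.
  rewrite (_ : fine \o _ =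
      (fun n => h (1 * n.+1%:R)) - (fun n => h (-1 * n.+1%:R))); first exact: h0.
  apply/funext => n; rewrite /= -[RHS]/(h (1 * n.+1%:R) - h (-1 * n.+1%:R)).
  by rewrite mul1r mulN1r.
have := cvg_unique _ H1 H2 => H3; by rewrite /Rintegral H3.
Unshelve. all: by end_near. Qed.

Lemma cintegral_derive0 f f' (c : R) : is_cder f f' -> ccontinuous f' ->
  (forall x, normc (f x) <= c * jb (-2) x) ->
  (forall x, normc (f' x) <= c * jb (-2) x) -> cintegral setT f' = 0.
Proof.
move=> hf [c1 c2] b b'; apply: complex_eqP.
- apply: (Rintegral_derive0 (h := Re \o f) (h' := Re \o f') (c := c)) => // x.
  + by have [] := hf x.
  + exact: le_trans (le_Re_normc _) (b x).
  + exact: le_trans (le_Re_normc _) (b' x).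
- apply: (Rintegral_derive0 (h := Im \o f) (h' := Im \o f') (c := c)) => // x.
  + by have [] := hf x.
  + exact: le_trans (le_Im_normc _) (b x).
  + exact: le_trans (le_Im_normc _) (b' x).
Qed.

Lemma normc_i : normc ('i : R[i]) = 1.
Proof. by rewrite normcE /= expr0n expr1n add0r sqrtr1. Qed.

Lemma fourierE f n :
  fourier f n = cintegral setT (fun x => expi ((- n) * x) * f x).
Proof. by apply: eq_cintegral => x _; rewrite mulNr. Qed.

Lemma is_cder_fourier f c : ccontinuous f ->
  (forall x, normc (f x) <= c * jb (-3) x) ->
  is_cder (fourier f) (fourier (fun x => (- 'i * x%:C) * f x)).
Proof.
move=> cf bf.
have c0 : 0 <= c.
  by rewrite -(pmulr_lge0 _ (jb_gt0 (-3) 0)) (le_trans (normc_ge0 _) (bf 0)).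
apply: (is_cder_cintegral (F := fun n x => expi (- (n * x)) * f x)
  (G := fun x => c * jb (-2) x)).
- move=> n; apply: ccontinuous_measurable => //; apply: ccontinuousM => //.
  by apply: ccontinuous_ext (ccontinuous_expi (- n)) => x; rewrite mulNr.
- move=> y; have := is_cderM (is_cder_expi_linear (- y)) (is_cder_cst (f y)).
  apply: is_cder_eq => n; rewrite mulNr (mulrC y)//.
  by rewrite mulr0 addr0 realCN; ring.
- move=> n y; rewrite normcM normc_expi mul1r (le_trans (bf y))//.
  by rewrite ler_wpM2l// jb_le//; lra.
- move=> n y; rewrite !normcM normcN normc_i normc_expi !mul1r normcR.
  apply: le_trans (ler_pM _ _ (normr_le_jb1 y) (bf y)) _ => //; rewrite ?normc_ge0//.
  by rewrite mulrCA -jbD (_ : 1 + -3 = -2 :> R)//; ring.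
- exact: (integrableZl measurableT c integrable_jb).
Qed.

Lemma fourier_cder f f' c : is_cder f f' -> ccontinuous f' ->
  (forall x, normc (f x) <= c * jb (-2) x) ->
  (forall x, normc (f' x) <= c * jb (-2) x) ->
  forall n, fourier f' n = ('i * n%:C) * fourier f n.
Proof.
move=> hf cf' bf bf' n.
have cf := is_cder_continuous hf; have ce := ccontinuous_expi (- n).
have he := is_cderM (is_cder_expi_linear (- n)) hf.
have c0 : 0 <= c.
  by rewrite -(pmulr_lge0 _ (jb_gt0 (-2) 0)) (le_trans (normc_ge0 _) (bf 0)).
have i1 : cintegrable setT (fun x => expi (- n * x) * f x).
  apply: (cintegrable_jb (c := c)); first exact: ccontinuousM.
  by move=> x; rewrite normcM normc_expi mul1r.
have i2 : cintegrable setT (fun x => expi (- n * x) * f' x).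
  apply: (cintegrable_jb (c := c)); first exact: ccontinuousM.
  by move=> x; rewrite normcM normc_expi mul1r.
have : cintegral setT (fun x => ('i * (- n)%:C) * (expi (- n * x) * f x) +
    expi (- n * x) * f' x) = 0.
  apply: (cintegral_derive0 (c := (`|n| + 1) * c) (is_cder_eq _ _ he)) => //.
  - by move=> x; rewrite mulrA.
  - have -> : (fun x => 'i * (- n)%:C * (expi (- n * x) * f x) + expi (- n * x) * f' x)
        = (fun x => expi (- n * x) * (('i * (- n)%:C) * f x + f' x)).
      by apply/funext => x; ring.
    apply: ccontinuousM => //; split => x.
      rewrite (_ : _ \o _ = (fun x => (Re \o (fun x => ('i * (- n)%:C) * f x)) x + (Re \o f') x)).
        apply: cvgD; last exact: cf'.1.
        exact: (ccontinuousM (ccontinuous_cst _) cf).1.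
      by apply/funext => y /=; rewrite ReD.
    rewrite (_ : _ \o _ = (fun x => (Im \o (fun x => ('i * (- n)%:C) * f x)) x + (Im \o f') x)).
      apply: cvgD; last exact: cf'.2.
      exact: (ccontinuousM (ccontinuous_cst _) cf).2.
    by apply/funext => y /=; rewrite ImD.
  - move=> x; rewrite normcM normc_expi mul1r (le_trans (bf x))//.
    by rewrite ler_wpM2r ?jb_ge0// ler_peMl// lerDr.
  - move=> x; apply: le_trans (normcD _ _) _.
    rewrite !normcM normc_i normc_expi !mul1r normcR normrN mulrDl mul1r mulrDl.
    by rewrite lerD// -mulrA ler_wpM2l.
rewrite cintegralD//; last exact: cintegrableZ.
rewrite cintegralZ// -!fourierE => /eqP; rewrite addrC addr_eq0 => /eqP ->.
by rewrite realCN mulrN mulNr opprK.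
Qed.

Lemma fourier_bound f c n : ccontinuous f ->
  (forall x, normc (f x) <= c * jb (-2) x) ->
  normc (fourier f n) <= c * jb_mass.
Proof.
move=> cf bf; rewrite fourierE; apply: normc_cintegral_jb.
  by apply: ccontinuousM => //; exact: ccontinuous_expi.
by move=> x; rewrite normcM normc_expi mul1r.
Qed.

Lemma fourierD f g n : cintegrable setT f -> cintegrable setT g ->
  ccontinuous f -> ccontinuous g ->
  fourier (fun x => f x + g x) n = fourier f n + fourier g n.
Proof.
have H k : cintegrable setT k -> ccontinuous k ->
    cintegrable setT (fun x => expi (- n * x) * k x).
  move=> ik ck; apply: (cintegrable_le (h := fun x => normc (k x))) => //.
  - apply: ccontinuous_measurable => //.
    by apply: ccontinuousM => //; exact: ccontinuous_expi.
  - by move=> x _; rewrite normcM normc_expi mul1r.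
  - exact: integrable_normc.
move=> fi gi cf cg; rewrite !fourierE -cintegralD//; [|exact: H|exact: H].
by apply: eq_cintegral => x _; rewrite mulrDr.
Qed.

Lemma schwartz_der f : schwartz f -> is_cder f (cder f) /\ schwartz (cder f).
Proof.
move=> /schwartzP sf; have [hf _] := symbol_der (sf 0); split=> //.
by apply/schwartzP => a; have [_] := symbol_der (sf a); rewrite subr0.
Qed.

Lemma schwartz_fourierD f g n : schwartz f -> schwartz g ->
  fourier (fun x => f x + g x) n = fourier f n + fourier g n.
Proof.
by move=> sf sg; apply: fourierD; do ?exact: schwartz_cintegrable;
  exact: schwartz_continuous.
Qed.

Lemma symbol_expi (n : R) : symbol setT 0 0 (fun x => expi (n * x)).
Proof.
apply: (symbol_ode (c := 1) _ _ (is_cder_expi_linear n)).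
  by move=> x _; rewrite normc_expi jb0 mulr1.
by rewrite oppr0; exact: symbol_cst.
Qed.

Lemma schwartz_expi f n : schwartz f -> schwartz (fun x => expi (n * x) * f x).
Proof. exact: (scont_schwartz (scont_mul (symbol_expi n))). Qed.

Lemma schwartz_fourierZ (z : R[i]) f n : schwartz f ->
  fourier (fun x => z * f x) n = z * fourier f n.
Proof.
move=> sf; rewrite !fourierE -cintegralZ//; last first.
  by apply: schwartz_cintegrable; exact: schwartz_expi.
by apply: eq_cintegral => x _; rewrite mulrCA.
Qed.

Lemma schwartz_is_cder_fourier f : schwartz f ->
  is_cder (fourier f) (fourier (fun x => (- 'i * x%:C) * f x)).
Proof.
move=> sf; have [c c0 bf] := schwartz_bound (-3) sf.
exact: is_cder_fourier (schwartz_continuous sf) bf.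
Qed.

Lemma schwartz_fourier_cder f : schwartz f ->
  forall n, fourier (cder f) n = ('i * n%:C) * fourier f n.
Proof.
move=> sf; have [hf sf'] := schwartz_der sf.
have [c c0 bf] := schwartz_bound (-2) sf.
have [c' c'0 bf'] := schwartz_bound (-2) sf'.
apply: (fourier_cder (c := c + c') hf (schwartz_continuous sf')) => x.
- by rewrite (le_trans (bf x))// ler_wpM2r ?jb_ge0// lerDl.
- by rewrite (le_trans (bf' x))// ler_wpM2r ?jb_ge0// lerDr.
Qed.

Lemma scont_mulx : scont (fun f x => (- 'i * x%:C) * f x).
Proof.
have r01 : (0 : R) <= 0 <= (1 : R) by rewrite lexx ler01.
exact: scont_mul (symbolZ (- 'i) (symbol_id setT r01)).
Qed.

Lemma scont_add T U : scont T -> scont U -> scont (fun f x => T f x + U f x).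
Proof.
move=> hT hU k a; have [k1 [a1 [C1 [C10 h1]]]] := hT k a.
have [k2 [a2 [C2 [C20 h2]]]] := hU k a.
exists (maxn k1 k2), (Num.min a1 a2), (C1 + C2); split; first exact: addr_ge0.
move=> f c c0 sf s; rewrite mulrDl; apply: symD.
- apply: h1 => //; apply: sym_weaken s => //; first exact: leq_maxl.
  by rewrite ge_min lexx.
- apply: h2 => //; apply: sym_weaken s => //; first exact: leq_maxr.
  by rewrite ge_min lexx orbT.
Qed.

Lemma scont_scale (z : R[i]) T : scont T -> scont (fun f x => z * T f x).
Proof.
move=> hT k a; have [k1 [a1 [C1 [C10 h1]]]] := hT k a.
exists k1, a1, (normc z * C1); split; first by rewrite mulr_ge0 ?normc_ge0.
by move=> f c c0 sf s; rewrite -mulrA; apply: symZ; exact: h1.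
Qed.

Lemma scont_cder : scont (@cder R).
Proof.
move=> k a; exists k.+1, a, 1; split=> // f c c0 sf s; rewrite mul1r.
by rewrite -(subr0 a); apply: sym_der s _; exact: (schwartz_der sf).1.
Qed.

Lemma scont_id : scont (fun f => f).
Proof. by move=> k a; exists k, a, 1; split=> // f c c0 sf; rewrite mul1r. Qed.

(** Derivatives of [fourier f] come from multiplying [f] by the variable, and
    decay from [(1 + n^2) fourier f = fourier (f - f'')]. *)
Lemma scont_fourier : scont (@fourier R).
Proof.
suff H (j k : nat) : exists k' a' C, 0 <= C /\ forall f c, 0 <= c -> schwartz f ->
    sym setT 0 k' a' c f -> sym setT 0 k (- (2 * j%:R)) (C * c) (fourier f).
  move=> k a; have [N aN] := exists_natN_le a.
  have [k' [a' [C [C0 h]]]] := H N k.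
  exists k', a', C; split=> // f c c0 sf s.
  apply: sym_weaken (h f c c0 sf s) => //; last by rewrite mulr_ge0.
  apply: le_trans aN; rewrite lerN2 mulr_natl mulr2n lerDl; exact: ler0n.
elim: j k => [|j IHj] k.
  rewrite mulr0 oppr0; elim: k => [|k [k' [a' [C [C0 IH]]]]].
    exists 0%N, (-2), jb_mass; split; first exact: jb_mass_ge0.
    move=> f c c0 sf [bf _]; split=> // n _; rewrite jb0 mulr1 mulrC.
    apply: fourier_bound; first exact: schwartz_continuous.
    by move=> x; exact: bf.
  have [k1 [a1 [C1 [C10 h1]]]] := scont_mulx k' a'.
  exists k1, (Num.min a1 (-2)), (C * C1 + jb_mass); split.
    by rewrite addr_ge0 ?jb_mass_ge0// mulr_ge0.
  move=> f c c0 sf s.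
  apply: (symS _ (schwartz_is_cder_fourier sf)).
    move=> n _; rewrite jb0 mulr1.
    apply: (@le_trans _ _ (c * jb_mass)).
      apply: fourier_bound; first exact: schwartz_continuous.
      move=> x; apply: le_trans (sym_bound s (I : setT x)) _.
      by rewrite ler_wpM2l// jb_le// ge_min lexx orbT.
    by rewrite mulrC ler_wpM2r// lerDr mulr_ge0.
  rewrite subr0; apply: (@sym_weaken _ setT setT 0 0 k k 0 0 (C * (C1 * c))) => //.
  - by rewrite mulrA ler_wpM2r// lerDl jb_mass_ge0.
  - by rewrite mulr_ge0// addr_ge0 ?jb_mass_ge0// mulr_ge0.
  apply: IH; rewrite ?mulr_ge0//; first exact: (scont_schwartz scont_mulx).
  by apply: h1 => //; apply: sym_weaken s => //; rewrite ge_min lexx.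
have [k' [a' [C [C0 h]]]] := IHj k.
have hT : scont (fun f x => f x + (-1) * cder (cder f) x).
  apply: scont_add scont_id _; apply: scont_scale.
  exact: scont_comp scont_cder scont_cder.
have [k1 [a1 [C1 [C10 h1]]]] := hT k' a'.
have r01 : (0 : R) <= 0 <= (1 : R) by rewrite lexx ler01.
have [d d0 sd] := symbol_jb setT (-2) r01 k.
exists k1, a1, (2 ^+ k * (d * (C * C1))); split.
  by rewrite !mulr_ge0// exprn_ge0.
move=> f c c0 sf s.
have [_ sf1] := schwartz_der sf; have [_ sf2] := schwartz_der sf1.
have E n : fourier f n = (jb (-2) n)%:C *
    fourier (fun x => f x + (-1) * cder (cder f) x) n.
  rewrite schwartz_fourierD//; last exact: schwartzZ.
  rewrite schwartz_fourierZ// !schwartz_fourier_cder//.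
  have ii : 'i * 'i = -1 :> R[i] by apply: complex_eqP; rewrite !(ReM, ImM) /=; ring.
  rewrite (_ : _ + _ = (1 + n ^+ 2)%:C * fourier f n); last first.
    rewrite realCD expr2 realCM.
    have -> : 'i * n%:C * ('i * n%:C * fourier f n) =
      ('i * 'i) * (n%:C * n%:C * fourier f n) by ring.
    by rewrite ii; ring.
  rewrite -jb2 mulrA -realCM -jbD (_ : -2 + 2 = 0 :> R) ?jb0 ?mul1r//; ring.
apply: (sym_eq (fun n => esym (E n))).
have s1 := h _ _ (mulr_ge0 C10 c0) (scont_schwartz hT sf) (h1 f c c0 sf s).
have := symM d0 (mulr_ge0 C0 (mulr_ge0 C10 c0)) sd s1.
rewrite (_ : -2 + - (2 * j%:R) = - (2 * j.+1%:R) :> R) ?mulrA//.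
by rewrite -natr1; ring.
Qed.

End fourier_schwartz.

(** * Changes of variables, dominated convergence and Fubini *)

Section integral_tools.
Context {R : realType}.
Let mu := @lebesgue_measure R.
Implicit Types (f g : R -> R[i]) (h : R -> R).
Local Notation mR D := (@measurable _ (measurableTypeR R) D).

Lemma Rintegral_cvg0 (D : set R) (g_ : nat -> R -> R) (h : R -> R) : mR D ->
  (forall n, measurable_fun D (g_ n)) -> mu.-integrable D (EFin \o h) ->
  (forall n x, D x -> 0 <= g_ n x <= h x) ->
  (forall x, D x -> g_ n x @[n --> \oo] --> (0 : R)) ->
  \int[mu]_(x in D) g_ n x @[n --> \oo] --> (0 : R).
Proof.
move=> mD mg ih gh g0.
have [] := @dominated_convergence _ _ _ mu D mD
    (fun n x => (g_ n x)%:E) (cst 0%E) (EFin \o h) _ _ _ ih _.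
- by move=> n; apply/measurable_EFinP; exact: mg.
- exact: measurable_cst.
- by apply: aeW => x Dx; apply: cvg_EFin; [exact: nearW|exact: g0].
- apply: aeW => x n Dx; have /andP[g1 g2] := gh n x Dx.
  by rewrite lee_fin ger0_norm.
move=> _ _; rewrite integral0; exact: fine_cvg.
Qed.

Lemma cvg_cintegral (D : set R) (f_ : nat -> R -> R[i]) f h : mR D ->
  (forall n, cmeasurable_fun D (f_ n)) -> cmeasurable_fun D f ->
  mu.-integrable D (EFin \o h) ->
  (forall n x, D x -> normc (f_ n x) <= h x) ->
  (forall x, D x -> normc (f x) <= h x) ->
  (forall x, D x -> normc (f_ n x - f x) @[n --> \oo] --> (0 : R)) ->
  normc (cintegral D (f_ n) - cintegral D f) @[n --> \oo] --> (0 : R).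
Proof.
move=> mD mf_ mf ih fh_ fh fc.
have i_ n := cintegrable_le mD (mf_ n) (fh_ n) ih.
have i := cintegrable_le mD mf fh ih.
have : \int[mu]_(x in D) normc (f_ n x - f x) @[n --> \oo] --> (0 : R).
  apply: (Rintegral_cvg0 (h := fun x => h x + h x)) => //.
  - by move=> n; apply: measurable_normc; exact: cmeasurableB.
  - exact: (integrableD mD ih ih).
  - move=> n x Dx; rewrite normc_ge0 (le_trans (normcB _ _))// lerD//.
      exact: fh_.
    exact: fh.
have i0 n := normc_ge0 (cintegral D (f_ n) - cintegral D f).
apply: squeeze_cvgr (@cvg_cst _ _ _ _ _).
apply: nearW => n; rewrite i0 -cintegralB//.
apply: normc_cintegral => //.
apply: eq_cintegrable (cintegrableD mD (i_ n) (cintegrableZ (-1) mD i)) => //.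
by move=> x _; rewrite mulN1r.
Qed.

Lemma normc_cvg_unique (z_ : nat -> R[i]) (z w : R[i]) :
  normc (z_ n - z) @[n --> \oo] --> (0 : R) ->
  normc (z_ n - w) @[n --> \oo] --> (0 : R) -> z = w.
Proof.
move=> hz hw; have h := cvgD hz hw; rewrite addr0 in h.
have e : normc (z - w) <= 0.
  have h0 : (fun n => normc (z_ n - z) + normc (z_ n - w)) @ \oo --> (0 : R) by exact: h.
  apply: (cvgr_to_ge h0); apply: nearW => n.
  rewrite (_ : z - w = (z_ n - w) - (z_ n - z)); last by ring.
  by rewrite (le_trans (normcB _ _))// addrC.
have : normc (z - w) = 0 by apply/eqP; rewrite eq_le e normc_ge0.
by move/normc_eq0/eqP; rewrite subr_eq0 => /eqP.
Qed.

Lemma ge0_integral_affine h (e b : R) : 0 < e -> continuous h ->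
  (forall x, 0 <= h x) ->
  (\int[mu]_x (h x)%:E = \int[mu]_x (h (e * x + b) * e)%:E)%E.
Proof.
move=> e0 ch h0; pose F (x : R) : R := e * x + b.
have dF (x : R) : is_derive x 1 F e.
  apply: (is_derive_eq (is_deriveD (is_derive_mulc e (is_derive_id x 1))
    (is_derive_cst b x 1))).
  by rewrite mulr1 addr0.
have dE : F^`()%classic = cst e.
  by apply/funext => x; rewrite derive1E; have [_ ->] := dF x.
rewrite (@increasing_ge0_integration_by_substitutionT _ F)//.
- by apply: eq_integral => x _; rewrite dE.
- by move=> x y xy; rewrite /F ltrD2r ltr_pM2l.
- by rewrite dE; exact: cst_continuous.
- by rewrite dE; exact: is_cvg_cst.
- by rewrite dE; exact: is_cvg_cst.
- apply: (cvg_comp (fun x => e * x) (fun y => y + b)); last exact: cvg_addrr_Ny.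
  by apply: gt0_cvgMrNy => //; exact: cvg_id.
- apply: (cvg_comp (fun x => e * x) (fun y => y + b)); last exact: cvg_addrr.
  by apply: gt0_cvgMry => //; exact: cvg_id.
Qed.

Lemma Rintegral_affine h (e b : R) (H : R -> R) : 0 < e -> continuous h ->
  continuous H ->
  (forall x, `|h x| <= H x) -> mu.-integrable setT (EFin \o H) ->
  \int[mu]_x h x = \int[mu]_x (h (e * x + b) * e).
Proof.
move=> e0 ch cH hH iH.
have cq : continuous (fun x : R => e * x + b).
  move=> x; apply: cvgD; last exact: cvg_cst.
  by apply: cvgM; [exact: cvg_cst|exact: cvg_id].
have H0 x : 0 <= H x := le_trans (normr_ge0 _) (hH x).
have cc (k : R -> R) : continuous k -> continuous (fun x => k (e * x + b) * e).
  move=> ck x; apply: cvgM; last exact: cvg_cst.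
  by apply: continuous_comp; [exact: cq|exact: ck].
have iH' : mu.-integrable setT (EFin \o (fun x => H (e * x + b) * e)).
  apply/integrableP; split.
    by apply/measurable_EFinP; apply: continuous_measurable; exact: cc.
  under eq_integral do rewrite /= ger0_norm ?mulr_ge0// ?ltW//.
  rewrite -ge0_integral_affine//; have /integrableP[_] := iH.
  by under eq_integral do rewrite /= ger0_norm//.
have ih : mu.-integrable setT (EFin \o h).
  apply: (le_integrable measurableT _ _ iH).
    by apply/measurable_EFinP; apply: continuous_measurable.
  by move=> x _; rewrite /= lee_fin (le_trans (hH x))// ler_norm.
have ih' : mu.-integrable setT (EFin \o (fun x => h (e * x + b) * e)).
  apply: (le_integrable measurableT _ _ iH').
    by apply/measurable_EFinP; apply: continuous_measurable; exact: cc.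
  move=> x _; rewrite /= lee_fin !normrM ler_wpM2r// (le_trans (hH _))//.
  exact: ler_norm.
have chH : continuous (fun x => h x + H x).
  by move=> x; apply: cvgD; [exact: ch|exact: cH].
have hH0 x : 0 <= h x + H x.
  by have := hH x; rewrite ler_norml => /andP[]; lra.
have := congr1 fine (ge0_integral_affine b e0 chH hH0).
have := congr1 fine (ge0_integral_affine b e0 cH H0).
rewrite -!/(Rintegral _ _ _) => E1.
rewrite RintegralD// E1.
under [in X in _ = X -> _]eq_Rintegral do rewrite mulrDl.
by rewrite RintegralD// => /addIr.
Qed.

Lemma cintegral_affine f (e b c : R) : 0 < e -> ccontinuous f ->
  (forall x, normc (f x) <= c * jb (-2) x) ->
  cintegral setT f = cintegral setT (fun x => e%:C * f (e * x + b)).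
Proof.
move=> e0 [c1 c2] bf.
have cH : continuous (fun x => c * jb (-2) x).
  by move=> x; apply: cvgM; [exact: cvg_cst|exact: jb_continuous].
have iH : mu.-integrable setT (EFin \o (fun x => c * jb (-2) x)).
  exact: (integrableZl measurableT c integrable_jb).
have E1 := Rintegral_affine b e0 c1 cH (fun x => le_trans (le_Re_normc _) (bf x)) iH.
have E2 := Rintegral_affine b e0 c2 cH (fun x => le_trans (le_Im_normc _) (bf x)) iH.
apply: complex_eqP; rewrite /cintegral /=.
- by rewrite E1; apply: eq_Rintegral => x _; rewrite ReM /= mul0r subr0 mulrC.
- by rewrite E2; apply: eq_Rintegral => x _; rewrite ImM /= mul0r addr0 mulrC.
Qed.

End integral_tools.

(** * Fourier inversion and Parseval *)

Section fourier_inversion.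
Context {R : realType}.
Let mu := @lebesgue_measure R.
Implicit Types (f g : R -> R[i]) (h : R -> R).

Lemma Rintegral_fubini (K : R -> R -> R) (c : R) : 0 <= c ->
  measurable_fun setT (fun p : measurableTypeR R * measurableTypeR R => K p.1 p.2) ->
  (forall x, measurable_fun setT (K x)) ->
  (forall y, measurable_fun setT (K ^~ y)) ->
  (forall x y, `|K x y| <= c * jb (-2) x * jb (-2) y) ->
  \int[mu]_x \int[mu]_y K x y = \int[mu]_y \int[mu]_x K x y.
Proof.
move=> c0 mK mK1 mK2 bK.
have i0 (d : R) : mu.-integrable setT (EFin \o (fun y => d * jb (-2) y)).
  exact: (integrableZl measurableT d integrable_jb).
have i1 x : mu.-integrable setT (EFin \o K x).
  apply: (le_integrable measurableT _ _ (i0 (c * jb (-2) x))).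
    by apply/measurable_EFinP; exact: mK1.
  by move=> y _; rewrite /= lee_fin (le_trans (bK x y))// ler_norm.
have i2 y : mu.-integrable setT (EFin \o (K ^~ y)).
  apply: (le_integrable measurableT _ _ (i0 (c * jb (-2) y))).
    by apply/measurable_EFinP; exact: mK2.
  move=> x _; rewrite /= lee_fin (le_trans (bK x y))// mulrAC ler_norm//.
pose f (p : measurableTypeR R * measurableTypeR R) := (K p.1 p.2)%:E.
have mf : measurable_fun setT f by exact/measurable_EFinP.
have in_ x : (\int[mu]_y (`|K x y|)%:E <= (c * jb_mass * jb (-2) x)%:E)%E.
  have -> : c * jb_mass * jb (-2) x = \int[mu]_y (c * jb (-2) x * jb (-2) y).
    by rewrite RintegralZl ?integrable_jb// mulrAC.
  rewrite /Rintegral fineK; last exact: (integrable_fin_num measurableT (i0 _)).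
  apply: ge0_le_integral => //.
  - by apply/measurable_EFinP; apply: measurableT_comp => //; exact: mK1.
  - exact: (measurable_int mu (i0 _)).
  - by move=> y _; rewrite lee_fin bK.
have if_ : (mu \x mu)%E.-integrable setT f.
  apply/(integrable12ltyP mu mu mf).
  apply: (@le_lt_trans _ _ (\int[mu]_x (c * jb_mass * jb (-2) x)%:E)%E); last first.
    exact: (integrable_lty measurableT (i0 _)).
  apply: ge0_le_integral => //.
  - by move=> x _; exact: integral_ge0.
  - apply: (measurable_fun_fubini_tonelli_F (m2 := mu) (abse \o f)).
      exact: measurableT_comp.
    by move=> p; exact: abse_ge0.
  - exact: (measurable_int mu (i0 _)).
  - by move=> x _; exact: in_.
have := congr1 fine (Fubini if_).
have e1 x : (\int[mu]_y (K x y)%:E)%E = (\int[mu]_y K x y)%:E.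
  by rewrite /Rintegral fineK//; apply: (integrable_fin_num measurableT (i1 x)).
have e2 y : (\int[mu]_x (K x y)%:E)%E = (\int[mu]_x K x y)%:E.
  by rewrite /Rintegral fineK//; apply: (integrable_fin_num measurableT (i2 y)).
rewrite /f/=; under eq_integral do rewrite e1.
by under [X in _ = fine X -> _]eq_integral do rewrite e2.
Qed.

Lemma cintegral_fubini (K : R -> R -> R[i]) (c : R) : 0 <= c ->
  cmeasurable_fun setT (fun p : measurableTypeR R * measurableTypeR R => K p.1 p.2) ->
  (forall x, cmeasurable_fun setT (K x)) ->
  (forall y, cmeasurable_fun setT (K ^~ y)) ->
  (forall x y, normc (K x y) <= c * jb (-2) x * jb (-2) y) ->
  cintegral setT (fun x => cintegral setT (K x)) =
  cintegral setT (fun y => cintegral setT (K ^~ y)).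
Proof.
move=> c0 [m1 m2] m1' m2' bK; apply: complex_eqP.
- apply: (Rintegral_fubini (K := fun x y => Re (K x y)) c0) => //.
  + by move=> x; exact: (m1' x).1.
  + by move=> y; exact: (m2' y).1.
  + by move=> x y; exact: le_trans (le_Re_normc _) (bK x y).
- apply: (Rintegral_fubini (K := fun x y => Im (K x y)) c0) => //.
  + by move=> x; exact: (m1' x).2.
  + by move=> y; exact: (m2' y).2.
  + by move=> x y; exact: le_trans (le_Im_normc _) (bK x y).
Qed.

Lemma fourier_exchange f g : schwartz f -> schwartz g ->
  cintegral setT (fun n => fourier f n * g n) =
  cintegral setT (fun y => f y * fourier g y).
Proof.
move=> sf sg.
have [c c0 bf] := schwartz_bound (-2) sf; have [d d0 bg] := schwartz_bound (-2) sg.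
have cf := schwartz_continuous sf; have cg := schwartz_continuous sg.
pose K n y := g n * (expi (- n * y) * f y).
have mK : cmeasurable_fun setT (fun p : measurableTypeR R * measurableTypeR R => K p.1 p.2).
  have mcomp k : ccontinuous k ->
      cmeasurable_fun setT (fun p : measurableTypeR R * measurableTypeR R => k p.1) /\
      cmeasurable_fun setT (fun p : measurableTypeR R * measurableTypeR R => k p.2).
    move=> [k1 k2]; split; split.
    - exact: (measurableT_comp (continuous_measurable k1) measurable_fst).
    - exact: (measurableT_comp (continuous_measurable k2) measurable_fst).
    - exact: (measurableT_comp (continuous_measurable k1) measurable_snd).
    - exact: (measurableT_comp (continuous_measurable k2) measurable_snd).
  apply: cmeasurableM; first exact: (mcomp _ cg).1.
  apply: cmeasurableM; last exact: (mcomp _ cf).2.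
  have mq : measurable_fun setT (fun p : measurableTypeR R * measurableTypeR R => - p.1 * p.2).
    by apply: measurable_funM; [apply: measurable_funN; exact: measurable_fst|exact: measurable_snd].
  split.
  - exact: (measurableT_comp (continuous_measurable (@continuous_cos R)) mq).
  - exact: (measurableT_comp (continuous_measurable (@continuous_sin R)) mq).
have bK n y : normc (K n y) <= c * d * jb (-2) n * jb (-2) y.
  rewrite /K !normcM normc_expi mul1r.
  apply: le_trans (ler_pM (normc_ge0 _) (normc_ge0 _) (bg n) (bf y)) _.
  by rewrite le_eqVlt; apply/orP; left; apply/eqP; ring.
have H := cintegral_fubini (mulr_ge0 c0 d0) mK _ _ bK.
transitivity (cintegral setT (fun n => cintegral setT (K n))).
  apply: eq_cintegral => n _; rewrite (mulrC (fourier f n)) fourierE.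
  by rewrite -(cintegralZ (g n) measurableT (schwartz_cintegrable (schwartz_expi (- n) sf))).
rewrite H.
- apply: eq_cintegral => y _; rewrite fourierE.
  rewrite -(cintegralZ (f y) measurableT (schwartz_cintegrable (schwartz_expi (- y) sg))).
  apply: eq_cintegral => n _; rewrite /K (_ : - n * y = - y * n); last by ring.
  by ring.
- move=> n; apply: (ccontinuous_measurable measurableT).
  apply: ccontinuousM; first exact: ccontinuous_cst.
  by apply: (ccontinuousM _ cf); exact: ccontinuous_expi.
- move=> y; apply: (ccontinuous_measurable measurableT).
  apply: (ccontinuousM cg); apply: ccontinuousM; last exact: ccontinuous_cst.
  by apply: ccontinuous_ext (ccontinuous_expi (- y)) => n; rewrite mulrC mulrN mulNr.
Qed.

Definition gauss (x : R) : R := expR (- (x ^+ 2 / 2)).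

Lemma gauss_gt0 x : 0 < gauss x. Proof. exact: expR_gt0. Qed.
Lemma gauss_le1 x : gauss x <= 1.
Proof. by rewrite -expR0 ler_expR oppr_le0 divr_ge0// sqr_ge0. Qed.

Lemma is_derive_gauss (x : R) : is_derive x 1 gauss (- x * gauss x).
Proof.
have hq : is_derive x 1 (fun y : R => - (y ^+ 2 / 2) : R) (- x).
  have h := is_deriveN (is_deriveM (is_deriveM (is_derive_id x 1) (is_derive_id x 1))
    (is_derive_cst (2^-1 : R) x 1)).
  by apply: (is_derive_eq h); rewrite /GRing.scale /=; lra.
have h := is_derive1_comp (g := fun y : R => - (y ^+ 2 / 2))
  (is_derive_expR (- (x ^+ 2 / 2))) hq.
by apply: (is_derive_eq h); rewrite mulrC.
Qed.

Lemma gauss_jb (N : nat) x :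
  gauss x <= expR 2^-1 * (N.+1`!%:R * 2 ^+ N.+1) * jb (- (2 * N.+1%:R)) x.
Proof.
have y0 : 0 < (1 + x ^+ 2) / 2 by rewrite divr_gt0// onesqr_gt0.
have h := expR_ge1Dxn N (ltW y0); set y := (1 + x ^+ 2) / 2 in y0 h *.
have -> : jb (- (2 * N.+1%:R)) x = (2 * y) ^- N.+1.
  have -> : 2 * y = 1 + x ^+ 2 by rewrite /y mulrC divfK.
  rewrite jbN; congr (_^-1).
  rewrite /jb (_ : 2 * N.+1%:R / 2 = N.+1%:R); last by field.
  by rewrite powR_mulrn// ltW// onesqr_gt0.
have -> : gauss x = expR 2^-1 * (expR y)^-1.
  by rewrite -expRN -expRD /gauss /y; congr expR; lra.
rewrite -mulrA ler_wpM2l ?expR_ge0// exprMn invfM mulrA mulfK ?expf_neq0//.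
have f0 : 0 < (N.+1)`!%:R :> R by rewrite ltr0n fact_gt0.
rewrite -[_ / _]invrK invf_div lef_pV2 ?posrE ?expR_gt0 ?divr_gt0 ?exprn_gt0//.
by apply: le_trans h; rewrite lerDr.
Qed.

Lemma schwartz_gauss : schwartz (fun x => (gauss x)%:C).
Proof.
have r01 : (0 : R) <= 0 <= (1 : R) by rewrite lexx ler01.
have B a : exists2 c, 0 <= c & forall x, normc ((gauss x)%:C) <= c * jb a x.
  have [N aN] := exists_natN_le a.
  exists (expR 2^-1 * (N.+1`!%:R * 2 ^+ N.+1)).
    by rewrite !mulr_ge0 ?expR_ge0// exprn_ge0.
  move=> x; rewrite normcR (ger0_norm (ltW (gauss_gt0 x))).
  apply: le_trans (gauss_jb N x) _; apply: ler_wpM2l.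
    by rewrite !mulr_ge0 ?expR_ge0// exprn_ge0.
  apply: jb_le.
  by apply: le_trans aN; rewrite lerN2 -natr1; have := ler0n R N; lra.
apply/schwartzP => a k; elim: k a => [|k IH] a; have [c c0 h] := B a.
  by exists c => //; split.
have [d d0 sd] := IH (a - 0 - 1); have [e e0 se] := symbol_id setT r01 k.
exists (c + 2 ^+ k * (e * d)).
  by rewrite addr_ge0// !mulr_ge0// exprn_ge0.
apply: (symS _ (is_cder_real is_derive_gauss)).
  move=> x _; rewrite (le_trans (h x))// ler_wpM2r ?jb_ge0// lerDl.
  by rewrite !mulr_ge0// exprn_ge0.
apply: (sym_eq (f := fun x => (-1) * (x%:C * (gauss x)%:C))).
  by move=> x; rewrite mulN1r -realCM -realCN mulNr.
have := symZ (-1) (symM e0 d0 se sd); rewrite normcN normc1 mul1r.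
apply: sym_weaken => //.
- by lra.
- by rewrite lerDr.
- by rewrite addr_ge0// !mulr_ge0// exprn_ge0.
Qed.

End fourier_inversion.

Section fourier_inversion_theorem.
Context {R : realType}.
Let mu := @lebesgue_measure R.
Implicit Types (f g : R -> R[i]) (h : R -> R).

Lemma schwartz_affine f (e b : R) : e != 0 -> schwartz f ->
  schwartz (fun x => f (e * x + b)).
Proof.
move=> e0 sf.
pose C := 1 + 2 * (b ^+ 2 + 1) / e ^+ 2.
have C0 : 0 <= C.
  by rewrite addr_ge0// divr_ge0 ?sqr_ge0// mulr_ge0// addr_ge0 ?sqr_ge0.
have H2 x : jb (-2) (e * x + b) <= C * jb (-2) x.
  rewrite !jbN ler_pdivlMr ?jb_gt0// mulrC ler_pdivrMr ?jb_gt0// !jb2.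
  set y := e * x + b.
  have -> : x = (y - b) / e by rewrite /y addrK mulrC mulKf.
  have e2 : 0 < e ^+ 2 by rewrite exprn_even_gt0.
  have h1 : (y - b) ^+ 2 <= 2 * (b ^+ 2 + 1) * (1 + y ^+ 2).
    rewrite -subr_ge0 (_ : _ - _ = (y + b) ^+ 2 + 2 * (1 + (b * y) ^+ 2)); last by ring.
    by rewrite addr_ge0 ?sqr_ge0// mulr_ge0// addr_ge0// sqr_ge0.
  have h2 : (y - b) ^+ 2 / e ^+ 2 <= 2 * (b ^+ 2 + 1) / e ^+ 2 * (1 + y ^+ 2).
    by rewrite [leRHS]mulrAC ler_wpM2r// invr_ge0 ltW.
  by rewrite exprMn exprVn /C mulrDl mul1r lerD// lerDl sqr_ge0.
have HN N x : jb (- (2 * N%:R)) (e * x + b) <= C ^+ N * jb (- (2 * N%:R)) x.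
  elim: N => [|N IH]; first by rewrite mulr0 oppr0 !jb0 mul1r.
  rewrite (_ : - (2 * N.+1%:R) = -2 + - (2 * N%:R)); last by rewrite -natr1; ring.
  by rewrite !jbD exprS mulrACA; apply: ler_pM; rewrite ?jb_ge0.
have B g a : schwartz g ->
    exists2 c, 0 <= c & forall x, normc (g (e * x + b)) <= c * jb a x.
  move=> sg; have [N aN] := exists_natN_le a.
  have [c c0 h] := schwartz_bound (- (2 * N%:R)) sg.
  exists (c * C ^+ N); first by rewrite mulr_ge0// exprn_ge0.
  move=> x; apply: le_trans (h _) _; rewrite -mulrA; apply: ler_wpM2l => //.
  apply: le_trans (HN N x) _; apply: ler_wpM2l; first exact: exprn_ge0.
  by apply: jb_le; apply: le_trans aN; rewrite lerN2; have := ler0n R N; lra.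
apply/schwartzP => a k; elim: k a f sf => [|k IH] a f sf; have [c c0 h] := B f a sf.
  by exists c => //; split.
have [hf sf'] := schwartz_der sf.
have [d d0 sd] := IH (a - 0) _ sf'.
exists (c + normc e%:C * d); first by rewrite addr_ge0// mulr_ge0 ?normc_ge0.
apply: (symS _ (is_cder_affine e b hf)).
  move=> x _; rewrite (le_trans (h x))// ler_wpM2r ?jb_ge0// lerDl.
  by rewrite mulr_ge0 ?normc_ge0.
apply: sym_weaken (symZ e%:C sd) => //; first by rewrite lerDr.
by rewrite addr_ge0// mulr_ge0 ?normc_ge0.
Qed.

Lemma schwartz_ext f g : f =1 g -> schwartz f -> schwartz g.
Proof. by move=> /funext ->. Qed.

Lemma schwartz_scale f (e : R) : e != 0 -> schwartz f ->
  schwartz (fun x => f (e * x)).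
Proof.
by move=> e0 sf; apply: schwartz_ext (schwartz_affine 0 e0 sf) => x; rewrite addr0.
Qed.

Lemma schwartz_shift f (b : R) : schwartz f -> schwartz (fun x => f (x + b)).
Proof.
move=> sf; apply: schwartz_ext (schwartz_affine b (oner_neq0 R) sf) => x.
by rewrite mul1r.
Qed.

Lemma schwartz_reflect f : schwartz f -> schwartz (fun x => f (- x)).
Proof.
move=> sf; have e0 : (-1 : R) != 0 by rewrite oppr_eq0 oner_neq0.
by apply: schwartz_ext (schwartz_scale e0 sf) => x; rewrite mulN1r.
Qed.

Definition gauss_mass : R := \int[mu]_x gauss x.

Lemma gauss_massE : gauss_mass = Num.sqrt (2 * pi).
Proof.
have := @integral_normal_pdf R 0 1.
have -> : (fun x : R => (normal_pdf 0 1 x)%:E) =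
    (fun x => ((Num.sqrt (2 * pi))^-1 * gauss x)%:E).
  apply/funext => x; rewrite normal_pdfE ?oner_neq0//; congr (_%:E).
  rewrite /normal_peak /normal_fun /gauss expr1n mul1r subr0.
  by rewrite mulNr !(mulr_natl, mulr1n).
have ig : mu.-integrable setT (EFin \o gauss).
  by have [] := schwartz_cintegrable (@schwartz_gauss R).
move=> /(congr1 fine); rewrite -/(Rintegral _ _ _) RintegralZl// => /= h.
have p0 : Num.sqrt (2 * pi) != 0 :> R by rewrite gt_eqF// sqrtr_gt0 mulr_gt0// pi_gt0.
by apply/eqP; rewrite -(inj_eq (mulfI (invr_neq0 p0))) h mulVf.
Qed.

Lemma sqr_i_eq : 'i * 'i = -1 :> R[i].
Proof. by apply: complex_eqP; rewrite !(ReM, ImM) /=; ring. Qed.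

Lemma fourier_gauss n :
  fourier (fun x => (gauss x)%:C) n = (gauss_mass * gauss n)%:C :> R[i].
Proof.
have sg := @schwartz_gauss R.
have dg := is_cder_real (@is_derive_gauss R).
pose F := fourier (fun x => (gauss x)%:C : R[i]).
have dF : is_cder F (fun n => (- n)%:C * F n).
  apply: is_cder_eq (schwartz_is_cder_fourier sg) => // m.
  have -> : (fun x => - 'i * x%:C * (gauss x)%:C) =
      (fun x => 'i * cder (fun x => (gauss x)%:C : R[i]) x).
    apply/funext => x; rewrite -(is_cderE dg) realCM realCN; ring.
  have [_ sg'] := schwartz_der sg.
  rewrite (schwartz_fourierZ _ _ sg') (schwartz_fourier_cder sg) !mulrA.
  by rewrite sqr_i_eq mulN1r realCN.
have de (x : R) : is_derive x 1 (fun y => (gauss y)^-1 : R) (x * (gauss x)^-1).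
  have g0 : gauss x != 0 by rewrite gt_eqF// gauss_gt0.
  apply: (is_derive_eq (is_deriveV g0 (is_derive_gauss x))).
  by rewrite /GRing.scale /= expr2 invfM; field.
have dH : is_cder (fun n => F n * ((gauss n)^-1)%:C) (fun=> 0).
  apply: is_cder_eq (is_cderM dF (is_cder_real de)) => // x.
  by rewrite realCM realCN; ring.
have HC : F n * ((gauss n)^-1)%:C = F 0 * ((gauss 0)^-1)%:C.
  apply: complex_eqP.
  - by apply: (is_derive_0_is_cst (f := fun n => Re (F n * ((gauss n)^-1)%:C))) => x;
      have [] := dH x.
  - by apply: (is_derive_0_is_cst (f := fun n => Im (F n * ((gauss n)^-1)%:C))) => x;
      have [] := dH x.
have gn0 : gauss n != 0 by rewrite gt_eqF// gauss_gt0.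
have g1 : gauss 0 = 1 :> R by rewrite /gauss expr0n mul0r oppr0 expR0.
have F0 : F 0 = gauss_mass%:C.
  have -> : F 0 = cintegral setT (fun x => (gauss x)%:C).
    by apply: eq_cintegral => x _; rewrite mul0r oppr0 expi0 mul1r.
  by apply: complex_eqP => //=; rewrite Rintegral_cst// mul0r.
move: HC; rewrite g1 invr1 mulr1 F0 => /(congr1 (fun z => z * (gauss n)%:C)).
by rewrite -mulrA -!realCM mulVf// mulr1.
Qed.

Lemma ccontinuous_cvg f (z_ : nat -> R) (z : R) : ccontinuous f ->
  z_ n @[n --> \oo] --> z ->
  normc (f (z_ n) - f z) @[n --> \oo] --> (0 : R).
Proof.
move=> [c1 c2] hz.
have k1 : Re (f (z_ n)) @[n --> \oo] --> Re (f z) by exact: (cvg_comp _ _ hz (c1 z)).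
have k2 : Im (f (z_ n)) @[n --> \oo] --> Im (f z) by exact: (cvg_comp _ _ hz (c2 z)).
apply/cvgr0Pnorm_le => e e0; have e2 : 0 < e / 2 by rewrite divr_gt0.
near=> n; rewrite ger0_norm ?normc_ge0// (le_trans (normc_le _))//.
rewrite ReB ImB [leRHS](splitr e) lerD//.
- by rewrite distrC; near: n; move/cvgrPdist_le : k1; exact.
- by rewrite distrC; near: n; move/cvgrPdist_le : k2; exact.
Unshelve. all: by end_near. Qed.

Lemma cvg0M (a : R) (u v : nat -> R) : u n @[n --> \oo] --> (0 : R) ->
  (forall n, v n = a * u n) -> v n @[n --> \oo] --> (0 : R).
Proof.
move=> hu /funext ->; rewrite -(mulr0 a).
by apply: cvgM => //; exact: cvg_cst.
Qed.

Lemma gauss_regularization f (e : R) : schwartz f -> 0 < e ->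
  cintegral setT (fun n => fourier f n * (gauss (e * n))%:C) =
  gauss_mass%:C * cintegral setT (fun z => f (e * z) * (gauss z)%:C).
Proof.
move=> sf e0; have ne0 : e != 0 by rewrite gt_eqF.
have ie0 : 0 < e^-1 by rewrite invr_gt0.
have sg := @schwartz_gauss R; have sge := schwartz_scale ne0 sg.
have E y : fourier (fun x => (gauss (e * x))%:C) y =
    (e^-1 * (gauss_mass * gauss (e^-1 * y)))%:C.
  have sy := schwartz_expi (- y) sge.
  have [c c0 b] := schwartz_bound (-2) sy.
  rewrite fourierE (cintegral_affine 0 ie0 (schwartz_continuous sy) b).
  rewrite realCM -fourier_gauss fourierE.
  rewrite -(cintegralZ _ measurableT (schwartz_cintegrable (schwartz_expi _ sg))).
  apply: eq_cintegral => x _; rewrite addr0 mulVKf//.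
  by congr (_ * (expi _ * _)); ring.
rewrite (fourier_exchange sf sge).
have sfg : schwartz (fun y => f y * (gauss (e^-1 * y))%:C).
  have := scont_schwartz (scont_mul ((schwartzP f).1 sf 0)) (schwartz_scale (lt0r_neq0 ie0) sg).
  by [].
pose k y := (e^-1 * gauss_mass)%:C * (f y * (gauss (e^-1 * y))%:C).
have sk : schwartz k by exact: schwartzZ.
have [c c0 b] := schwartz_bound (-2) sk.
have -> : cintegral setT (fun y => f y * fourier (fun x => (gauss (e * x))%:C) y) =
    cintegral setT k.
  by apply: eq_cintegral => y _; rewrite E /k mulrA !realCM; ring.
rewrite (cintegral_affine 0 e0 (schwartz_continuous sk) b).
have sz : schwartz (fun z => f (e * z) * (gauss z)%:C).
  exact: (scont_schwartz (scont_mul ((schwartzP _).1 (schwartz_scale ne0 sf) 0)) sg).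
rewrite -(cintegralZ _ measurableT (schwartz_cintegrable sz)).
apply: eq_cintegral => z _; rewrite /k addr0 mulKf// mulrA -realCM.
by rewrite (mulrA e) mulfV// mul1r.
Qed.

Lemma integral_fourier f : schwartz f ->
  cintegral setT (fourier f) = (2 * pi)%:C * f 0.
Proof.
move=> sf; have sF := scont_schwartz scont_fourier sf; have sg := @schwartz_gauss R.
pose e_ (n : nat) : R := n.+1%:R^-1.
have e0 n : 0 < e_ n by rewrite invr_gt0 ltr0n.
have ez (z : R) : e_ n * z @[n --> \oo] --> (0 : R).
  rewrite -(mul0r z); apply: cvgM; [exact: cvg_harmonic|exact: cvg_cst].
have [c c0 bf] := schwartz_bound 0 sf.
apply: (normc_cvg_unique
  (z_ := fun n => cintegral setT (fun x => fourier f x * (gauss (e_ n * x))%:C))).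
- apply: (cvg_cintegral (h := fun x => normc (fourier f x))) => //.
  + move=> n; apply: (ccontinuous_measurable measurableT).
    apply: ccontinuousM; first exact: schwartz_continuous.
    exact: schwartz_continuous (schwartz_scale (lt0r_neq0 (e0 n)) sg).
  + exact/(ccontinuous_measurable measurableT)/schwartz_continuous.
  + exact: (integrable_normc measurableT (schwartz_cintegrable sF)).
  + move=> n x _; rewrite normcM normcR (ger0_norm (ltW (gauss_gt0 _))).
    by rewrite ler_piMr ?normc_ge0 ?gauss_le1.
  + move=> x _.
    have h := ccontinuous_cvg (schwartz_continuous sg) (ez x).
    have g1 : gauss 0 = 1 :> R by rewrite /gauss expr0n mul0r oppr0 expR0.
    apply: (cvg0M (a := normc (fourier f x)) h) => n.
    by rewrite -normcM mulrBr g1 mulr1.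
- have -> : (2 * pi)%:C * f 0 = gauss_mass%:C *
      cintegral setT (fun z => f 0 * (gauss z)%:C).
    rewrite (cintegralZ _ measurableT (schwartz_cintegrable sg)).
    have -> : cintegral setT (fun x => (gauss x)%:C) = gauss_mass%:C.
      by apply: complex_eqP => //=; rewrite Rintegral_cst// mul0r.
    rewrite mulrCA -realCM gauss_massE -expr2 sqr_sqrtr 1?mulrC//.
    by rewrite mulr_ge0// pi_ge0.
  have H : normc (cintegral setT (fun z => f (e_ n * z) * (gauss z)%:C) -
      cintegral setT (fun z => f 0 * (gauss z)%:C)) @[n --> \oo] --> (0 : R).
    apply: (cvg_cintegral (h := fun x => c * gauss x)) => //.
    + move=> n; apply: (ccontinuous_measurable measurableT).
      apply: ccontinuousM; last exact: schwartz_continuous.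
      exact: schwartz_continuous (schwartz_scale (lt0r_neq0 (e0 n)) sf).
    + apply: (ccontinuous_measurable measurableT).
      by apply: ccontinuousM; [exact: ccontinuous_cst|exact: schwartz_continuous].
    + have [ig _] := schwartz_cintegrable sg.
      exact: (integrableZl measurableT c ig).
    + move=> n x _; rewrite normcM normcR (ger0_norm (ltW (gauss_gt0 _))).
      rewrite ler_wpM2r ?(ltW (gauss_gt0 _))// (le_trans (bf _))// jb0 mulr1//.
    + move=> x _; rewrite normcM normcR (ger0_norm (ltW (gauss_gt0 _))).
      by rewrite ler_wpM2r ?(ltW (gauss_gt0 _))// (le_trans (bf _))// jb0 mulr1.
    + move=> x _; have h := ccontinuous_cvg (schwartz_continuous sf) (ez x).
      apply: (cvg0M (a := normc ((gauss x)%:C : R[i])) h) => n.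
      by rewrite [RHS]mulrC -normcM mulrBl.
  apply: (cvg0M (a := normc (gauss_mass%:C : R[i])) H) => n.
  by rewrite -normcM mulrBr gauss_regularization.
Qed.

Lemma fourier_shift f (b n : R) : schwartz f ->
  fourier (fun x => f (x + b)) n = expi (n * b) * fourier f n.
Proof.
move=> sf; have sy := schwartz_expi (- n) sf.
have [c c0 bd] := schwartz_bound (-2) sy.
rewrite [fourier f n]fourierE (cintegral_affine b ltr01 (schwartz_continuous sy) bd).
rewrite fourierE.
have ss := schwartz_expi (- n) (schwartz_shift b sf).
have E : cintegral setT (fun x => 1%:C * (expi (- n * (1 * x + b)) * f (1 * x + b))) =
    cintegral setT (fun x => expi (- (n * b)) * (expi (- n * x) * f (x + b))).
  apply: eq_cintegral => x _; rewrite !mul1r mulrDr expiD (mulNr n b).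
  by ring.
rewrite E (cintegralZ _ measurableT (schwartz_cintegrable ss)) mulrA -expiD.
by rewrite subrr expi0 mul1r.
Qed.

Lemma fourier_fourier f x : schwartz f ->
  fourier (fourier f) x = (2 * pi)%:C * f (- x).
Proof.
move=> sf; rewrite -[- x]add0r -(integral_fourier (schwartz_shift (- x) sf)).
apply: eq_cintegral => n _; rewrite fourier_shift// mulrN; congr (expi _ * _).
by rewrite mulrC.
Qed.

Lemma pi2C_neq0 : (2 * pi)%:C != 0 :> R[i].
Proof. by rewrite eq_complex /= negb_and mulf_neq0// gt_eqF// pi_gt0. Qed.

Lemma fourier_reflect f x : schwartz f ->
  fourier (fun y => f (- y)) x = fourier f (- x).
Proof.
move=> sf; have sF := scont_schwartz scont_fourier sf.
apply: (mulfI pi2C_neq0); rewrite -(fourier_fourier x sF).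
rewrite -(schwartz_fourierZ _ _ (schwartz_reflect sf)); congr fourier.
by apply/funext => y; rewrite fourier_fourier.
Qed.

Lemma inv_fourierE f x : inv_fourier f x = ((2 * pi)^-1)%:C * fourier f (- x).
Proof.
congr (_ * _); apply: eq_cintegral => n _; congr (expi _ * _).
by rewrite mulNr opprK mulrC.
Qed.

Lemma pi2CK (z : R[i]) : ((2 * pi)^-1)%:C * ((2 * pi)%:C * z) = z.
Proof. by rewrite mulrA -realCM mulVf ?mul1r// mulf_neq0// gt_eqF// pi_gt0. Qed.

Lemma fourierK f : schwartz f -> inv_fourier (fourier f) = f.
Proof.
move=> sf; apply/funext => x.
by rewrite inv_fourierE fourier_fourier// opprK pi2CK.
Qed.

Lemma sym_reflect k a c f : sym setT 0 k a c f ->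
  sym setT 0 k a c (fun x => f (- x)).
Proof.
elim: k a f => [|k IH] a f; first by move=> [h _]; split=> // x _; rewrite -jb_even h.
move=> [h [f' hf sf]]; have hd := is_cder_affine (-1) 0 hf.
have {}hd : is_cder (fun x => f (- x)) (fun x => -1 * f' (- x)).
  by apply: is_cder_eq hd => x; rewrite addr0 (mulN1r x)// realCN.
apply: (symS _ hd); first by move=> x _; rewrite -jb_even h.
by have := symZ (-1) (IH _ _ sf); rewrite normcN normc1 mul1r.
Qed.

Lemma scont_inv_fourier : scont (@inv_fourier R).
Proof.
move=> k a; have [k' [a' [C [C0 h]]]] := scont_scale ((2 * pi)^-1)%:C scont_fourier k a.
exists k', a', C; split=> // f c c0 sf s.
have sf' := schwartz_reflect sf.
have s' := sym_reflect s.
apply: sym_eq (h _ c c0 sf' s') => x.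
by rewrite inv_fourierE fourier_reflect.
Qed.

Lemma inv_fourierK f : schwartz f -> fourier (inv_fourier f) = f.
Proof.
move=> sf; apply/funext => x.
have -> : inv_fourier f = (fun x => ((2 * pi)^-1)%:C * fourier (fun y => f (- y)) x).
  by apply/funext => y; rewrite inv_fourierE fourier_reflect.
have sr := schwartz_reflect sf.
rewrite schwartz_fourierZ; last exact: (scont_schwartz scont_fourier).
by rewrite fourier_fourier// opprK pi2CK.
Qed.

End fourier_inversion_theorem.

(** * Fourier multipliers *)

Section multipliers.
Context {R : realType}.
Let mu := @lebesgue_measure R.
Implicit Types (f g m : R -> R[i]).

(** The transpose of [fourier_multiplier m], acting on Schwartz functions. *)
Definition Tm m f : R -> R[i] := fourier (fun n => m n * inv_fourier f n).

Definition slow m := exists a, symbol setT 0 a m.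

Lemma scont_Tm m : slow m -> scont (Tm m).
Proof.
move=> [a sm].
exact: (scont_comp scont_fourier (scont_comp (scont_mul sm) scont_inv_fourier)).
Qed.

Lemma schwartz_inv_fourier f : schwartz f -> schwartz (inv_fourier f).
Proof. exact: scont_schwartz scont_inv_fourier. Qed.

Lemma schwartz_fourier f : schwartz f -> schwartz (fourier f).
Proof. exact: scont_schwartz scont_fourier. Qed.

Lemma schwartz_slow m f : slow m -> schwartz f -> schwartz (fun n => m n * f n).
Proof. by move=> [a sm]; exact: scont_schwartz (scont_mul sm). Qed.

Lemma schwartz_Tm m f : slow m -> schwartz f -> schwartz (Tm m f).
Proof. by move=> sm; exact: scont_schwartz (scont_Tm sm). Qed.

Lemma fourier_multiplierE m (u : functional R) f : slow m -> schwartz f ->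
  fourier_multiplier m u f = u (Tm m f).
Proof.
move=> sm sf; have s1 := schwartz_inv_fourier sf.
have s2 := schwartz_slow sm s1.
rewrite /fourier_multiplier /dinv_fourier /dmul /dfourier /on_schwartz.
by rewrite (asboolT sf) (asboolT s1) (asboolT s2).
Qed.

Lemma fourier_multiplier0 m (u : functional R) f : ~ schwartz f ->
  fourier_multiplier m u f = 0.
Proof.
by move=> nf; rewrite /fourier_multiplier /dinv_fourier /on_schwartz asboolF.
Qed.

Lemma inv_fourier_Tm m f : slow m -> schwartz f ->
  inv_fourier (Tm m f) = (fun n => m n * inv_fourier f n).
Proof.
by move=> sm sf; apply: fourierK; apply: schwartz_slow => //; exact: schwartz_inv_fourier.
Qed.

Lemma Tm_comp m m' f : slow m' -> schwartz f ->
  Tm m (Tm m' f) = Tm (fun n => m n * m' n) f.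
Proof.
move=> sm' sf; rewrite /Tm -/(Tm m' f) inv_fourier_Tm//.
by congr fourier; apply/funext => n; rewrite mulrA.
Qed.

Lemma Tm1 f : schwartz f -> Tm (fun=> 1) f = f.
Proof.
move=> sf; rewrite /Tm -[RHS](inv_fourierK sf); congr fourier.
by apply/funext => n; rewrite mul1r.
Qed.

Lemma eq_Tm m m' f : m =1 m' -> Tm m f = Tm m' f.
Proof. by move=> /funext ->. Qed.

Lemma inv_fourierD (z : R[i]) f g : schwartz f -> schwartz g ->
  inv_fourier (fun x => z * f x + g x) =
  (fun n => z * inv_fourier f n + inv_fourier g n).
Proof.
move=> sf sg; apply/funext => n; rewrite !inv_fourierE.
rewrite (schwartz_fourierD _ (schwartzZ z sf) sg) (schwartz_fourierZ _ _ sf).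
by ring.
Qed.

Lemma TmD m (z : R[i]) f g : slow m -> schwartz f -> schwartz g ->
  Tm m (fun x => z * f x + g x) = (fun x => z * Tm m f x + Tm m g x).
Proof.
move=> sm sf sg; apply/funext => x; rewrite /Tm inv_fourierD//.
have s1 := schwartz_slow sm (schwartz_inv_fourier sf).
have s2 := schwartz_slow sm (schwartz_inv_fourier sg).
rewrite -(schwartz_fourierZ _ _ s1) -(schwartz_fourierD _ (schwartzZ z s1) s2).
by congr fourier; apply/funext => n; ring.
Qed.

Lemma Tm_addsym m m' f x : slow m -> slow m' -> schwartz f ->
  Tm (fun n => m n + m' n) f x = Tm m f x + Tm m' f x.
Proof.
move=> sm sm' sf; have s0 := schwartz_inv_fourier sf.
rewrite -(schwartz_fourierD _ (schwartz_slow sm s0) (schwartz_slow sm' s0)).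
by congr fourier; apply/funext => n; rewrite mulrDl.
Qed.

Lemma slow_symbol a rho m : 0 <= rho -> symbol setT rho a m -> slow m.
Proof. by move=> r0 sm; exists a; exact: symbol_weaken sm. Qed.

Lemma slowM m m' : slow m -> slow m' -> slow (fun n => m n * m' n).
Proof. by move=> [a sa] [b sb]; exists (a + b); exact: symbolM. Qed.

Lemma tempered_multiplier m (u : functional R) : slow m -> tempered u ->
  tempered (fourier_multiplier m u).
Proof.
move=> sm tu; have [u0 uD _] := tu; split.
- by move=> f nf; exact: fourier_multiplier0.
- move=> z f g sf sg.
  rewrite !fourier_multiplierE//; last by apply: schwartzD => //; exact: schwartzZ.
  by rewrite TmD// uD//; exact: schwartz_Tm.
- move=> f_ sf_ h.
  have zf := scont_szero (scont_Tm sm) sf_ (cvg_szero sf_ h).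
  have := tempered_cvg tu (fun n => schwartz_Tm sm (sf_ n)) zf.
  by under eq_fun do rewrite -fourier_multiplierE//.
Qed.

(** ** Plancherel *)

Lemma Re_conj (z : R[i]) : Re (conjc z) = Re z. Proof. by case: z. Qed.
Lemma Im_conj (z : R[i]) : Im (conjc z) = - Im z. Proof. by case: z. Qed.

Lemma conjM (z w : R[i]) : conjc (z * w) = conjc z * conjc w.
Proof. exact: rmorphM. Qed.

Lemma sym_conj A rho k a c f : sym A rho k a c f ->
  sym A rho k a c (fun x => conjc (f x)).
Proof.
elim: k a f => [|k IH] a f.
  by move=> [h _]; split=> // x Ax; rewrite normc_conj h.
move=> [h [f' hf sf]]; apply: (symS (f' := fun x => conjc (f' x))).
- by move=> x Ax; rewrite normc_conj h.
- move=> x; have [h1 h2] := hf x; split.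
  + rewrite (_ : _ \o _ = Re \o f); last by apply/funext => y; exact: Re_conj.
    by apply: (is_derive_eq h1); rewrite Re_conj.
  + rewrite (_ : _ \o _ = - (Im \o f)); last by apply/funext => y; exact: Im_conj.
    by apply: (is_derive_eq (is_deriveN h2)); rewrite Im_conj.
- exact: IH.
Qed.

Lemma schwartz_conj f : schwartz f -> schwartz (fun x => conjc (f x)).
Proof.
move=> /schwartzP sf; apply/schwartzP => a k; have [c c0 h] := sf a k.
by exists c => //; exact: sym_conj.
Qed.

Lemma cintegral_conj f : cintegrable setT f ->
  cintegral setT (fun x => conjc (f x)) = conjc (cintegral setT f).
Proof.
move=> [i1 i2]; apply: complex_eqP; rewrite ?Re_conj ?Im_conj /cintegral /=.
  by apply: eq_Rintegral => x _; rewrite Re_conj.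
rewrite -[RHS]mulN1r -RintegralZl//.
by apply: eq_Rintegral => x _; rewrite Im_conj mulN1r.
Qed.

Definition nrm2 f : R := \int[mu]_x (normc (f x) ^+ 2).

Lemma mul_conj (z : R[i]) : z * conjc z = (normc z ^+ 2)%:C.
Proof. by rewrite sqr_normc; case: z => a b; apply: complex_eqP => /=; ring. Qed.

Lemma nrm2E f : (nrm2 f)%:C = cintegral setT (fun x => f x * conjc (f x)).
Proof.
apply: complex_eqP; rewrite /cintegral /=.
  by apply: eq_Rintegral => x _; rewrite mul_conj.
rewrite -[LHS](mul0r (fine (mu setT))) -Rintegral_cst//.
by apply: eq_Rintegral => x _; rewrite mul_conj.
Qed.

Lemma plancherel f : schwartz f -> nrm2 (fourier f) = 2 * pi * nrm2 f.
Proof.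
move=> sf; apply: complexI; rewrite realCM !nrm2E.
pose k y := conjc (f (- y)).
have sk : schwartz k by apply: schwartz_conj; exact: schwartz_reflect.
have Fk n : conjc (fourier f n) = fourier k n.
  rewrite (@fourier_reflect _ (fun x => conjc (f x))); last exact: schwartz_conj.
  rewrite !fourierE -cintegral_conj; last first.
    by apply: schwartz_cintegrable; exact: schwartz_expi.
  by apply: eq_cintegral => x _; rewrite conjM conj_expi; congr (expi _ * _); ring.
have -> : cintegral setT (fun x => fourier f x * conjc (fourier f x)) =
    cintegral setT (fun n => fourier f n * fourier k n).
  by apply: eq_cintegral => n _; rewrite Fk.
rewrite (fourier_exchange sf (schwartz_fourier sk)).
have sfc : schwartz (fun x => f x * conjc (f x)).
  by apply: schwartz_slow (schwartz_conj sf); exists 0; exact: ((schwartzP f).1 sf 0).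
rewrite -(cintegralZ _ measurableT (schwartz_cintegrable sfc)).
apply: eq_cintegral => y _; rewrite fourier_fourier// /k opprK.
by ring.
Qed.

End multipliers.

Section pseudo_locality.
Context {R : realType}.
Let mu := @lebesgue_measure R.
Implicit Types (f g m : R -> R[i]).

Lemma Tm_L2 m f (M : R) : slow m -> schwartz f -> (forall n, normc (m n) <= M) ->
  nrm2 (Tm m f) <= M ^+ 2 * nrm2 f.
Proof.
move=> sm sf mM; have s1 := schwartz_inv_fourier sf.
have s2 := schwartz_slow sm s1.
have isq g : schwartz g -> mu.-integrable setT (EFin \o (fun x => normc (g x) ^+ 2)).
  move=> sg; have sgc := schwartz_slow
    (ex_intro _ 0 ((schwartzP _).1 sg 0)) (schwartz_conj sg).
  have [i1 _] := schwartz_cintegrable sgc.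
  by apply: eq_integrable i1 => // x _; rewrite /= mul_conj.
rewrite plancherel// -{2}(inv_fourierK sf) plancherel//.
rewrite [leRHS]mulrCA ler_wpM2l ?mulr_ge0 ?pi_ge0//.
rewrite /nrm2 -RintegralZl//; last exact: isq.
apply: le_Rintegral => //; first exact: isq.
  exact: (integrableZl measurableT _ (isq _ s1)).
move=> x _; rewrite normcM exprMn ler_wpM2r ?sqr_ge0//.
by rewrite lerXn2r ?nnegrE ?normc_ge0// (le_trans (normc_ge0 _) (mM x)).
Qed.

(** The commutator of a Fourier multiplier with multiplication by [c - y],
    evaluated at [c], only involves the derivative of the symbol. *)
Lemma Tm_commutator m g (c : R) : slow m -> slow (cder m) -> is_cder m (cder m) ->
  schwartz g ->
  Tm m (fun y => (c - y)%:C * g y) c = - 'i * Tm (cder m) g c.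
Proof.
move=> sm sm' hm sg.
have r01 : (0 : R) <= 0 <= (1 : R) by rewrite lexx ler01.
have sx : slow (fun x : R => x%:C) by exists 1; exact: symbol_id.
have sxg := schwartz_slow sx sg.
pose G := inv_fourier g; have sG := schwartz_inv_fourier sg.
have dG : is_cder G (fun n => 'i * inv_fourier (fun y => y%:C * g y) n).
  have h := schwartz_is_cder_fourier (schwartz_reflect sg).
  have := is_cderZ ((2 * pi)^-1)%:C h; apply: is_cder_eq => n.
    by rewrite /G inv_fourierE fourier_reflect.
  rewrite inv_fourierE -(fourier_reflect _ sxg) mulrCA.
  rewrite -(schwartz_fourierZ ('i)%R n (schwartz_reflect sxg)).
  have -> : (fun x => - 'i * x%:C * g (- x)) =
      (fun x => 'i * ((fun y => y%:C * g y) (- x))).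
    by apply/funext => y; rewrite /= realCN; ring.
  by [].
have [_ sG'] := schwartz_der sG.
have EG : cder G = fun n => 'i * inv_fourier (fun y => y%:C * g y) n.
  by rewrite -(is_cderE dG).
have E1 : inv_fourier (fun y => (c - y)%:C * g y) =
    fun n => c%:C * G n + 'i * cder G n.
  have -> : (fun y => (c - y)%:C * g y) =
      (fun y => (-1) * (y%:C * g y) + c%:C * g y).
    by apply/funext => y; rewrite realCD realCN; ring.
  rewrite (inv_fourierD _ sxg (schwartzZ c%:C sg)).
  apply/funext => n; rewrite EG mulrA sqr_i_eq addrC; congr (_ + _).
  have := inv_fourierD c%:C sg (@schwartz0 R) => /(congr1 (fun f => f n)).
  under [X in inv_fourier X]funext do rewrite addr0.
  move=> ->; rewrite [X in _ + X](_ : _ = 0) ?addr0//.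
  rewrite /inv_fourier [cintegral _ _](_ : _ = cintegral setT (fun=> 0)).
    by apply: complex_eqP; rewrite /= ?Rintegral_cst// !mul0r ?subr0 ?addr0 ?mulr0 ?mul0r// ?addr0 ?subrr.
  by apply: eq_cintegral => x _; rewrite mulr0.
have smG := schwartz_slow sm sG; have smG' := schwartz_slow sm sG'.
have sm'G := schwartz_slow sm' sG.
have dmG := is_cderM hm dG.
have E2 : cder (fun n => m n * G n) = fun n => cder m n * G n + m n * cder G n.
  by rewrite -(is_cderE dmG) EG.
rewrite /Tm E1 -/G.
have -> : (fun n => m n * (c%:C * G n + 'i * cder G n)) =
    (fun n => c%:C * (m n * G n) + 'i * (m n * cder G n)).
  by apply/funext => n; ring.
rewrite (schwartz_fourierD _ (schwartzZ _ smG) (schwartzZ _ smG')).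
rewrite (schwartz_fourierZ _ _ smG) (schwartz_fourierZ _ _ smG').
have := schwartz_fourier_cder smG c; rewrite E2.
rewrite (schwartz_fourierD _ sm'G smG') => h.
have {}h : c%:C * fourier (fun n => m n * G n) c =
    - 'i * (fourier (fun n => cder m n * G n) c + fourier (fun n => m n * cder G n) c).
  by rewrite h mulNr -!mulrA (mulrA 'i 'i) sqr_i_eq; ring.
by rewrite h; ring.
Qed.

Lemma symbol_cderiven rho a m M : symbol setT rho a m ->
  symbol setT rho (a - rho *+ M) (cderiven M m).
Proof.
elim: M a m => [|M IH] a m sm; first by rewrite mulr0n subr0 cderiven0.
have [_ sm'] := symbol_der sm; rewrite cderivenSr mulrS opprD addrA.
exact: IH.
Qed.

Lemma Tm_commutator_iter a m g (c : R) M : symbol setT 1 a m -> schwartz g ->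
  Tm m (fun y => (c - y)%:C ^+ M * g y) c = (- 'i) ^+ M * Tm (cderiven M m) g c.
Proof.
have sl (b : R) k : symbol setT 1 b k -> slow k by exact: slow_symbol.
have r01 : (0 : R) <= 0 <= (1 : R) by rewrite lexx ler01.
have sx : slow (fun y : R => (c - y)%:C).
  exists 1; apply: (symbol_eq (f := fun y : R => (-1) * y%:C + c%:C)).
    by move=> y; rewrite realCD realCN; ring.
  apply: symbolD; first by apply: symbolZ; exact: symbol_id.
  by apply: symbol_weaken (symbol_cst setT c%:C (lexx 0)).
elim: M a m g => [|M IH] a m g sm sg.
  rewrite cderiven0 expr0 mul1r; congr (Tm m _ c).
  by apply/funext => y; rewrite mul1r.
have [hm sm'] := symbol_der sm.
have -> : (fun y => (c - y)%:C ^+ M.+1 * g y) =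
    (fun y => (c - y)%:C ^+ M * ((c - y)%:C * g y)).
  by apply/funext => y; rewrite exprSr mulrA.
rewrite (IH _ _ _ sm (schwartz_slow sx sg)).
have [hM sM] := symbol_der (symbol_cderiven M sm).
rewrite (Tm_commutator c (sl _ _ (symbol_cderiven M sm)) (sl _ _ sM) hM sg).
by rewrite mulrA -exprSr cderivenS.
Qed.

Definition nrm1 f : R := \int[mu]_x normc (f x).

Lemma Tm_sup_bound m g (c x : R) : slow m -> schwartz g ->
  (forall n, normc (m n) <= c * jb (-2) n) ->
  normc (Tm m g x) <= c * jb_mass * nrm1 g.
Proof.
move=> sm sg mc.
have c0 : 0 <= c.
  by rewrite -(pmulr_lge0 _ (jb_gt0 (-2) 0)) (le_trans (normc_ge0 _) (mc 0)).
have ig := schwartz_cintegrable sg.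
have g1 : 0 <= nrm1 g by apply: Rintegral_ge0 => y _; exact: normc_ge0.
have bG n : normc (inv_fourier g n) <= nrm1 g.
  rewrite inv_fourierE fourierE normcM normcR ger0_norm; last first.
    by rewrite invr_ge0 mulr_ge0// pi_ge0.
  apply: le_trans (_ : 1 * nrm1 g <= _); last by rewrite mul1r.
  have p1 : (2 * pi)^-1 <= 1 :> R.
    rewrite invf_le1 ?mulr_gt0 ?pi_gt0//; have := @pi_ge2 R; lra.
  apply: ler_pM; rewrite ?invr_ge0 ?mulr_ge0 ?pi_ge0 ?normc_ge0//.
  have := normc_cintegral measurableT (schwartz_cintegrable (schwartz_expi (- - n) sg)).
  by move=> /le_trans; apply; apply: le_Rintegral => //;
    [exact: integrable_normc (schwartz_cintegrable (schwartz_expi (- - n) sg))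
    |exact: integrable_normc
    |move=> y _; rewrite normcM normc_expi mul1r].
have sG := schwartz_inv_fourier sg; have smG := schwartz_slow sm sG.
rewrite mulrAC; apply: fourier_bound; first exact: schwartz_continuous.
move=> n; rewrite normcM mulrAC; apply: ler_pM; rewrite ?normc_ge0//.
Qed.

(** A smooth function equal to [1 / z] for [1 <= |z|]. *)
Definition smoothinv (z : R) : R := z / (z ^+ 2 + cutoff (2 * z)).

Lemma smoothinv_den (z : R) : z ^+ 2 + cutoff (2 * z) != 0.
Proof.
have [->|z0] := eqVneq z 0; first by rewrite mulr0 cutoff1 ?normr0// expr0n add0r oner_neq0.
by rewrite gt_eqF// ltr_pwDl ?cutoff_ge0// exprn_even_gt0.
Qed.

Lemma smoothinvE (z : R) : 1 <= `|z| -> smoothinv z = z^-1.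
Proof.
move=> z1; have z0 : z != 0 by rewrite -normr_gt0 (lt_le_trans ltr01).
rewrite /smoothinv cutoff0 ?addr0; last by rewrite normrM ger0_norm//; lra.
by rewrite expr2 invfM mulrA mulfV// mul1r.
Qed.

Lemma csmooth_real_id : csmooth (fun x : R => x%:C).
Proof.
have r01 : (0 : R) <= 0 <= (1 : R) by rewrite lexx ler01.
exact: symbol_smooth (symbol_id set0 r01).
Qed.

Lemma csmooth_smoothinv : csmooth (fun x => (smoothinv x)%:C).
Proof.
have s1 : csmooth (fun z : R => (z ^+ 2 + cutoff (2 * z))%:C).
  have := csmoothD (csmoothM csmooth_real_id csmooth_real_id)
    (csmooth_affine 2 0 (@csmooth_cutoff R)).
  congr csmooth; apply/funext => z.
  by rewrite realCD expr2 realCM addr0.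
have := csmoothM csmooth_real_id (csmooth_inv smoothinv_den s1).
by congr csmooth; apply/funext => z; rewrite -realCM.
Qed.

Lemma csmooth_exp f M : csmooth f -> csmooth (fun x => f x ^+ M).
Proof.
move=> sf; elim: M => [|M IH].
  by under [X in csmooth X]funext do rewrite expr0; exact: csmooth_cst.
have := csmoothM sf IH; congr csmooth; apply/funext => x.
by rewrite exprS.
Qed.

(** Off the support of [g], writing [g = (x - y)^M (x - y)^-M g] trades the
    distance to the support for [M] derivatives of the symbol. *)
Lemma Tm_off_support a m (M : nat) (c r : R) g x : symbol setT 1 a m -> csmooth g ->
  (forall y, r <= `|y| -> g y = 0) -> r + 1 <= `|x| ->
  (forall n, normc (cderiven M m n) <= c * jb (-2) n) -> 0 <= c ->
  normc (Tm m g x) <= c * jb_mass * ((`|x| - r)^-1 ^+ M * nrm1 g).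
Proof.
move=> sm sg g0 xr mc c0.
have gz y : r < `|y| -> g y = 0 by move=> ry; apply: g0; exact: ltW.
pose w y := (smoothinv ((-1) * y + x))%:C ^+ M.
have sw : csmooth w by apply: csmooth_exp; exact: csmooth_affine csmooth_smoothinv.
pose gx y := w y * g y.
have sgx : schwartz gx.
  apply: (schwartz_compact (r := r)); first exact: csmoothM.
  by move=> y ry; rewrite /gx gz// mulr0.
have sgS : schwartz g by exact: schwartz_compact gz.
have xy y : `|y| < r -> `|x| - r <= `|x - y|.
  move=> yr; apply: le_trans (lerB_dist _ _); rewrite lerD2l lerN2; exact: ltW.
have Eg : g = fun y => (x - y)%:C ^+ M * gx y.
  apply/funext => y; have [ry|yr] := leP r `|y|.
    by rewrite /gx g0// !mulr0.
  have h := xy y yr.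
  have h1 : 1 <= `|x - y| by apply: le_trans h; rewrite lerBrDl.
  have h0 : x - y != 0 by rewrite -normr_gt0 (lt_le_trans ltr01).
  rewrite /gx /w mulN1r (addrC (- y)) smoothinvE// mulrA -exprMn -realCM mulfV//.
  by rewrite expr1n mul1r.
have -> : Tm m g x = Tm m (fun y => (x - y)%:C ^+ M * gx y) x by rewrite -Eg.
rewrite (Tm_commutator_iter x M sm sgx) normcM.
have -> : normc ((- 'i) ^+ M : R[i]) = 1.
  elim: (M) => [|j IHj]; first by rewrite expr0 normc1.
  by rewrite exprS normcM IHj normcN normc_i mul1r.
rewrite mul1r; have sM := slow_symbol ler01 (symbol_cderiven M sm).
apply: le_trans (Tm_sup_bound x sM sgx mc) _.
rewrite ler_wpM2l ?mulr_ge0 ?jb_mass_ge0//.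
have in1 := integrable_normc measurableT (schwartz_cintegrable sgS).
rewrite /nrm1 -RintegralZl//.
apply: le_Rintegral => //.
- exact: integrable_normc (schwartz_cintegrable sgx).
- exact: (integrableZl measurableT _ in1).
move=> y _; have [ry|yr] := leP r `|y|.
  by rewrite /gx g0// mulr0 normc0 mulr0.
have h := xy y yr; have h1 : 1 <= `|x - y| by apply: le_trans h; rewrite lerBrDl.
rewrite /gx normcM ler_wpM2r ?normc_ge0//.
have -> : normc (w y) = `|x - y|^-1 ^+ M.
  rewrite /w mulN1r (addrC (- y)) smoothinvE//.
  elim: (M) => [|j IHj]; first by rewrite !expr0 normc1.
  by rewrite !exprS normcM IHj normcR normfV.
have p1 : 0 < `|x| - r by lra.
have p2 : 0 < `|x - y| by lra.
by rewrite lerXn2r ?nnegrE ?invr_ge0 ?(ltW p1) ?(ltW p2)// lef_pV2 ?posrE.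
Qed.

End pseudo_locality.

Section pseudo_local_operators.
Context {R : realType}.
Let mu := @lebesgue_measure R.
Implicit Types (f g m : R -> R[i]).

Lemma Tm_translate m g (t x : R) :
  Tm (fun n => expi (- t * n) * m n) g x = Tm m g (x + t).
Proof.
apply: eq_cintegral => n _.
have -> : expi (- ((x + t) * n)) = expi (- (x * n)) * expi (- t * n) :> R[i].
  by rewrite -expiD; congr expi; ring.
by ring.
Qed.

Lemma slow_expi (t : R) : slow (fun n => expi (t * n)).
Proof. by exists 0; exact: symbol_expi. Qed.

Lemma is_cder_Tm m g : slow m -> schwartz g ->
  is_cder (Tm m g) (Tm (fun n => (- 'i * n%:C) * m n) g).
Proof.
move=> sm sg; have smG := schwartz_slow sm (schwartz_inv_fourier sg).
apply: is_cder_eq (schwartz_is_cder_fourier smG) => x //.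
by apply: eq_cintegral => n _; rewrite !mulrA.
Qed.

Lemma jb1_le_dist (r x : R) : 0 <= r -> r + 1 <= `|x| ->
  jb 1 x <= 2 * (r + 1) * (`|x| - r).
Proof.
move=> r0 rx; have x1 : 1 <= `|x| by lra.
have h1 : jb 1 x <= 2 * `|x|.
  rewrite jb1 -[leRHS]ger0_norm ?mulr_ge0// -sqrtr_sqr ler_wsqrtr//.
  have : 1 <= `|x| ^+ 2 by rewrite exprn_ege1.
  by rewrite exprMn real_normK ?num_real//; lra.
apply: le_trans h1 _; rewrite -mulrA ler_wpM2l// -subr_ge0.
rewrite (_ : _ - _ = r * (`|x| - r - 1)); last by ring.
by rewrite mulr_ge0//; lra.
Qed.

Lemma Tm_off_sym (t r : R) : 0 <= r -> forall k a m b, symbol setT 1 a m ->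
  exists2 C, 0 <= C & forall g, csmooth g -> (forall y, r <= `|y| -> g y = 0) ->
    sym [set x | r + `|t| + 1 <= `|x|] 0 k b (C * nrm1 g)
      (Tm (fun n => expi (- t * n) * m n) g).
Proof.
move=> r0; set r' := r + `|t|; have r'0 : 0 <= r' by rewrite addr_ge0.
have B a m b : symbol setT 1 a m -> exists2 C, 0 <= C & forall g, csmooth g ->
    (forall y, r <= `|y| -> g y = 0) -> forall x, r' + 1 <= `|x| ->
    normc (Tm (fun n => expi (- t * n) * m n) g x) <= C * nrm1 g * jb b x.
  move=> sm; have [M hM] := exists_natN_le (Num.min b (- 2 - a)).
  have /andP[Mb Ma'] : (- M%:R <= b) && (- M%:R <= - 2 - a) by rewrite -le_min.
  have Ma : a - M%:R <= -2 by lra.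
  have [c c0 sc] := symbol_cderiven M sm 0.
  have mc n : normc (cderiven M m n) <= c * jb (-2) n.
    by rewrite (le_trans (sym_bound sc I))// ler_wpM2l// jb_le.
  pose K := 2 * (r' + 1).
  have K0 : 0 <= K by rewrite mulr_ge0// addr_ge0.
  exists (c * jb_mass * K ^+ M).
    by rewrite !mulr_ge0 ?jb_mass_ge0// exprn_ge0.
  move=> g sg g0 x xr; rewrite Tm_translate.
  have xt : `|x| - `|t| <= `|x + t| by rewrite -(normrN t) -{2}(opprK t) lerB_dist.
  have xtr : r + 1 <= `|x + t| by move: xr xt; rewrite /r'; lra.
  apply: le_trans (Tm_off_support sm sg g0 xtr mc c0) _.
  rewrite [leRHS](_ : _ = c * jb_mass * ((K ^+ M * jb b x) * nrm1 g)); last by ring.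
  apply: ler_wpM2l; first by rewrite mulr_ge0// jb_mass_ge0.
  apply: ler_wpM2r; first by apply: Rintegral_ge0 => y _; exact: normc_ge0.
  have p1 : 0 < `|x| - r' by lra.
  have p2 : 0 < `|x + t| - r by lra.
  apply: le_trans (_ : (K * jb (-1) x) ^+ M <= _).
    apply: lerXn2r; rewrite ?nnegrE ?invr_ge0 ?(ltW p2) ?(mulr_ge0 K0 (jb_ge0 _ _))//.
    apply: (@le_trans _ _ (`|x| - r')^-1).
      by rewrite lef_pV2 ?posrE//; move: xt; rewrite /r'; lra.
    rewrite jbN ler_pdivlMr ?jb_gt0// mulrC ler_pdivrMr//.
    exact: jb1_le_dist.
  rewrite exprMn; apply: ler_wpM2l; first exact: exprn_ge0.
  have -> : jb (-1) x ^+ M = jb (- M%:R) x.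
    by rewrite !jbN jb_nat exprVn.
  exact: jb_le.
elim=> [|k IH] a m b sm; have [C C0 h] := B a m b sm.
  by exists C => // g sg g0; split=> // x Ax; exact: h.
have r01 : (0 : R) <= 1 <= (1 : R) by rewrite ler01 lexx.
have sm' : symbol setT 1 (1 + a) (fun n => (- 'i * n%:C) * m n).
  by apply: symbolM => //; apply: symbolZ; exact: symbol_id.
have [C' C'0 h'] := IH _ _ (b - 0) sm'.
exists (C + C'); first exact: addr_ge0.
move=> g sg g0.
have n10 : 0 <= nrm1 g by apply: Rintegral_ge0 => y _; exact: normc_ge0.
have sgS : schwartz g.
  by apply: (schwartz_compact (r := r)) => // y ry; apply: g0; exact: ltW.
have sme := slowM (slow_expi (- t)) (slow_symbol ler01 sm).
have hd := is_cder_Tm sme sgS.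
apply: (symS _ hd).
  move=> x Ax; apply: le_trans (h g sg g0 x Ax) _.
  by rewrite ler_wpM2r ?jb_ge0// ler_wpM2r// lerDl.
have := h' g sg g0.
rewrite (eq_Tm (m' := fun n => (- 'i * n%:C) * (expi (- t * n) * m n))); last first.
  by move=> n; ring.
apply: sym_weaken => //; first by rewrite ler_wpM2r// lerDr.
by rewrite mulr_ge0// addr_ge0.
Qed.

(** Functions supported in a ball are mapped to functions that are rapidly
    decreasing, with all their derivatives, outside a larger ball. *)
Definition pseudolocal m := forall r, 0 <= r -> exists r', forall k b,
  exists2 C, 0 <= C & forall g, csmooth g -> (forall y, r <= `|y| -> g y = 0) ->
    sym [set x | r' <= `|x|] 0 k b (C * nrm1 g) (Tm m g).

Lemma slow_wave (t : R) : slow (wave t).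
Proof. by exists 0; exact: symbol_wave. Qed.

Lemma slow_jb (a : R) : slow (fun n => (jb a n)%:C).
Proof.
have r01 : (0 : R) <= 0 <= (1 : R) by rewrite lexx ler01.
by exists a; exact: symbol_jb.
Qed.

Lemma pseudolocal_wave (t : R) : pseudolocal (wave t).
Proof.
move=> r r0; exists (r + `|t| + 1) => k b.
have [C1 C10 h1] := Tm_off_sym t r0 k b (symbol_wave_plus t).
have [C2 C20 h2] := Tm_off_sym (- t) r0 k b (symbol_wave_minus t).
exists (C1 + C2); first exact: addr_ge0.
move=> g sg g0.
have sgS : schwartz g.
  by apply: (schwartz_compact (r := r)) => // y ry; apply: g0; exact: ltW.
have sl1 := slowM (slow_expi (- t)) (slow_symbol ler01 (symbol_wave_plus t)).
have sl2 := slowM (slow_expi (- - t)) (slow_symbol ler01 (symbol_wave_minus t)).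
have s1 := h1 g sg g0; have := h2 g sg g0; rewrite normrN => s2.
have := symD s1 s2; rewrite -mulrDl; apply: sym_eq => x.
rewrite -(Tm_addsym x sl1 sl2 sgS); congr (Tm _ g x); apply/funext => n.
by rewrite wave_decomp opprK.
Qed.

Lemma test_schwartz r g : test_function r g -> schwartz g. Proof. by case. Qed.

Lemma test_vanish r g : test_function r g -> forall y, r <= `|y| -> g y = 0.
Proof. by move=> [_ [r' rr h]] y ry; apply: h; rewrite (le_trans (ltW rr)). Qed.

Lemma nrm2_ge0 f : 0 <= nrm2 f.
Proof. by apply: Rintegral_ge0 => x _; exact: sqr_ge0. Qed.

Lemma nrm1_ge0 f : 0 <= nrm1 f.
Proof. by apply: Rintegral_ge0 => x _; exact: normc_ge0. Qed.

Lemma schwartz_sq_integrable g : schwartz g ->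
  mu.-integrable setT (EFin \o (fun x => normc (g x) ^+ 2)).
Proof.
move=> sg; have sgc := schwartz_slow
  (ex_intro _ 0 ((schwartzP _).1 sg 0)) (schwartz_conj sg).
have [i1 _] := schwartz_cintegrable sgc.
by apply: eq_integrable i1 => // x _; rewrite /= mul_conj.
Qed.

Lemma nrm1_le r g : 0 < r -> test_function r g ->
  nrm1 g <= Num.sqrt (2 * r) * Num.sqrt (nrm2 g).
Proof.
move=> r0 tg; have sg := test_schwartz tg; have gv := test_vanish tg.
have i1 := integrable_normc measurableT (schwartz_cintegrable sg).
have i2 := schwartz_sq_integrable sg.
have rr : - r < r by lra.
have iI : mu.-integrable setT (EFin \o (\1_(sym_itv r) : R -> R)).
  exact: (integrable_indic_itv (- r) r false true).
pose a := nrm1 g / (2 * r).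
have r2 : 0 < 2 * r by rewrite mulr_gt0.
have a0 : 0 <= a by rewrite divr_ge0 ?nrm1_ge0// ltW.
have mI : \int[mu]_x (\1_(sym_itv r) x : R) = 2 * r.
  rewrite /Rintegral integral_indic//; last exact: measurable_itv.
  rewrite setIT [X in fine X](_ : _ = (2 * r)%:E)//.
  have := @lebesgue_measure_itv R `]- r, r[; rewrite /= lte_fin rr -EFinB opprK.
  by move=> h; apply: etrans h _; congr EFin; ring.
have H : 0 <= nrm2 g - (2 * a) * nrm1 g + a ^+ 2 * (2 * r).
  rewrite -mI /nrm2 /nrm1 -!RintegralZl//.
  have j1 := integrableZl measurableT (2 * a) i1.
  have j2 := integrableZl measurableT (a ^+ 2) iI.
  rewrite -RintegralB// -RintegralD//; last exact: (integrableB measurableT i2 j1).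
  apply: Rintegral_ge0 => x _.
  have [xr|rx] := leP r `|x|.
    by rewrite gv// normc0 expr0n mulr0 subr0 add0r mulr_ge0 ?sqr_ge0// indicE.
  rewrite indicE mem_set /=; last by rewrite /sym_itv /= in_itv /= -ltr_norml.
  rewrite mulr1 (_ : _ + _ = (normc (g x) - a) ^+ 2) ?sqr_ge0//; ring.
have E : a * (2 * r) = nrm1 g by rewrite /a divfK// gt_eqF.
have : nrm1 g ^+ 2 <= 2 * r * nrm2 g.
  have : (2 * r) * (a * nrm1 g) = nrm1 g ^+ 2 by rewrite mulrA (mulrC _ a) E expr2.
  have h3 : a ^+ 2 * (2 * r) = a * nrm1 g by rewrite expr2 -mulrA E.
  move=> <-; rewrite ler_wpM2l ?(ltW r2)//; move: H; rewrite h3; lra.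
move=> h; rewrite -(@ler_pXn2r _ 2%N)// ?nnegrE ?nrm1_ge0 ?mulr_ge0 ?sqrtr_ge0//.
by rewrite exprMn !sqr_sqrtr ?nrm2_ge0// ltW.
Qed.

Definition opb (r : R) (v : functional R) (C : R) : Prop :=
  forall g, test_function r g -> normc (v g) <= C * Num.sqrt (nrm2 g).

End pseudo_local_operators.

(** * Locally bounded functionals *)

Section local_bounds.
Context {R : realType}.
Let mu := @lebesgue_measure R.
Implicit Types (f g m : R -> R[i]) (v : functional R).

Definition slinear v := forall (z : R[i]) f g, schwartz f -> schwartz g ->
  v (fun x => z * f x + g x) = z * v f + v g.

Lemma tempered_slinear v : tempered v -> slinear v. Proof. by case. Qed.

Lemma slinear0 v : slinear v -> v (fun=> 0) = 0.
Proof.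
move=> lv; have := lv (-1) _ _ (@schwartz0 R) (@schwartz0 R).
under [X in v X]funext do rewrite mulr0 addr0.
by rewrite mulN1r addNr.
Qed.

Lemma slinearZ v (z : R[i]) f : slinear v -> schwartz f ->
  v (fun x => z * f x) = z * v f.
Proof.
move=> lv sf; have := lv z _ _ sf (@schwartz0 R).
by under [X in v X]funext do rewrite addr0; rewrite slinear0// addr0.
Qed.

Lemma slinearD v f g : slinear v -> schwartz f -> schwartz g ->
  v (fun x => f x + g x) = v f + v g.
Proof.
move=> lv sf sg; have := lv 1 _ _ sf sg; rewrite mul1r => <-.
by congr v; apply/funext => x; rewrite mul1r.
Qed.

Lemma testZ r (z : R[i]) g : test_function r g ->
  test_function r (fun x => z * g x).
Proof.
move=> [sg [r' rr h]]; split; first exact: schwartzZ.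
by exists r' => // x xr; rewrite h// mulr0.
Qed.

Lemma testD r f g : test_function r f -> test_function r g ->
  test_function r (fun x => f x + g x).
Proof.
move=> [sf [r1 rr1 h1]] [sg [r2 rr2 h2]]; split; first exact: schwartzD.
exists (Num.max r1 r2); first by rewrite gt_max rr1.
by move=> x; rewrite ge_max => /andP[x1 x2]; rewrite h1// h2// addr0.
Qed.

Lemma test_conj r g : test_function r g -> test_function r (fun x => conjc (g x)).
Proof.
move=> [sg [r' rr h]]; split; first exact: schwartz_conj.
by exists r' => // x xr; rewrite h// /conjc/= oppr0.
Qed.

Lemma nrm2Z (z : R[i]) g : schwartz g ->
  nrm2 (fun x => z * g x) = normc z ^+ 2 * nrm2 g.
Proof.
move=> sg; rewrite /nrm2 -RintegralZl//; last exact: schwartz_sq_integrable.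
by apply: eq_Rintegral => x _; rewrite normcM exprMn.
Qed.

Lemma nrm1Z (z : R[i]) g : schwartz g ->
  nrm1 (fun x => z * g x) = normc z * nrm1 g.
Proof.
move=> sg; rewrite /nrm1 -RintegralZl//.
  by apply: eq_Rintegral => x _; rewrite normcM.
exact: integrable_normc (schwartz_cintegrable sg).
Qed.

Lemma TmZ m (z : R[i]) f : slow m -> schwartz f ->
  Tm m (fun x => z * f x) = fun x => z * Tm m f x.
Proof.
move=> sm sf; have := TmD z sm sf (@schwartz0 R).
under [X in Tm m X]funext do rewrite addr0.
move=> ->; apply/funext => x.
have -> : Tm m (fun=> 0) x = 0; last by rewrite addr0.
have := TmD (-1) sm (@schwartz0 R) (@schwartz0 R).
under [X in Tm m X]funext do rewrite mulr0 addr0.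
by move=> /(congr1 (fun f => f x)) ->; rewrite mulN1r addNr.
Qed.

Definition cut (rho : R) : R -> R[i] := fun x => (cutoff (rho^-1 * x))%:C.

Lemma csmooth_cut rho : csmooth (cut rho).
Proof.
have := csmooth_affine rho^-1 0 (@csmooth_cutoff R).
by congr csmooth; apply/funext => x; rewrite addr0.
Qed.

Lemma cut1 rho x : 0 < rho -> `|x| <= rho -> cut rho x = 1.
Proof.
move=> r0 xr; rewrite /cut cutoff1// normrM gtr0_norm ?invr_gt0//.
by rewrite mulrC ler_pdivrMr// mul1r.
Qed.

Lemma cut0 rho x : 0 < rho -> 2 * rho <= `|x| -> cut rho x = 0.
Proof.
move=> r0 xr; rewrite /cut cutoff0// normrM gtr0_norm ?invr_gt0//.
by rewrite mulrC ler_pdivlMr.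
Qed.

Lemma normc_cut rho x : normc (cut rho x) <= 1.
Proof. by rewrite normcR ger0_norm ?cutoff_ge0// cutoff_le1. Qed.

Lemma symbol_cut rho rh a : 0 < rho -> symbol setT rh a (cut rho).
Proof.
move=> r0; apply: (symbol_compact (r := 2 * rho)); first exact: csmooth_cut.
by move=> x xr; apply: cut0 => //; exact: ltW.
Qed.

Lemma symbol_cutC rho : 0 < rho -> symbol setT 0 0 (fun x => 1 - cut rho x).
Proof.
move=> r0; have := symbolD (symbol_cst setT 1 (lexx 0))
  (symbolZ (-1) (symbol_cut 0 0 r0)).
by apply: symbol_eq => x; rewrite mulN1r.
Qed.

Lemma test_cut rho g : 0 < rho -> schwartz g ->
  test_function (2 * rho + 1) (fun x => cut rho x * g x).
Proof.
move=> r0 sg; split.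
  by apply: schwartz_slow => //; exists 0; exact: symbol_cut.
exists (2 * rho); first by rewrite ltrDl.
by move=> x xr; rewrite cut0// mul0r.
Qed.

(** Cutting off far away splits the pairing into a local part, controlled by
    the local bound of [v], and a part where [Tm m g] is rapidly decreasing;
    the latter is handled by sequential continuity of [v]. *)
Lemma opb_multiplier m v : tempered v -> slow m -> pseudolocal m ->
  (forall n, normc (m n) <= 1) ->
  (forall r, 0 < r -> exists2 C, 0 <= C & opb r v C) ->
  forall r, 0 < r -> exists2 C, 0 <= C & opb r (fun g => v (Tm m g)) C.
Proof.
move=> tv sm pm m1 bv r r0; have lv := tempered_slinear tv.
have [r' hr'] := pm r (ltW r0).
pose rho := Num.max r' 0 + 1.
have rho0 : 0 < rho by rewrite ltr_wpDl// le_max lexx orbT.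
have rr : r' < rho by rewrite (@le_lt_trans _ _ (Num.max r' 0)) ?le_max ?lexx// ltrDl.
pose S g := fun x => (1 - cut rho x) * Tm m g x.
have sS g : schwartz g -> schwartz (S g).
  move=> sg; apply: schwartz_slow; last exact: schwartz_Tm.
  by exists 0; exact: symbol_cutC.
have p : 0 < 2 * rho + 1 by rewrite addr_gt0// mulr_gt0.
have [C1 C10 h1] := bv _ p.
have [C2 C20 h2] : exists2 C, 0 <= C & forall g, test_function r g ->
    normc (v (S g)) <= C * nrm1 g.
  apply: contrapT => nC.
  have H (n : nat) : exists g, test_function r g /\ n%:R * nrm1 g < normc (v (S g)).
    apply: contrapT => nH; apply: nC; exists n%:R => // g tg.
    by rewrite leNgt; apply/negP => lt; apply: nH; exists g.
  have [g_ hg] := choice H.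
  have sg n : schwartz (g_ n) := test_schwartz (hg n).1.
  have N0 n : 0 < normc (v (S (g_ n))).
    by rewrite (le_lt_trans _ (hg n).2)// mulr_ge0 ?nrm1_ge0.
  pose h_ n := fun x => ((normc (v (S (g_ n))))^-1)%:C * g_ n x.
  have th n : test_function r (h_ n) by apply: testZ; exact: (hg n).1.
  have Sh n : S (h_ n) = fun x => ((normc (v (S (g_ n))))^-1)%:C * S (g_ n) x.
    by apply/funext => x; rewrite /S /h_ TmZ// mulrCA.
  have v1 n : normc (v (S (h_ n))) = 1.
    rewrite Sh slinearZ//; last exact: sS.
    by rewrite normcM normcR ger0_norm ?invr_ge0 ?normc_ge0// mulVf// gt_eqF.
  have n1 n : n%:R * nrm1 (h_ n) <= 1.
    rewrite nrm1Z// normcR ger0_norm ?invr_ge0 ?normc_ge0// mulrCA.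
    by rewrite mulrC ler_pdivrMr// mul1r ltW// (hg n).2.
  have zS : szero (fun n => S (h_ n)).
    move=> k a e e0; have [C C0 hC] := hr' k a.
    have [d d0 sd] := symbol_cutC rho0 k.
    have K0 : 0 <= 2 ^+ k * (d * C) by rewrite !mulr_ge0// exprn_ge0.
    near=> n.
    have sh := hC _ (schwartz_smooth (test_schwartz (th n))) (test_vanish (th n)).
    have nn : 0 <= C * nrm1 (h_ n) by rewrite mulr_ge0// nrm1_ge0.
    have s1 : sym [set x | r' <= `|x|] 0 k 0 d (fun x => 1 - cut rho x).
      exact: sym_weaken sd.
    have := symM d0 nn s1 sh; rewrite add0r => s2.
    have e2 : 2 ^+ k * (d * (C * nrm1 (h_ n))) <= e.
      have n0 : 0 < n%:R :> R by rewrite ltr0n; near: n; exact: nbhs_infty_gt.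
      rewrite -(ler_pM2l n0).
      have -> : n%:R * (2 ^+ k * (d * (C * nrm1 (h_ n)))) =
        (2 ^+ k * (d * C)) * (n%:R * nrm1 (h_ n)) by ring.
      apply: le_trans (ler_wpM2l K0 (n1 n)) _.
      rewrite mulr1 -ler_pdivrMr//.
      by near: n; exact: nbhs_infty_ger.
    have : sym setT 0 k a (2 ^+ k * (d * (C * nrm1 (h_ n)))) (S (h_ n)).
      apply: (sym_extend (@open_abs_lt _ rho) _ _ _ s2).
      - by move=> x /= /negP; rewrite -ltNge => xr; rewrite (lt_trans xr).
      - by move=> x xr; rewrite /S cut1 ?subrr ?mul0r// ltW.
      - by rewrite !mulr_ge0// ?exprn_ge0// nrm1_ge0.
    by apply: sym_weaken => //; exact: ltW.
  have := tempered_cvg tv (fun n => sS _ (test_schwartz (th n))) zS.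
  under eq_fun do rewrite v1.
  by move=> /(cvg_lim (@Rhausdorff R)); rewrite lim_cst// => /eqP; rewrite oner_eq0.
exists (C1 + C2 * Num.sqrt (2 * r)).
  by rewrite addr_ge0// mulr_ge0// sqrtr_ge0.
move=> g tg; have sg := test_schwartz tg; have sT := schwartz_Tm sm sg.
have tc := test_cut rho0 sT.
have -> : v (Tm m g) = v (fun x => cut rho x * Tm m g x) + v (S g).
  rewrite -slinearD//; last 2 first.
  - exact: test_schwartz tc.
  - exact: sS.
  by congr v; apply/funext => x; rewrite /S -mulrDl addrC subrK mul1r.
apply: le_trans (normcD _ _) _; rewrite mulrDl lerD//.
- apply: le_trans (h1 _ tc) _; rewrite ler_wpM2l// ler_wsqrtr//.
  apply: (@le_trans _ _ (nrm2 (Tm m g))).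
    apply: le_Rintegral => //; first exact: schwartz_sq_integrable (test_schwartz tc).
      exact: schwartz_sq_integrable.
    move=> x _; rewrite normcM exprMn ler_piMl ?sqr_ge0//.
    by rewrite exprn_ile1 ?normc_ge0// normc_cut.
  by have := Tm_L2 sm sg m1; rewrite expr1n mul1r.
- apply: le_trans (h2 _ tg) _; rewrite -mulrA ler_wpM2l//.
  exact: nrm1_le.
Unshelve. all: by end_near.
Qed.

(** The bilinear pairing of Schwartz functions. *)
Definition bil f g : R[i] := cintegral setT (fun x => f x * g x).

Lemma schwartzM f g : schwartz f -> schwartz g -> schwartz (fun x => f x * g x).
Proof.
move=> sf sg; apply: schwartz_slow sg.
by exists 0; exact: ((schwartzP f).1 sf 0).
Qed.

Lemma nrm2D p h : schwartz p -> schwartz h ->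
  nrm2 (fun x => p x + h x) =
  nrm2 p + nrm2 h + 2 * Re (bil (fun x => conjc (p x)) h).
Proof.
move=> sp sh; have sph := schwartzM (schwartz_conj sp) sh.
have [i1 _] := schwartz_cintegrable sph.
have i2 := schwartz_sq_integrable sp; have i3 := schwartz_sq_integrable sh.
rewrite /nrm2 /bil /cintegral /= -RintegralZl// -RintegralD//.
have i4 := integrableD measurableT i2 i3.
have i5 := integrableZl measurableT 2 i1.
rewrite -RintegralD//; apply: eq_Rintegral => x _.
rewrite !sqr_normc; case: (p x) => a b; case: (h x) => c d /=; ring.
Qed.

(** Almost minimizing [nrm2 p - 2 Re (v p)] over test functions: the standard
    proof of the Riesz theorem, stopped before passing to the limit. *)
Lemma riesz_approx v (r C e : R) : slinear v -> 0 <= C -> opb r v C -> 0 < e ->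
  exists2 f, test_function r f & opb r (fun g => v g - bil f g) e.
Proof.
move=> lv C0 bv e0.
pose J p : R := nrm2 p - 2 * Re (v p).
pose JS := [set J p | p in test_function r].
have t0 : test_function r (fun=> 0 : R[i]).
  split; first exact: schwartz0.
  by exists (r - 1) => //; rewrite ltrBlDr ltrDl.
have J0 : has_inf JS.
  split; first by exists (J (fun=> 0)); exists (fun=> 0).
  exists (- C ^+ 2) => _ [p tp <-].
  have h1 : Re (v p) <= C * Num.sqrt (nrm2 p).
    exact: le_trans (ler_norm _) (le_trans (le_Re_normc _) (bv p tp)).
  have h2 := sqr_sqrtr (nrm2_ge0 p).
  rewrite /J -h2; set s := Num.sqrt _ in h1 *.
  by have := sqr_ge0 (s - C); rewrite sqrrB; move: h1; lra.
have [_ [p tp <-] hp] : exists2 y, JS y & y < inf JS + e ^+ 2.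
  by apply: inf_adherent => //; rewrite exprn_gt0.
have sp := test_schwartz tp.
exists (fun x => conjc (p x)); first exact: test_conj.
move=> h th; have sh := test_schwartz th; set w := v h - bil _ h.
have spc := schwartz_conj sp.
have bilZ z : bil (fun x => conjc (p x)) (fun x => z * h x) =
    z * bil (fun x => conjc (p x)) h.
  rewrite /bil -(cintegralZ z measurableT (schwartz_cintegrable (schwartzM spc sh))).
  by apply: eq_cintegral => x _; ring.
have key t : normc w ^+ 2 * (2 * t - t ^+ 2 * nrm2 h) <= e ^+ 2.
  pose z := t%:C * conjc w.
  have tz := testZ z th.
  have : inf JS <= J (fun x => p x + z * h x).
    by apply: ge_inf; [exact: J0.2|exists (fun x => p x + z * h x) => //; exact: testD].
  have E : J (fun x => p x + z * h x) = J p + normc z ^+ 2 * nrm2 h - 2 * Re (z * w).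
    rewrite /J nrm2D//; last exact: schwartzZ.
    rewrite (nrm2Z _ sh) bilZ (slinearD lv sp (schwartzZ z sh)) (slinearZ _ lv sh).
    rewrite ReD /w mulrBr ReB; ring.
  rewrite E => hJ.
  have zw : Re (z * w) = t * normc w ^+ 2.
    by rewrite /z -mulrA (mulrC _ w) mul_conj -realCM.
  have zz : normc z ^+ 2 = t ^+ 2 * normc w ^+ 2.
    by rewrite /z normcM normc_conj normcR exprMn real_normK ?num_real.
  by move: hJ; rewrite zw zz; move: hp; lra.
have : normc w ^+ 2 <= e ^+ 2 * nrm2 h.
  have [n0|n0] := eqVneq (nrm2 h) 0.
    rewrite n0 mulr0 leNgt; apply/negP => w0.
    have := key (e ^+ 2 / normc w ^+ 2); rewrite n0 mulr0 subr0.
    have wn : normc w ^+ 2 != 0 by rewrite gt_eqF.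
    have -> : normc w ^+ 2 * (2 * (e ^+ 2 / normc w ^+ 2)) = 2 * e ^+ 2.
      by rewrite mulrCA [_ / _]mulrC mulVKf.
    have : 0 < e ^+ 2 by rewrite exprn_gt0.
    by lra.
  have np : 0 < nrm2 h by rewrite lt_neqAle eq_sym n0 nrm2_ge0.
  have := key (nrm2 h)^-1.
  have -> : 2 / nrm2 h - (nrm2 h)^-1 ^+ 2 * nrm2 h = (nrm2 h)^-1.
    by field.
  by rewrite ler_pdivrMr.
move=> hw; rewrite -(@ler_pXn2r _ 2%N)// ?nnegrE ?normc_ge0 ?mulr_ge0 ?sqrtr_ge0 ?(ltW e0)//.
by rewrite exprMn sqr_sqrtr ?nrm2_ge0.
Qed.

End local_bounds.

(** * Completeness of L2 and the seminorms of Hloc *)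

Section riesz_fischer.
Context {R : realType} d (T : measurableType d) (m : {measure set T -> \bar R}).
Context (D : set T) (mD : measurable D).

Lemma fatou_bound (F_ : nat -> T -> R) (F : T -> R) (c_ : nat -> R) (c : R) :
  (forall n, measurable_fun D (F_ n)) -> measurable_fun D F ->
  (forall n x, D x -> 0 <= F_ n x) -> (forall x, D x -> 0 <= F x) ->
  {ae m, forall x, D x -> F_ n x @[n --> \oo] --> F x} ->
  (forall n, (\int[m]_(x in D) (F_ n x)%:E <= (c_ n)%:E)%E) ->
  c_ n @[n --> \oo] --> c ->
  (\int[m]_(x in D) (F x)%:E <= c%:E)%E.
Proof.
move=> mF_ mF F_0 F0 aeF Fc cc.
have mE n : measurable_fun D (fun x => (F_ n x)%:E) by exact/measurable_EFinP.
have E0 n x : D x -> (0 <= (F_ n x)%:E)%E by move=> Dx; rewrite lee_fin F_0.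
apply: (@le_trans _ _ (\int[m]_(x in D) limn_einf (fun n => (F_ n x)%:E))%E).
  apply: ae_ge0_le_integral => //.
  - exact/measurable_EFinP.
  - by move=> x Dx; rewrite limn_einf_lim; apply: lime_ge;
      [exact: is_cvg_einfs|near=> n; apply: le_ereal_inf_tmp => _ [k _ <-]; exact: E0].
  - apply: measurableT_comp => //; apply: measurable_fun_limn_esup => n.
    exact: measurableT_comp.
  - apply: filterS aeF => x Fx Dx.
    have cE : (F_ n x)%:E @[n --> \oo] --> (F x)%:E.
      by apply: cvg_EFin; [near=> n|exact: Fx].
    by have [-> _] := cvg_limn_einf_sup cE.
apply: le_trans (fatou _ mD mE E0) _.
have cE : (c_ n)%:E @[n --> \oo] --> c%:E by apply: cvg_EFin; [near=> n|].
have [<- _] := cvg_limn_einf_sup cE; rewrite !limn_einf_lim.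
apply: lee_lim; [exact: is_cvg_einfs|exact: is_cvg_einfs|].
near=> n; apply: le_ereal_inf_tmp => _ [k nk <-].
apply: le_trans (Fc k); apply: ereal_inf_lbound; by exists k.
Unshelve. all: by end_near. Qed.

(** The increments are summable in L1, hence pointwise summable outside a
    negligible set. *)
Lemma riesz_fischer (f_ : nat -> T -> R) (a_ : nat -> R) :
  (forall n, measurable_fun D (f_ n)) ->
  (forall n, (\int[m]_(x in D) `|f_ n.+1 x - f_ n x|%:E <= (a_ n)%:E)%E) ->
  (\sum_(n <oo) (a_ n)%:E < +oo)%E ->
  exists2 f : T -> R, measurable_fun D f &
    {ae m, forall x, D x -> f_ n x @[n --> \oo] --> f x}.
Proof.
move=> mf fa sa.
pose g n x := `|f_ n.+1 x - f_ n x|.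
have mg n : measurable_fun D (fun x => (g n x)%:E).
  by apply/measurable_EFinP; apply: measurableT_comp => //; exact: measurable_funB.
have g0 n x : D x -> (0 <= (g n x)%:E)%E by move=> _; rewrite lee_fin /g normr_ge0.
pose S x := (\sum_(n <oo) (g n x)%:E)%E.
have mS : measurable_fun D S by apply: ge0_emeasurable_sum => // k x Dx _; exact: g0.
have S0 x : D x -> (0 <= S x)%E by move=> Dx; apply: nneseries_ge0 => n _ _; exact: g0.
have iS : (m.-integrable D S).
  apply/integrableP; split=> //.
  under eq_integral => x /set_mem Dx do rewrite gee0_abs ?S0//.
  rewrite integral_nneseries//; apply: le_lt_trans sa.
  by apply: lee_nneseries => n *; [by apply: integral_ge0 => x Dx; exact: g0|exact: fa].
exists (fun x => fine (limn_esup (fun n => (f_ n x)%:E))).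
  apply: measurableT_comp => //.
  by apply: measurable_fun_limn_esup => n; exact/measurable_EFinP.
apply: filterS (integrable_ae mD iS) => x Sx Dx; have {}Sx := Sx Dx.
have cS : cvgn (series (fun n => g n x)).
  apply: nondecreasing_is_cvgn.
    by apply: nondecreasing_series => n _ _; exact: normr_ge0.
  exists (fine (S x)) => _ [n _ <-].
  rewrite -lee_fin fineK// /series/= -sumEFin.
  by apply: nneseries_lim_ge => k _ _; exact: g0.
have cf : cvgn (fun n => f_ n x).
  have /cvg_ex[l hl] : cvgn (series (telescope (fun n => f_ n x))) := normed_cvg cS.
  apply/cvg_ex; exists (f_ 0 x + l).
  under eq_fun do rewrite (eq_sum_telescope (fun n => f_ n x)).
  by apply: cvgD => //; exact: cvg_cst.
have cE : (f_ n x)%:E @[n --> \oo] --> (limn (fun n => f_ n x))%:E.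
  by apply: cvg_EFin; [near=> n|exact: cf].
have [_ ->] := cvg_limn_einf_sup cE; exact: cf.
Unshelve. all: by end_near. Qed.

End riesz_fischer.

Section representation.
Context {R : realType}.
Let mu := @lebesgue_measure R.
Implicit Types (f g : R -> R[i]) (v : functional R).
Local Notation mR D := (@measurable _ (measurableTypeR R) D).

Lemma measurable_sym_itv (r : R) : mR (sym_itv r).
Proof. exact: measurable_itv. Qed.

Lemma integral_restrict_le (D : set R) (h : R -> R) : mR D ->
  (forall x, 0 <= h x) -> mu.-integrable setT (EFin \o h) ->
  (\int[mu]_(x in D) (h x)%:E <= (\int[mu]_x h x)%:E)%E.
Proof.
move=> mD h0 ih; rewrite /Rintegral fineK; last exact: integrable_fin_num ih.
apply: ge0_subset_integral => //; first exact: (measurable_int mu ih).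
by move=> x _; rewrite lee_fin.
Qed.

Lemma cintegral_support (D : set R) f : (forall x, ~ D x -> f x = 0) ->
  cintegral setT f = cintegral D f.
Proof.
move=> f0; apply: complex_eqP; rewrite /cintegral /= [RHS]Rintegral_mkcond;
  by apply: eq_Rintegral => x _; rewrite patchE; case: ifPn => // /negP xD;
    rewrite f0// => Dx; apply: xD; rewrite inE.
Qed.

Lemma test_support r g : test_function r g -> forall x, ~ sym_itv r x -> g x = 0.
Proof.
move=> tg x xr; apply: (test_vanish tg); rewrite leNgt; apply/negP => h.
by apply: xr; rewrite /sym_itv /= in_itv /= -ltr_norml.
Qed.

Lemma bil_test r f g : test_function r g ->
  bil f g = cintegral (sym_itv r) (fun x => f x * g x).
Proof.
move=> tg; apply: cintegral_support => x xr.
by rewrite (test_support tg xr) mulr0.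
Qed.

Lemma bil_conj f : bil f (fun x => conjc (f x)) = (nrm2 f)%:C.
Proof. by rewrite nrm2E. Qed.

Lemma nrm2_conj f : nrm2 (fun x => conjc (f x)) = nrm2 f.
Proof. by apply: eq_Rintegral => x _; rewrite normc_conj. Qed.

Lemma opb_bil_norm r f K : test_function r f -> 0 <= K -> opb r (bil f) K ->
  Num.sqrt (nrm2 f) <= K.
Proof.
move=> tf K0 /(_ _ (test_conj tf)); rewrite bil_conj normcR ger0_norm ?nrm2_ge0//.
rewrite nrm2_conj -{1}(sqr_sqrtr (nrm2_ge0 f)) expr2 => h.
have [->//|n0] := eqVneq (Num.sqrt (nrm2 f)) 0.
by move: h; rewrite ler_pM2r// lt_neqAle eq_sym n0 sqrtr_ge0.
Qed.

Lemma bilB f f' g : schwartz f -> schwartz f' -> schwartz g ->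
  bil (fun x => f x - f' x) g = bil f g - bil f' g.
Proof.
move=> sf sf' sg.
rewrite /bil -(cintegralB measurableT (schwartz_cintegrable (schwartzM sf sg))
  (schwartz_cintegrable (schwartzM sf' sg))).
by apply: eq_cintegral => x _; rewrite mulrBl.
Qed.

Lemma testB r f g : test_function r f -> test_function r g ->
  test_function r (fun x => f x - g x).
Proof.
move=> tf tg; have := testD tf (testZ (-1) tg).
by under [X in test_function _ X]funext do rewrite mulN1r.
Qed.

Lemma L2norm_le (D : set R) f (c : R) : 0 <= c ->
  (\int[mu]_(x in D) (normc (f x) ^+ 2)%:E <= (c ^+ 2)%:E)%E ->
  (L2norm mu D f <= c%:E)%E.
Proof.
move=> c0 h; rewrite /L2norm.
have -> : c%:E = ((c ^+ 2)%:E `^ 2^-1)%E.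
  by rewrite poweR_EFin powR12_sqrt ?sqr_ge0// sqrtr_sqr ger0_norm.
apply: gt0_ler_poweR => //; rewrite ?in_itv/= ?lee_fin ?sqr_ge0 ?leey//.
by rewrite integral_ge0// => x _; rewrite lee_fin sqr_ge0.
Qed.

Lemma L2norm_ge (D : set R) f (c : R) : 0 <= c ->
  (L2norm mu D f <= c%:E)%E ->
  (\int[mu]_(x in D) (normc (f x) ^+ 2)%:E <= (c ^+ 2)%:E)%E.
Proof.
move=> c0; rewrite /L2norm; set X := (\int[mu]_(x in D) _)%E => h.
have X0 : (0 <= X)%E by apply: integral_ge0 => x _; rewrite lee_fin sqr_ge0.
case: X X0 h => [x|_|//]; last by rewrite poweRyr ?invr_neq0.
rewrite lee_fin => x0; rewrite poweR_EFin powR12_sqrt// !lee_fin => h.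
by rewrite -(sqr_sqrtr x0) ler_pXn2r// ?nnegrE ?sqrtr_ge0.
Qed.

(** Nonnegativity of a quadratic polynomial, as in the classical proof of the
    Cauchy-Schwarz inequality. *)
Lemma discriminant_le (A B X : R) : 0 <= A -> 0 <= B -> 0 <= X ->
  (forall t, 0 <= t ^+ 2 * A - 2 * t * X + B) -> X <= Num.sqrt A * Num.sqrt B.
Proof.
move=> A0 B0 X0 h.
suff : X ^+ 2 <= A * B.
  move=> h2; rewrite -(@ler_pXn2r _ 2%N)// ?nnegrE ?mulr_ge0 ?sqrtr_ge0//.
  by rewrite exprMn !sqr_sqrtr.
have [A1|A1] := eqVneq A 0.
  have [->|X1] := eqVneq X 0; first by rewrite expr0n mulr_ge0.
  have := h ((B + 1) / X); rewrite A1 mulr0 add0r -mulrA -mulrA mulVf// mulr1.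
  by move: B0; lra.
have := h (X / A); have Ap : 0 < A by rewrite lt_neqAle eq_sym A1.
have -> : (X / A) ^+ 2 * A - 2 * (X / A) * X + B = (A * B - X ^+ 2) / A by field.
by rewrite pmulr_lge0 ?invr_gt0// subr_ge0.
Qed.

Lemma opb_L2 r v f (c : R) : 0 <= c -> locally_L2 r v f ->
  (L2norm mu (sym_itv r) f <= c%:E)%E -> opb r v c.
Proof.
move=> c0 [mf _ vf] fc g tg; have sg := test_schwartz tg.
have mI := measurable_sym_itv r.
rewrite (vf _ tg).
have i2 : mu.-integrable (sym_itv r) (EFin \o (fun x => normc (f x) ^+ 2)).
  apply/integrableP; split.
    by apply/measurable_EFinP; apply: measurable_funX; exact: measurable_normc.
  under eq_integral do rewrite /= ger0_norm ?sqr_ge0//.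
  exact: le_lt_trans (L2norm_ge c0 fc) (ltry _).
have j2 : mu.-integrable (sym_itv r) (EFin \o (fun x => normc (g x) ^+ 2)).
  exact: integrableS (schwartz_sq_integrable sg).
have mfg : measurable_fun (sym_itv r) (fun x => normc (f x) * normc (g x)).
  apply: measurable_funM; apply: measurable_normc => //.
  exact: ccontinuous_measurable (schwartz_continuous sg).
have ij : mu.-integrable (sym_itv r) (EFin \o (fun x => normc (f x) * normc (g x))).
  have := integrableD mI i2 j2; apply: le_integrable => //.
    exact/measurable_EFinP.
  move=> x _ /=; rewrite lee_fin ger0_norm ?mulr_ge0 ?normc_ge0//.
  rewrite ger0_norm ?addr_ge0 ?sqr_ge0//.
  have := sqr_ge0 (normc (f x) - normc (g x)).
  have := mulr_ge0 (normc_ge0 (f x)) (normc_ge0 (g x)).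
  by rewrite sqrrB; lra.
apply: (@le_trans _ _ (\int[mu]_(x in sym_itv r) (normc (f x) * normc (g x)))).
  apply: normc_cintegral_le => //.
    apply: cmeasurableM mf _; exact: ccontinuous_measurable (schwartz_continuous sg).
  by move=> x _; rewrite normcM.
set A := \int[mu]_(x in sym_itv r) (normc (f x) ^+ 2).
set B := \int[mu]_(x in sym_itv r) (normc (g x) ^+ 2).
have A0 : 0 <= A by apply: Rintegral_ge0 => x _; exact: sqr_ge0.
have B0 : 0 <= B by apply: Rintegral_ge0 => x _; exact: sqr_ge0.
have Ac : A <= c ^+ 2.
  rewrite -lee_fin /A /Rintegral fineK; first exact: L2norm_ge.
  exact: integrable_fin_num i2.
have Bg : B <= nrm2 g.
  rewrite -lee_fin {1}/B {1}/Rintegral fineK; last exact: integrable_fin_num j2.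
  by apply: integral_restrict_le => //; [move=> x; exact: sqr_ge0|exact: schwartz_sq_integrable].
apply: (@le_trans _ _ (Num.sqrt A * Num.sqrt B)).
  apply: discriminant_le => //.
    by apply: Rintegral_ge0 => x _; rewrite mulr_ge0 ?normc_ge0.
  move=> t; rewrite /A /B -!RintegralZl//.
  have i3 := integrableZl mI (t ^+ 2) i2; have i4 := integrableZl mI (2 * t) ij.
  rewrite -RintegralB// -RintegralD//; last exact: (integrableB mI i3 i4).
  apply: Rintegral_ge0 => x _.
  rewrite (_ : _ + _ = (t * normc (f x) - normc (g x)) ^+ 2) ?sqr_ge0//; ring.
rewrite ler_pM ?sqrtr_ge0 ?ler_wsqrtr//.
by rewrite -[leRHS]ger0_norm// -sqrtr_sqr ler_wsqrtr.
Qed.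

End representation.

Section riesz_representation.
Context {R : realType}.
Let mu := @lebesgue_measure R.
Implicit Types (f g : R -> R[i]) (v : functional R).
Local Notation mR D := (@measurable _ (measurableTypeR R) D).

Let eps (n : nat) : R := 2^-1 ^+ n.

Let eps_gt0 n : 0 < eps n. Proof. by rewrite exprn_gt0// invr_gt0. Qed.

Let eps_le n : eps n.+1 <= eps n.
Proof. by rewrite /eps exprS ler_piMl ?exprn_ge0 ?invf_le1// ler1n. Qed.

Let eps0 : eps n @[n --> \oo] --> (0 : R).
Proof.
have := @cvg_geometric R 1 2^-1; rewrite /geometric /=.
under eq_fun do rewrite mul1r.
by apply; rewrite ger0_norm// invf_lt1// ltr1n.
Qed.

Let sum_eps (K : R) : 0 <= K -> (\sum_(n <oo) (K * eps n)%:E < +oo)%E.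
Proof.
move=> K0; have h : `|2^-1 : R| < 1 by rewrite ger0_norm// invf_lt1// ltr1n.
have c := @cvg_geometric_series R K _ h.
have -> : (\sum_(n <oo) (K * eps n)%:E)%E = (K * (1 - 2^-1)^-1)%:E.
  apply: cvg_lim => //.
  under eq_fun do rewrite sumEFin.
  apply: cvg_EFin; first by near=> n.
  exact: c.
exact: ltry.
Unshelve. all: by end_near. Qed.

Lemma cvg_normc (z_ : nat -> R[i]) z :
  Re (z_ n) @[n --> \oo] --> Re z -> Im (z_ n) @[n --> \oo] --> Im z ->
  normc (z_ n) @[n --> \oo] --> normc z.
Proof.
move=> hr hi.
have E w : normc w = Num.sqrt (Re w * Re w + Im w * Im w) by case: w => a b; rewrite -!expr2.
rewrite E; under eq_fun do rewrite E.
have h : Re (z_ n) * Re (z_ n) + Im (z_ n) * Im (z_ n) @[n --> \oo] -->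
    (Re z * Re z + Im z * Im z : R) by apply: cvgD; exact: cvgM.
exact: (cvg_comp _ _ h (@sqrt_continuous R _)).
Qed.

(** A functional bounded in L2 norm on test functions is an L2 function: the
    approximants [riesz_approx] form a Cauchy sequence in L1 and L2. *)
Lemma riesz_rep v (r C : R) : 0 < r -> slinear v -> 0 <= C -> opb r v C ->
  exists2 f, locally_L2 r v f & (L2norm mu (sym_itv r) f <= C%:E)%E.
Proof.
move=> r0 lv C0 bv; have mI := measurable_sym_itv r.
have H n : exists f, test_function r f /\ opb r (fun g => v g - bil f g) (eps n).
  by have [f ? ?] := riesz_approx lv C0 bv (eps_gt0 n); exists f.
have [f_ hf] := choice H.
have tf n := (hf n).1; have sf n := test_schwartz (tf n).
pose d n k := fun x => f_ n x - f_ k x.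
have td n k : test_function r (d n k) by exact: testB.
pose K := Num.sqrt (2 * r); have K0 : 0 <= K by exact: sqrtr_ge0.
have d2 n k : Num.sqrt (nrm2 (d n k)) <= eps n + eps k.
  apply: opb_bil_norm (td n k) _ _; first by rewrite addr_ge0// ltW.
  move=> g tg; rewrite (bilB (sf n) (sf k) (test_schwartz tg)).
  have -> : bil (f_ n) g - bil (f_ k) g =
      (v g - bil (f_ k) g) - (v g - bil (f_ n) g) by ring.
  apply: le_trans (normcB _ _) _; rewrite mulrDl addrC lerD//.
    exact: (hf n).2.
  exact: (hf k).2.
have d1 n k : nrm1 (d n k) <= K * (eps n + eps k).
  apply: le_trans (nrm1_le r0 (td n k)) _; exact: ler_wpM2l.
have i1 n k := integrable_normc measurableT (schwartz_cintegrable (test_schwartz (td n k))).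
have D1 n k : (\int[mu]_(x in sym_itv r) (normc (d n k x))%:E <=
    (K * (eps n + eps k))%:E)%E.
  apply: le_trans (integral_restrict_le mI _ (i1 n k)) _ => [x|]; first exact: normc_ge0.
  by rewrite lee_fin; exact: d1.
have mf n : cmeasurable_fun (sym_itv r) (f_ n).
  exact: ccontinuous_measurable (schwartz_continuous (sf n)).
have md n k : cmeasurable_fun (sym_itv r) (d n k).
  exact: ccontinuous_measurable (schwartz_continuous (test_schwartz (td n k))).
have part_bound (p : R[i] -> R) n : (forall z, `|p z| <= normc z) ->
    {morph p : x y / x - y} -> measurable_fun (sym_itv r) (p \o f_ n.+1) ->
    measurable_fun (sym_itv r) (p \o f_ n) ->
    (\int[mu]_(x in sym_itv r) `|p (f_ n.+1 x) - p (f_ n x)|%:E <=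
      (K * 2 * eps n)%:E)%E.
  move=> pn pB m1 m2; apply: (@le_trans _ _ (K * (eps n.+1 + eps n))%:E).
    apply: le_trans (D1 n.+1 n); apply: ge0_le_integral => //.
    - apply/measurable_EFinP; apply: measurableT_comp => //.
      exact: measurable_funB m1 m2.
    - by apply/measurable_EFinP; apply: measurable_normc; exact: md.
    - by move=> x Ix; rewrite lee_fin -pB; exact: pn.
  by rewrite lee_fin -mulrA ler_wpM2l// mulr_natl mulr2n lerD2r eps_le.
have [fr mfr hr] := riesz_fischer mI (fun n => (mf n).1)
  (fun n => part_bound Re n (@le_Re_normc R) (@ReB R) (mf n.+1).1 (mf n).1)
  (sum_eps (mulr_ge0 K0 (ler0n R 2))).
have [fi mfi hi] := riesz_fischer mI (fun n => (mf n).2)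
  (fun n => part_bound Im n (@le_Im_normc R) (@ImB R) (mf n.+1).2 (mf n).2)
  (sum_eps (mulr_ge0 K0 (ler0n R 2))).
pose f x := fr x +i* fi x.
have mcf : cmeasurable_fun (sym_itv r) f by split.
have FF := ae_filter_ringOfSetsType mu.
have ae_cvg : {ae mu, forall x, sym_itv r x -> forall (a : R[i]) (s : R),
    normc (a + s%:C * f_ n x) @[n --> \oo] --> normc (a + s%:C * f x)}.
  apply: filterS2 hr hi => x hrx hix Ix a s.
  apply: cvg_normc; [under eq_fun do rewrite ReD ReM/=|under eq_fun do rewrite ImD ImM/=];
    rewrite ?ReD ?ImD ?ReM ?ImM /=.
  - apply: cvgD; first exact: cvg_cst.
    by apply: cvgB; apply: cvgM; try exact: cvg_cst; [exact: hrx|exact: hix].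
  - apply: cvgD; first exact: cvg_cst.
    by apply: cvgD; apply: cvgM; try exact: cvg_cst; [exact: hix|exact: hrx].
have ae1 n : {ae mu, forall x, sym_itv r x ->
    normc (d n k x) @[k --> \oo] --> normc (f_ n x - f x)}.
  apply: filterS ae_cvg => x h Ix; have := h Ix (f_ n x) (-1).
  by rewrite realCN mulN1r; under eq_fun do rewrite mulN1r.
have ae2 : {ae mu, forall x, sym_itv r x ->
    normc (f_ k x) ^+ 2 @[k --> \oo] --> normc (f x) ^+ 2}.
  apply: filterS ae_cvg => x h Ix; have := h Ix 0 1.
  rewrite mul1r add0r; under eq_fun do rewrite mul1r add0r.
  by move=> {}h; apply: (cvgM h h).
have L1 n : (\int[mu]_(x in sym_itv r) (normc (f_ n x - f x))%:E <= (K * eps n)%:E)%E.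
  apply: (@fatou_bound _ _ _ mu _ mI (fun k x => normc (d n k x)) _
      (fun k => K * (eps n + eps k))) => //.
  - by move=> k; apply: measurable_normc; exact: md.
  - by apply: measurable_normc; exact: (cmeasurableB (mf n) mcf).
  - by move=> k x _; exact: normc_ge0.
  - by move=> x _; exact: normc_ge0.
  - by apply: cvgM; [exact: cvg_cst|rewrite -[X in _ --> X]addr0; apply: cvgD; [exact: cvg_cst|]].
have L2 : (\int[mu]_(x in sym_itv r) (normc (f x) ^+ 2)%:E <= (C ^+ 2)%:E)%E.
  apply: (@fatou_bound _ _ _ mu _ mI (fun k x => normc (f_ k x) ^+ 2) _
      (fun k => (C + eps k) ^+ 2)) => //.
  - by move=> k; apply: measurable_funX; exact: (measurable_normc (mf k)).
  - by apply: measurable_funX; exact: (measurable_normc mcf).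
  - by move=> k x _; exact: sqr_ge0.
  - by move=> x _; exact: sqr_ge0.
  - move=> k; apply: le_trans (integral_restrict_le mI _ (schwartz_sq_integrable (sf k))) _.
      by move=> x; exact: sqr_ge0.
    have Ce : 0 <= C + eps k by rewrite addr_ge0// ltW.
    rewrite lee_fin -[leLHS](sqr_sqrtr (nrm2_ge0 (f_ k))) ler_pXn2r// ?nnegrE ?sqrtr_ge0//.
    apply: opb_bil_norm (tf k) Ce _ => g tg; rewrite -[bil _ g](subKr (v g)).
    by apply: le_trans (normcB _ _) _; rewrite mulrDl lerD ?bv//; exact: (hf k).2.
  - have h : C + eps k @[k --> \oo] --> C.
      by rewrite -[X in _ --> X]addr0; apply: cvgD; [exact: cvg_cst|].
    exact: (cvgM h h).
exists f; last exact: L2norm_le.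
split=> //; first exact: le_lt_trans (L2norm_le C0 L2) (ltry _).
move=> g tg; have sg := test_schwartz tg; have cg := schwartz_continuous sg.
have mg := ccontinuous_measurable mI cg.
have [c c0 gc'] := schwartz_bound 0 sg.
have gc x : normc (g x) <= c by have := gc' x; rewrite jb0 mulr1.
have iN n : mu.-integrable (sym_itv r) (EFin \o (fun x => normc (f_ n x - f x))).
  apply/integrableP; split.
    by apply/measurable_EFinP; apply: measurable_normc; exact: (cmeasurableB (mf n) mcf).
  under eq_integral do rewrite /= ger0_norm ?normc_ge0//.
  exact: le_lt_trans (L1 n) (ltry _).
have iL n : mu.-integrable (sym_itv r) (EFin \o (fun x => c * normc (f_ n x - f x))).
  exact: (integrableZl mI c (iN n)).
have mdg n : cmeasurable_fun (sym_itv r) (fun x => (f_ n x - f x) * g x).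
  exact: cmeasurableM (cmeasurableB (mf n) mcf) mg.
have dgc n x : sym_itv r x -> normc ((f_ n x - f x) * g x) <= c * normc (f_ n x - f x).
  by rewrite normcM mulrC ler_wpM2r ?normc_ge0.
have idg n : cintegrable (sym_itv r) (fun x => (f_ n x - f x) * g x).
  exact: cintegrable_le (mdg n) (@dgc n) (iL n).
have ifg n : cintegrable (sym_itv r) (fun x => f_ n x * g x).
  by have [h1 h2] := schwartz_cintegrable (schwartzM (sf n) sg);
    split; apply: integrableS h1 || apply: integrableS h2.
have bound n : normc (v g - cintegral (sym_itv r) (fun x => f x * g x)) <=
    (Num.sqrt (nrm2 g) + c * K) * eps n.
  have E : cintegral (sym_itv r) (fun x => (f_ n x - f x) * g x) =
      bil (f_ n) g - cintegral (sym_itv r) (fun x => f x * g x).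
    rewrite (bil_test _ tg) -[in RHS](cintegralB mI (ifg n)).
      by apply: eq_cintegral => x _; rewrite mulrBl.
    have := cintegrableD mI (ifg n) (cintegrableZ (-1) mI (idg n)).
    by apply: eq_cintegrable => // x _; ring.
  have -> : v g - cintegral (sym_itv r) (fun x => f x * g x) = (v g - bil (f_ n) g) +
      cintegral (sym_itv r) (fun x => (f_ n x - f x) * g x) by rewrite E; ring.
  apply: le_trans (normcD _ _) _; rewrite mulrDl lerD//.
    by rewrite mulrC; exact: (hf n).2.
  apply: le_trans (normc_cintegral_le mI (mdg n) (@dgc n) (iL n)) _.
  rewrite (RintegralZl c mI (iN n)).
  rewrite -mulrA ler_wpM2l//.
  rewrite /Rintegral -lee_fin fineK; [exact: L1|exact: integrable_fin_num (iN n)].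
set w := v g - _ in bound.
have Ke0 : (Num.sqrt (nrm2 g) + c * K) * eps n @[n --> \oo] --> (0 : R).
  by rewrite -[X in _ --> X](mulr0 (Num.sqrt (nrm2 g) + c * K)); apply: cvgM => //; exact: cvg_cst.
have w0 : normc w <= 0.
  rewrite -(cvg_lim (@Rhausdorff R) Ke0); apply: limr_ge; first exact: cvgP Ke0.
  exact: nearW.
have /normc_eq0/eqP : normc w = 0 by apply/eqP; rewrite eq_le w0 normc_ge0.
by rewrite subr_eq0 => /eqP.
Qed.

Lemma seminorm_le (r s : R) u (C : R) : 0 < r -> slinear (D s u) -> 0 <= C ->
  opb r (D s u) C -> (seminorm r s u <= C%:E)%E.
Proof.
move=> r0 lu C0 bu; have [f Lf fC] := riesz_rep r0 lu C0 bu.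
by apply: ge_ereal_inf; exists (L2norm mu (sym_itv r) f) => //; exists f.
Qed.

Lemma L2_seminorm_ge0 (r s : R) u : (0 <= seminorm r s u)%E.
Proof. by apply: le_ereal_inf_tmp => _ [f _ <-]; exact: poweR_ge0. Qed.

(** The constant is attained since the bound is a closed condition in [C]. *)
Lemma seminorm_opb (r s : R) u : (seminorm r s u < +oo)%E ->
  opb r (D s u) (fine (seminorm r s u)).
Proof.
move=> fs; have s0 := L2_seminorm_ge0 r s u.
have fE : (fine (seminorm r s u))%:E = seminorm r s u by rewrite fineK// ge0_fin_numE.
move=> g tg; apply/ler_addgt0Pr => e e0.
pose q := Num.sqrt (nrm2 g); have q0 : 0 <= q by exact: sqrtr_ge0.
have qp : 0 < q + 1 by rewrite ltr_wpDl.
have : (seminorm r s u < (fine (seminorm r s u) + e / (q + 1))%:E)%E.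
  by rewrite EFinD fE lteDl ?lte_fin ?divr_gt0// ge0_fin_numE.
move=> /ereal_inf_lt[_ [f Lf <-] /ltW hf].
have c0 : 0 <= fine (seminorm r s u) + e / (q + 1).
  by rewrite addr_ge0 ?fine_ge0// ltW// divr_gt0.
apply: le_trans (opb_L2 c0 Lf hf tg) _; rewrite mulrDl lerD2l -/q.
rewrite -mulrA -[leRHS]mulr1 ler_wpM2l ?(ltW e0)//.
by rewrite mulrC ler_pdivrMr// mul1r lerDl.
Qed.

Lemma opb_le r v (C C' : R) : C <= C' -> opb r v C -> opb r v C'.
Proof.
move=> CC bv g tg; apply: le_trans (bv g tg) _.
by rewrite ler_wpM2r// sqrtr_ge0.
Qed.

End riesz_representation.

Section flow.
Context {R : realType}.
Implicit Types (f g : R -> R[i]) (u v : functional R).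

Lemma DE s u g : schwartz g -> D s u g = u (Tm (fun n => (jb s n)%:C) g).
Proof. by move=> sg; apply: fourier_multiplierE => //; exact: slow_jb. Qed.

Lemma LE t u g : schwartz g -> L t u g = u (Tm (wave t) g).
Proof. by move=> sg; apply: fourier_multiplierE => //; exact: slow_wave. Qed.

Lemma tempered_D s u : tempered u -> tempered (D s u).
Proof. exact: (tempered_multiplier (slow_jb s)). Qed.

Lemma tempered_L t u : tempered u -> tempered (L t u).
Proof. exact: (tempered_multiplier (slow_wave t)). Qed.

Lemma D_L s t u g : schwartz g -> D s (L t u) g = D s u (Tm (wave t) g).
Proof.
move=> sg; have sj := slow_jb s; have sw := slow_wave t.
rewrite (DE s (L t u) sg) (LE t u (schwartz_Tm sj sg)) (DE s u (schwartz_Tm sw sg)).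
rewrite (Tm_comp _ sj sg) (Tm_comp _ sw sg).
by congr u; apply: eq_Tm => n; rewrite mulrC.
Qed.

Lemma Hloc_opb u s : Hloc_set u -> s < 2^-1 -> forall r, 0 < r ->
  exists2 C, 0 <= C & opb r (D s u) C.
Proof.
move=> [_ fu] s2 r r0; exists (fine (seminorm r s u)).
  by rewrite fine_ge0// L2_seminorm_ge0.
by apply: seminorm_opb; exact: fu.
Qed.

Lemma Hloc_L t u : Hloc_set u -> Hloc_set (L t u).
Proof.
move=> hu; have [tu _] := hu; split; first exact: tempered_L.
move=> r s r0 s2.
have w1 n : normc (wave t n) <= 1 by rewrite normc_wave.
have [C C0 hC] := opb_multiplier (tempered_D s tu) (slow_wave t)
  (pseudolocal_wave t) w1 (Hloc_opb hu s2) r0.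
apply: le_lt_trans (ltry C); apply: seminorm_le => //.
  exact: tempered_slinear (tempered_D s (tempered_L t tu)).
by move=> g tg; rewrite D_L; [exact: hC|exact: test_schwartz tg].
Qed.

Definition Hflow (t : R) (u : borel_Hloc R) : borel_Hloc R :=
  exist _ (L t (val u)) (mem_set (Hloc_L t (set_mem (valP u)))).

Lemma L_preimageE t A : L_preimage t A = Hflow t @^-1` A.
Proof.
apply/seteqP; split=> [u [v Av vu]|u Au]; last by exists (Hflow t u).
rewrite /preimage /= (_ : Hflow t u = v)//; exact: val_inj.
Qed.

End flow.

(** * Separability of the space of test functions in L2 *)

Section separability.
Context {R : realType}.
Let mu := @lebesgue_measure R.
Implicit Types (f g : R -> R[i]).
Local Notation mR D := (@measurable _ (measurableTypeR R) D).

Lemma lipschitz_of_derive (F F' : R -> R) (c : R) :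
  (forall x : R, is_derive x 1 F (F' x)) -> (forall x, `|F' x| <= c) ->
  forall x y, `|F y - F x| <= c * `|y - x|.
Proof.
move=> dF Fc.
have H x y : x <= y -> `|F y - F x| <= c * `|y - x|.
  move=> xy; have cF : {within `[x, y], continuous F}.
    apply: continuous_subspaceT => z.
    by apply: differentiable_continuous; apply/derivable1_diffP; have [] := dF z.
  have [z _ ->] := MVT_segment xy (fun z _ => dF z) cF.
  by rewrite normrM ler_wpM2r.
move=> x y; have [/H//|/ltW/H] := leP x y.
by rewrite distrC (distrC x).
Qed.

Lemma schwartz_lipschitz g : schwartz g ->
  exists2 c, 0 <= c & forall x y, normc (g y - g x) <= c * `|y - x|.
Proof.
move=> sg; have [c c0 hc] := (schwartzP g).1 sg 0 1%N.
have /csmoothP[dg _] := schwartz_smooth sg.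
have gc x : normc (cder g x) <= c.
  by have := sym_bound (sym_der hc dg) (I : setT x); rewrite subr0 jb0 mulr1.
exists (c + c); first exact: addr_ge0.
move=> x y; apply: le_trans (normc_le _) _; rewrite ReB ImB mulrDl lerD//.
- apply: (@lipschitz_of_derive (Re \o g) (Re \o cder g)) => z; first exact: (dg z).1.
  exact: le_trans (le_Re_normc _) (gc z).
- apply: (@lipschitz_of_derive (Im \o g) (Im \o cder g)) => z; first exact: (dg z).2.
  exact: le_trans (le_Im_normc _) (gc z).
Qed.

Let ratc (p : rat * rat) : R[i] := ratr p.1 +i* ratr p.2.

Lemma dense_ratc (z : R[i]) (e : R) : 0 < e -> exists p, normc (z - ratc p) <= e.
Proof.
move=> e0; have H (x : R) : exists q : rat, `|x - ratr q| <= e / 2.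
  have [|q] := @rat_in_itvoo R (x - e / 2) x; first by rewrite ltrBlDr ltrDl divr_gt0.
  rewrite in_itv /= => /andP[h1 h2]; exists q.
  by rewrite ger0_norm ?subr_ge0 ?ltW//; lra.
have [q1 h1] := H (Re z); have [q2 h2] := H (Im z); exists (q1, q2).
apply: le_trans (normc_le _) _; rewrite ReB ImB /=.
by rewrite [leRHS](splitr e) lerD.
Qed.

(** The test functions uniformly close to a given step function with rational
    values; [1 / m] is the step. *)
Let piece (r : R) (p : nat * nat * seq (rat * rat)) : set (R -> R[i]) :=
  [set g | test_function r g /\ forall x, `|x| < r ->
    normc (g x - ratc (nth (0, 0) p.2 (Num.truncn ((x + r) * p.1.2%:R)))) <=
      p.1.1.+1%:R^-1].

Lemma piece_cover r g n : test_function r g -> exists m s, piece r (n, m, s) g.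
Proof.
move=> tg; have [c c0 gc] := schwartz_lipschitz (test_schwartz tg).
pose e : R := n.+1%:R^-1; have e0 : 0 < e by rewrite invr_gt0.
pose m := Num.bound (2 * c / e); have mP : 2 * c / e < m%:R.
  by apply: archi_boundP; rewrite divr_ge0 ?mulr_ge0// ltW.
have m0 : 0 < m%:R :> R by rewrite (le_lt_trans _ mP)// divr_ge0 ?mulr_ge0// ltW.
have cm : c / m%:R <= e / 2.
  rewrite ler_pdivrMr// mulrAC ler_pdivlMr//; move: mP.
  by rewrite ltr_pdivrMr// => /ltW; rewrite mulrC (mulrC e).
pose K := Num.bound `|2 * r * m%:R|.
have [q hq] := choice (fun i : nat => dense_ratc (g (i%:R / m%:R - r))
  (divr_gt0 e0 (ltr0Sn R 1))).
exists m, (mkseq q K); split=> //= x xr; set i := Num.truncn _.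
move: xr; rewrite ltr_norml => /andP[xr1 xr2].
have xm : 0 <= (x + r) * m%:R by rewrite mulr_ge0// ltW//; lra.
have /andP[i1 i2] : i%:R <= (x + r) * m%:R < i.+1%:R by exact: truncn_itv.
have iK : (i < K)%N.
  rewrite -(ltr_nat R); apply: le_lt_trans i1 _.
  apply: lt_trans (archi_boundP (normr_ge0 _)); apply: lt_le_trans (ler_norm _).
  by rewrite ltr_pM2r//; lra.
rewrite nth_mkseq//.
have -> : g x - ratc (q i) = (g x - g (i%:R / m%:R - r)) + (g (i%:R / m%:R - r) - ratc (q i)).
  by rewrite addrA subrK.
apply: le_trans (normcD _ _) _; rewrite [leRHS](splitr e) lerD ?hq//.
apply: le_trans (gc _ _) _; apply: le_trans cm; rewrite ler_wpM2l//.
rewrite -(ler_pM2r m0) mulVf ?gt_eqF// -[X in _ * X]ger0_norm ?ltW// -normrM.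
have -> : (x - (i%:R / m%:R - r)) * m%:R = (x + r) * m%:R - i%:R.
  by field; rewrite gt_eqF.
by rewrite ger0_norm ?subr_ge0// ltrBlDl natr1.
Qed.

Lemma nrm2_uniform r g (e : R) : test_function r g -> 0 <= e ->
  (forall x, `|x| < r -> normc (g x) <= e) ->
  nrm2 g <= e ^+ 2 * fine (mu (sym_itv r)).
Proof.
move=> tg e0 ge; have mI := measurable_sym_itv r.
have i2 := schwartz_sq_integrable (test_schwartz tg).
rewrite -(Rintegral_cst mu mI).
have -> : nrm2 g = \int[mu]_(x in sym_itv r) (normc (g x) ^+ 2).
  rewrite /nrm2 [RHS]Rintegral_mkcond; apply: eq_Rintegral => x _.
  rewrite patchE; case: ifPn => // /negP xI.
  by rewrite (test_support tg) ?normc0 ?expr0n// => h; apply: xI; rewrite inE.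
apply: le_Rintegral => //; first exact: integrableS i2.
  apply/integrableP; split; first exact/measurable_EFinP/measurable_cst.
  rewrite integral_cst//= lte_mul_pinfty ?lee_fin//.
  rewrite /sym_itv; have := @lebesgue_measure_itv R `]- r, r[ => /= h.
  by rewrite [X in (X < _)%E]h; case: ifP => // _; rewrite -EFinB ltry.
move=> x; rewrite /sym_itv /= in_itv /= -ltr_norml => xr.
by rewrite ler_pXn2r ?nnegrE ?normc_ge0//; exact: ge.
Qed.

(** A subset of a separable metric space is separable: one test function is
    picked in each nonempty piece. *)
Lemma separable_test r : 0 < r -> exists2 w : nat -> R -> R[i],
  forall j, test_function r (w j) &
  forall g e, test_function r g -> 0 < e ->
    exists j, Num.sqrt (nrm2 (fun x => g x - w j x)) <= e.
Proof.
move=> r0; have t0 : test_function r (fun=> 0 : R[i]).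
  split; first exact: schwartz0.
  by exists (r - 1) => //; rewrite ltrBlDr ltrDl.
have H p : exists g, test_function r g /\ (piece r p !=set0 -> piece r p g).
  have [[g pg]|np] := pselect (piece r p !=set0); last by exists (fun=> 0).
  by exists g; split=> //; exact: pg.1.
have [w0 hw] := choice H.
exists (fun j => if unpickle j is Some p then w0 p else fun=> 0).
  by move=> j; case: (unpickle j) => [p|//]; exact: (hw p).1.
move=> g e tg e0.
pose M := Num.sqrt (fine (mu (sym_itv r))); have M0 : 0 <= M by exact: sqrtr_ge0.
pose n := Num.bound (2 * M / e).
have nP : 2 * M / e < n%:R by apply: archi_boundP; rewrite divr_ge0 ?mulr_ge0// ltW.
have [m [s ps]] := piece_cover n tg.
have [tw pw] := hw (n, m, s); have {}pw := (pw (ex_intro _ g ps)).2.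
exists (pickle (n, m, s)); rewrite pickleK.
have n0 : 0 < n.+1%:R :> R by [].
have := @nrm2_uniform r (fun x => g x - w0 (n, m, s) x) (2 / n.+1%:R) (testB tg tw).
have h2 : 0 <= 2 / n.+1%:R :> R by rewrite divr_ge0.
move=> /(_ h2) h; have {}h : nrm2 (fun x => g x - w0 (n, m, s) x) <=
    (2 / n.+1%:R) ^+ 2 * fine (mu (sym_itv r)).
  apply: h => x xr; set z := ratc (nth (0, 0) s (Num.truncn ((x + r) * m%:R))).
  have -> : g x - w0 (n, m, s) x = (g x - z) - (w0 (n, m, s) x - z) by ring.
  apply: le_trans (normcB _ _) _; rewrite mulr_natl mulr2n lerD//.
    exact: ps.2.
  exact: pw.
apply: le_trans (ler_wsqrtr h) _.
rewrite sqrtrM ?sqr_ge0// sqrtr_sqr ger0_norm// -/M.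
rewrite mulrAC ler_pdivrMr//; apply: (@le_trans _ _ (e * n%:R)).
  by move: nP; rewrite ltr_pdivrMr// mulrC (mulrC e) => /ltW; rewrite mulrC.
by rewrite ler_wpM2l ?(ltW e0)// ler_nat.
Qed.

End separability.

(** * The metric of Hloc *)

Section metric.
Context {R : realType}.
Let mu := @lebesgue_measure R.
Implicit Types (f g : R -> R[i]) (u v : functional R).
Local Notation mR D := (@measurable _ (measurableTypeR R) D).

Definition dsub u v : functional R := fun f => u f - v f.

Lemma D_dsub s u v g : schwartz g -> D s (dsub u v) g = D s u g - D s v g.
Proof. by move=> sg; rewrite !(DE _ _ sg). Qed.

Lemma slinear_D_dsub s u v : tempered u -> tempered v -> slinear (D s (dsub u v)).
Proof.
move=> tu tv z f g sf sg.
have sl : schwartz (fun x => z * f x + g x) by apply: schwartzD => //; exact: schwartzZ.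
rewrite (D_dsub _ _ _ sl) (D_dsub _ _ _ sf) (D_dsub _ _ _ sg).
rewrite (tempered_slinear (tempered_D s tu) _ sf sg).
rewrite (tempered_slinear (tempered_D s tv) _ sf sg).
by move: (D s u f) (D s u g) (D s v f) (D s v g) => a b c e; ring.
Qed.

Lemma dsub_seminorm_le u v (r s c : R) : tempered u -> tempered v -> 0 < r ->
  0 <= c -> opb r (fun g => D s u g - D s v g) c ->
  fine (seminorm r s (dsub u v)) <= c.
Proof.
move=> tu tv r0 c0 h; rewrite -lee_fin fineK.
  apply: seminorm_le => //; first exact: slinear_D_dsub.
  by move=> g tg; rewrite (D_dsub _ _ _ (test_schwartz tg)); exact: h.
rewrite ge0_fin_numE ?L2_seminorm_ge0//; apply: le_lt_trans (ltry c).
apply: seminorm_le => //; first exact: slinear_D_dsub.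
by move=> g tg; rewrite (D_dsub _ _ _ (test_schwartz tg)); exact: h.
Qed.

Lemma dsub_seminorm_opb u v (r s : R) : Hloc_set u -> Hloc_set v -> 0 < r ->
  s < 2^-1 -> opb r (fun g => D s u g - D s v g) (fine (seminorm r s (dsub u v))).
Proof.
move=> hu hv r0 s2; have [[tu _] [tv _]] := (hu, hv).
have [c c0 uc] := Hloc_opb hu s2 r0; have [c' c'0 vc] := Hloc_opb hv s2 r0.
have fs : (seminorm r s (dsub u v) < +oo)%E.
  apply: le_lt_trans (ltry (c + c')); apply: seminorm_le => //.
  - exact: slinear_D_dsub.
  - exact: addr_ge0.
  - move=> g tg; rewrite (D_dsub _ _ _ (test_schwartz tg)) mulrDl.
    by apply: le_trans (normcB _ _) _; rewrite lerD ?uc ?vc.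
move=> g tg; rewrite -(D_dsub _ _ _ (test_schwartz tg)).
exact: (seminorm_opb fs).
Qed.

Lemma Hloc_dist_term_ge0 (k l : nat) (p : R) : 0 <= p ->
  0 <= 2 ^- (k + l) * (p / (1 + p)).
Proof. by move=> p0; rewrite mulr_ge0 ?invr_ge0 ?exprn_ge0 ?divr_ge0 ?addr_ge0. Qed.

Let fine_ge (r s : R) u : 0 <= fine (seminorm r s u).
Proof. by rewrite fine_ge0// L2_seminorm_ge0. Qed.

Lemma Hloc_dist_ge (k l : nat) u v (p : R) : (0 < k)%N -> (0 < l)%N ->
  p = fine (seminorm k%:R (2^-1 - l%:R^-1) (dsub u v)) ->
  ((2 ^- (k + l) * (p / (1 + p)))%:E <= Hloc_dist u v)%E.
Proof.
move=> k0 l0 ->; rewrite /Hloc_dist.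
pose t i j : \bar R := let p := fine (seminorm i%:R (2^-1 - j%:R^-1) (dsub u v)) in
  (2 ^- (i + j) * (p / (1 + p)))%:E.
have t0 i j : (0 <= t i j)%E by rewrite lee_fin Hloc_dist_term_ge0.
have H (a : nat -> \bar R) n : (0 < n)%N -> (forall n, (0 <= a n)%E) ->
    (a n <= \sum_(1 <= i <oo) a i)%E.
  move=> n0 a0; apply: le_trans (nneseries_lim_ge n.+1 _) => //.
  by rewrite big_nat_recr//= leeDr// sume_ge0.
apply: le_trans (H (fun i => (\sum_(1 <= j <oo) t i j)%E) k k0 _) => [|i]; last exact: nneseries_ge0.
by apply: (H (fun j => t k j) l l0).
Qed.

Let geo (a : R) : 0 <= a -> (\sum_(1 <= l <oo) (a * (3 / 4) ^+ l)%:E <= (4 * a)%:E)%E.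
Proof.
move=> a0; have h : `|3 / 4 : R| < 1 by rewrite ger0_norm//; lra.
have g0 n : (0 <= (a * (3 / 4) ^+ n)%:E)%E.
  by rewrite lee_fin mulr_ge0// exprn_ge0//; lra.
have -> : (4 * a)%:E = (\sum_(0 <= l <oo) (a * (3 / 4) ^+ l)%:E)%E.
  apply/esym/cvg_lim => //; under eq_fun do rewrite sumEFin.
  apply: cvg_EFin; first by near=> n.
  have := @cvg_geometric_series R a _ h.
  by rewrite (_ : a * (1 - 3 / 4)^-1 = 4 * a)//; field.
by rewrite nneseries_recl// leeDr.
Unshelve. all: by end_near. Qed.

(** Beyond the first [n] indices the weights [2^-k] are small, and in all cases
    the terms are dominated by a multiple of [(3/4)^(k+l)]. *)
Lemma Hloc_dist_le (n : nat) u v (d : R) : 0 < d -> (2 / 3) ^+ n <= d ->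
  (forall k l, (0 < k)%N -> (0 < l)%N -> (k <= n)%N -> (l <= n)%N ->
    fine (seminorm k%:R (2^-1 - l%:R^-1) (dsub u v)) <= d) ->
  (Hloc_dist u v <= (16 * d)%:E)%E.
Proof.
move=> d0 nd H.
have q0 (m : nat) : 0 <= (3 / 4 : R) ^+ m by rewrite exprn_ge0//; lra.
have half (m : nat) : 2 ^- m = (2 / 3) ^+ m * (3 / 4) ^+ m :> R.
  by rewrite -exprMn -exprVn; congr (_ ^+ m); field.
have halfle (m : nat) : 2 ^- m <= (3 / 4) ^+ m :> R.
  by rewrite -exprVn lerXn2r ?nnegrE//; lra.
have tail (m : nat) : (n <= m)%N -> 2 ^- m <= d * (3 / 4) ^+ m.
  move=> nm; rewrite half ler_wpM2r//; apply: le_trans nd.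
  by apply: ler_wiXn2l => //; lra.
have term (k l : nat) (p : R) : (0 < k)%N -> (0 < l)%N -> 0 <= p ->
    ((k <= n)%N -> (l <= n)%N -> p <= d) ->
    2 ^- (k + l) * (p / (1 + p)) <= d * (3 / 4) ^+ k * (3 / 4) ^+ l.
  move=> k0 l0 p0 pd; have p1 : 0 < 1 + p by rewrite ltr_pwDl.
  have pp : p / (1 + p) <= 1 by rewrite ler_pdivrMr// mul1r lerDr.
  have pp0 : 0 <= p / (1 + p) by rewrite divr_ge0// ltW.
  have w0 m : 0 <= 2 ^- m :> R by rewrite invr_ge0 exprn_ge0.
  have E : 2 ^- (k + l) = 2 ^- k * 2 ^- l :> R by rewrite exprD invfM.
  rewrite E; have [kn|kn] := leqP k n; last first.
    apply: (@le_trans _ _ (2 ^- k * 2 ^- l)); first by rewrite ler_piMr// mulr_ge0.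
    by rewrite ler_pM// tail// ltnW.
  have [ln|ln] := leqP l n; last first.
    apply: (@le_trans _ _ (2 ^- k * 2 ^- l)); first by rewrite ler_piMr// mulr_ge0.
    by rewrite -mulrA mulrCA ler_pM// tail// ltnW.
  have ppd : p / (1 + p) <= d.
    apply: le_trans (pd kn ln).
    by rewrite ler_pdivrMr// ler_peMr// lerDl.
  have -> : d * (3 / 4) ^+ k * (3 / 4) ^+ l = (3 / 4) ^+ k * (3 / 4) ^+ l * d by ring.
  by apply: ler_pM => //; exact: ler_pM.
apply: le_trans (_ : \sum_(1 <= k <oo) (4 * d * (3 / 4) ^+ k)%:E <= _)%E; last first.
  apply: le_trans (geo _) _; first by rewrite mulr_ge0// ltW.
  by rewrite lee_fin mulrA -natrM.
rewrite /Hloc_dist eseries_cond [leRHS]eseries_cond.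
apply: lee_nneseries => [k _ _|k /andP[_ k0]].
  by apply: nneseries_ge0 => l _ _; rewrite lee_fin Hloc_dist_term_ge0.
have dk0 : 0 <= d * (3 / 4) ^+ k by rewrite mulr_ge0// ltW.
rewrite -mulrA; apply: le_trans (geo dk0).
rewrite eseries_cond [leRHS]eseries_cond.
apply: lee_nneseries => [l _ _|l /andP[_ l0]].
  by rewrite lee_fin Hloc_dist_term_ge0.
by rewrite lee_fin; apply: term => // kn ln; exact: H.
Qed.

End metric.

(** * The Borel sigma-algebra of Hloc *)

Section evaluations.
Context {R : realType}.
Let mu := @lebesgue_measure R.
Implicit Types (f g h : R -> R[i]) (v : functional R).
Local Notation mR D := (@measurable _ (measurableTypeR R) D).

Lemma Hloc_setP (u : Hloc R) : Hloc_set (val u).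
Proof. exact: set_mem (valP u). Qed.

Lemma Hloc_tempered (u : Hloc R) : tempered (val u).
Proof. by have [] := Hloc_setP u. Qed.

Lemma D0E v g : schwartz g -> D 0 v g = v g.
Proof.
move=> sg; rewrite (DE _ _ sg); congr v.
by rewrite -[RHS](Tm1 sg); apply: eq_Tm => n; rewrite jb0.
Qed.

Lemma Re_eval_continuous r h (u : Hloc R) (e : R) : test_function r h -> 0 < e ->
  exists2 d : R, 0 < d & forall v : Hloc R,
    (Hloc_dist (val u) (val v) < d%:E)%E -> normc (val u h - val v h) < e.
Proof.
move=> th e0.
have [k k0 tk] : exists2 k : nat, (0 < k)%N & test_function (k%:R : R) h.
  exists (Num.bound `|r|).+1 => //.
  have [sh [r' r'r hr]] := th; split=> //; exists r' => //.
  apply: lt_le_trans r'r _; apply: le_trans (ler_norm r) _.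
  by apply: ltW; apply: lt_le_trans (archi_boundP (normr_ge0 _)) _; rewrite ler_nat.
have frac (x y : R) : 0 <= x -> 0 < y -> x / (1 + x) < y / (1 + y) -> x < y.
  move=> x0 y0; have x1 : 0 < 1 + x by rewrite ltr_pwDl.
  rewrite ltr_pdivrMr// mulrAC ltr_pdivlMr ?addr_gt0// !mulrDr !mulr1 (mulrC y).
  by rewrite ltrD2r.
have k1 : 0 < k%:R :> R by rewrite ltr0n.
have w0 : 0 < 2 ^- (k + 2) :> R by rewrite invr_gt0 exprn_gt0.
pose q := Num.sqrt (nrm2 h); have q0 : 0 <= q by exact: sqrtr_ge0.
have q1 : 0 < q + 1 by rewrite ltr_wpDl.
pose eta := e / (q + 1); have eta0 : 0 < eta by rewrite divr_gt0.
exists (2 ^- (k + 2) * (eta / (1 + eta))).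
  by rewrite mulr_gt0// divr_gt0// addr_gt0.
move=> v; set p := fine (seminorm k%:R 0 (dsub (val u) (val v))) => uv.
have s2 : 2^-1 - 2%:R^-1 = 0 :> R by rewrite subrr.
have p0 : 0 <= p by rewrite fine_ge0// L2_seminorm_ge0.
have : p < eta.
  have pE : p = fine (seminorm k%:R (2^-1 - 2%:R^-1) (dsub (val u) (val v))) by rewrite s2.
  have := le_lt_trans (@Hloc_dist_ge R k 2 _ _ p k0 (ltn0Sn _) pE) uv.
  rewrite lte_fin (ltr_pM2l w0).
  exact: frac p0 eta0.
move=> pe; have s0 : (0 : R) < 2^-1 by rewrite invr_gt0.
have := dsub_seminorm_opb (Hloc_setP u) (Hloc_setP v) k1 s0 tk.
rewrite (D0E _ th.1) (D0E _ th.1) -/p -/q => H; apply: (le_lt_trans H).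
apply: (@le_lt_trans _ _ (eta * q)); first by rewrite ler_wpM2r// ltW.
by rewrite /eta mulrAC ltr_pdivrMr// ltr_pM2l// ltrDl.
Qed.

Lemma measurable_eval_test r h : test_function r h ->
  measurable_fun setT (fun u : borel_Hloc R => Re (val u h)).
Proof.
move=> th; apply: (measurability _ (RGenInftyO.measurableE R)) => //.
move=> _ [_ [x ->] <-]; rewrite setTI; apply: sub_sigma_algebra.
move=> u /=; rewrite in_itv /= => ux.
have e0 : 0 < x - Re (val u h) by rewrite subr_gt0.
have [d d0 H] := Re_eval_continuous u th e0; exists d => // v /H uv.
rewrite /= in_itv /=.
have := le_lt_trans (le_Re_normc _) uv; rewrite ReB ltr_norml => /andP[+ _].
by rewrite opprB; lra.
Qed.

Lemma sym_far A rh k a (c rho : R) f : 0 <= c -> 0 < rho ->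
  (forall x, A x -> rho <= jb 1 x) -> sym A rh k (a - 1) c f ->
  sym A rh k a (c / rho) f.
Proof.
move=> c0 r0 Ar; elim: k a f => [|k IH] a f sf.
- split=> // x Ax; apply: le_trans (sym_bound sf Ax) _.
  rewrite -mulrA ler_wpM2l// jbD jbN mulrC ler_wpM2r ?jb_ge0//.
  by rewrite lef_pV2 ?posrE ?jb_gt0//; exact: Ar.
- have [h [f' hf sf']] := sf; split.
    move=> x Ax; apply: le_trans (h _ Ax) _.
    rewrite -mulrA ler_wpM2l// jbD jbN mulrC ler_wpM2r ?jb_ge0//.
    by rewrite lef_pV2 ?posrE ?jb_gt0//; exact: Ar.
  by exists f' => //; apply: IH; rewrite addrAC.
Qed.

Lemma sym_contract k (c b : R) f : 0 <= c -> `|b| <= 1 -> sym setT 0 k 0 c f ->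
  sym setT 0 k 0 c (fun x => f (b * x)).
Proof.
move=> c0 b1.
have affine g : (fun x => g (b * x)) = (fun x => g (b * x + 0)) :> (R -> R[i]).
  by apply/funext => x; rewrite addr0.
have a0 : (0 : R) - 0 = 0 by rewrite subr0.
elim: k f => [|k IH] f sf.
  by split=> // x _; have := sym_bound sf (I : setT (b * x)); rewrite !jb0.
have [h [f' hf sf']] := sf; split.
  by move=> x _; have := h (b * x) I; rewrite !jb0.
rewrite a0 in sf' *; exists (fun x => b%:C * f' (b * x)).
  rewrite (affine f).
  by apply: is_cder_eq (is_cder_affine b 0 hf) => // x; rewrite addr0.
apply: sym_weaken (symZ b%:C (IH _ sf')) => //.
by rewrite normcR ler_piMl.
Qed.

(** Truncations converge in the Schwartz space, as the difference is supported
    far away, where one power of [jb 1 x] can be traded for a small constant. *)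
Lemma szero_cut h : schwartz h -> szero (fun n => fun x => (1 - cut n.+1%:R x) * h x).
Proof.
move=> sh k a e e0; have [c c0 hc] := (schwartzP h).1 sh (a - 1) k.
have [C C0 hC] := symbol_cut 0 0 (@ltr01 R) k.
pose K := 2 ^+ k * ((1 + C) * c).
have K0 : 0 <= K by rewrite !mulr_ge0 ?exprn_ge0 ?addr_ge0.
near=> n; have n0 : 0 < n.+1%:R :> R by [].
have s1 : sym setT 0 k 0 (1 + C) (fun x => 1 - cut n.+1%:R x).
  have b1 : `|n.+1%:R^-1 : R| <= 1 by rewrite ger0_norm// invf_le1// ler1n.
  have := symD (sym_cst setT k 1 (lexx (0 : R))) (symZ (-1) (sym_contract C0 b1 hC)).
  rewrite normcN normc1 mul1r; apply: sym_eq => x.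
  by rewrite mulN1r /cut invr1 mul1r.
have c1 : 0 <= 1 + C by rewrite addr_ge0.
have := symM c1 c0 s1 hc; rewrite add0r -/K => s2.
pose A := [set x : R | n.+1%:R <= `|x|].
have s3 : sym A 0 k (a - 1) K (fun x => (1 - cut n.+1%:R x) * h x).
  exact: sym_weaken s2.
have A1 x : A x -> n.+1%:R <= jb 1 x.
  by move=> Ax; exact: le_trans Ax (normr_le_jb1 x).
have s4 := sym_far K0 n0 A1 s3.
have : sym setT 0 k a (K / n.+1%:R) (fun x => (1 - cut n.+1%:R x) * h x).
  apply: (sym_extend (@open_abs_lt _ n.+1%:R) _ _ _ s4).
  - by move=> x /= /negP; rewrite -ltNge.
  - by move=> x xr; rewrite cut1 ?subrr ?mul0r// ltW.
  - by rewrite divr_ge0.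
apply: sym_weaken => //; last exact: ltW.
rewrite ler_pdivrMr// mulrC -ler_pdivrMr//.
apply: (@le_trans _ _ n%:R); last by rewrite ler_nat.
by near: n; exact: nbhs_infty_ger.
Unshelve. all: by end_near. Qed.

Lemma cut_eval_cvg v h : tempered v -> schwartz h ->
  normc (v h - v (fun x => cut n.+1%:R x * h x)) @[n --> \oo] --> (0 : R).
Proof.
move=> tv sh; have sc n : schwartz (fun x => cut n.+1%:R x * h x).
  by apply: test_schwartz (test_cut _ sh).
have sd n : schwartz (fun x => (1 - cut n.+1%:R x) * h x).
  by apply: schwartz_slow => //; exists 0; exact: symbol_cutC.
have := tempered_cvg tv sd (szero_cut sh).
rewrite (_ : (fun n => normc (v _)) =
  fun n => normc (v h - v (fun x => cut n.+1%:R x * h x)))//.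
apply/funext => n; congr normc; rewrite -[v h](_ : v (fun x => (1 - cut n.+1%:R x) * h x) +
  v (fun x => cut n.+1%:R x * h x) = _) ?addrK//.
rewrite -(slinearD (tempered_slinear tv) (sd n) (sc n)).
by congr v; apply/funext => x; rewrite -mulrDl subrK mul1r.
Qed.

Lemma measurable_eval h : schwartz h ->
  measurable_fun setT (fun u : borel_Hloc R => Re (val u h)).
Proof.
move=> sh; apply: (@measurable_fun_cvg _ (borel_Hloc R) R setT
    (fun n (u : borel_Hloc R) => Re (val u (fun x => cut n.+1%:R x * h x)))).
  by move=> n; apply: measurable_eval_test (test_cut _ sh).
move=> u _; have := cut_eval_cvg (Hloc_tempered u) sh.
move=> /cvgrPdist_le H; apply/cvgrPdist_le => e e0.
apply: filterS (H e e0) => n; rewrite sub0r normrN ger0_norm ?normc_ge0// => Hn.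
by rewrite -ReB; apply: le_trans (le_Re_normc _) _.
Qed.

End evaluations.

Section generation.
Context {R : realType}.
Let mu := @lebesgue_measure R.
Implicit Types (f g h : R -> R[i]) (v : functional R).
Local Notation mR D := (@measurable _ (measurableTypeR R) D).

Definition box (n : nat) (h : nat -> R -> R[i]) (a : nat -> R) : set (Hloc R) :=
  [set u | forall i, (i < n)%N -> a i <= Re (val u (h i))].

Definition boxes : set (set (Hloc R)) :=
  [set B | exists (n : nat) (h : nat -> R -> R[i]) (a : nat -> R), (forall i, schwartz (h i)) /\ B = box n h a].

Lemma boxes_setI : setI_closed boxes.
Proof.
move=> _ _ [n [h [a [sh ->]]]] [m [k [b [sk ->]]]].
exists (n + m)%N, (fun i => if (i < n)%N then h i else k (i - n)%N),
  (fun i => if (i < n)%N then a i else b (i - n)%N); split.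
  by move=> i; case: ifP.
apply/seteqP; split=> [u [h1 h2] i inm|u H].
  case: ifPn => [/h1//|]; rewrite -leqNgt => ni; apply: h2.
  by rewrite ltn_subLR.
split=> i im; first by have := H i (ltn_addr _ im); rewrite im.
have nn : (n + i < n)%N = false by rewrite ltnNge leq_addr.
by have := H (n + i)%N; rewrite ltn_add2l nn addKn => /(_ im).
Qed.

Let BT := g_sigma_algebraType boxes.

Lemma box_measurable_Re h : schwartz h ->
  measurable_fun setT (fun u : BT => Re (val u h)).
Proof.
move=> sh; apply: (measurability _ (RGenCInfty.measurableE R)) => //.
move=> _ [_ [x ->] <-]; rewrite setTI; apply: sub_sigma_algebra.
exists 1%N, (fun=> h), (fun=> x); split=> //.
apply/seteqP; split=> [u /=|u /(_ 0%N isT) /=]; rewrite in_itv /= andbT//.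
by move=> xu i _.
Qed.

Lemma box_cmeasurable h : schwartz h ->
  cmeasurable_fun setT (fun u : BT => val u h).
Proof.
move=> sh; split; first exact: box_measurable_Re.
have := box_measurable_Re (schwartzZ (0 -i* 1) sh); apply: eq_measurable_fun => u _ /=.
rewrite (slinearZ _ (tempered_slinear (Hloc_tempered u)) sh) ReM /=; ring.
Qed.

Lemma opb_bil r f : schwartz f -> opb r (bil f) (Num.sqrt (nrm2 f)).
Proof.
move=> sf; have mI := measurable_sym_itv r.
have s0 : 0 <= Num.sqrt (nrm2 f) by exact: sqrtr_ge0.
have le : (L2norm mu (sym_itv r) f <= (Num.sqrt (nrm2 f))%:E)%E.
  apply: (L2norm_le s0); rewrite sqr_sqrtr ?nrm2_ge0//.
  apply: integral_restrict_le => //; last exact: schwartz_sq_integrable.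
  by move=> x; exact: sqr_ge0.
apply: (opb_L2 s0 _ le); split.
- exact: ccontinuous_measurable (schwartz_continuous sf).
- exact: le_lt_trans le (ltry _).
- by move=> g tg; exact: bil_test.
Qed.

Lemma nrm2_triangle r f g : test_function r f -> test_function r g ->
  Num.sqrt (nrm2 f) <= Num.sqrt (nrm2 g) + Num.sqrt (nrm2 (fun x => f x - g x)).
Proof.
move=> tf tg; have td := testB tf tg.
have sg := test_schwartz tg; have sd := test_schwartz td.
rewrite -(@ler_pXn2r _ 2%N)// ?nnegrE ?addr_ge0 ?sqrtr_ge0//.
have E : f = fun x => g x + (f x - g x) by apply/funext => x; ring.
rewrite sqrrD !sqr_sqrtr ?nrm2_ge0// [X in nrm2 X <= _]E (nrm2D sg sd).
have := opb_bil (schwartz_conj sg) td; rewrite nrm2_conj => H.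
have := le_trans (ler_norm _) (le_trans (le_Re_normc _) H).
by rewrite mulr2n; lra.
Qed.

Let rad (k : nat) : R := k.+1%:R.
Let reg (l : nat) : R := 2^-1 - l.+1%:R^-1.

Let rad_gt0 k : 0 < rad k. Proof. by []. Qed.

Let reg_lt l : reg l < 2^-1.
Proof. by rewrite /reg ltrBlDr ltrDl invr_gt0. Qed.

(** A bounded functional is controlled by its values on a dense sequence. *)
Lemma opb_dense r v (c : R) (w : nat -> R -> R[i]) :
  (forall j, test_function r (w j)) ->
  (forall g e, test_function r g -> 0 < e ->
    exists j, Num.sqrt (nrm2 (fun x => g x - w j x)) <= e) ->
  slinear v -> (exists2 C, 0 <= C & opb r v C) -> 0 <= c ->
  (forall j, normc (v (w j)) <= c * Num.sqrt (nrm2 (w j))) -> opb r v c.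
Proof.
move=> tw dw lv [C C0 vC] c0 H g tg; apply/ler_addgt0Pr => e e0.
have Cc : 0 < C + c + 1 by rewrite ltr_wpDl// addr_ge0.
have [j hj] := dw g (e / (C + c + 1)) tg (divr_gt0 e0 Cc).
have td := testB tg (tw j); have td' := testB (tw j) tg.
have -> : v g = v (fun x => g x - w j x) + v (w j).
  rewrite -slinearD//; [|exact: test_schwartz td|exact: test_schwartz (tw j)].
  by congr v; apply/funext => x; rewrite subrK.
apply: le_trans (normcD _ _) _.
have h1 := le_trans (vC _ td) (ler_wpM2l C0 hj).
have h2 := nrm2_triangle (tw j) tg.
have E : nrm2 (fun x => w j x - g x) = nrm2 (fun x => g x - w j x).
  by apply: eq_Rintegral => x _; rewrite normc_distC.
rewrite E in h2.
have h3 := le_trans (H j) (ler_wpM2l c0 (le_trans h2 (lerD (lexx _) hj))).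
apply: le_trans (lerD h1 h3) _.
rewrite mulrDr addrCA lerD2l -mulrDl mulrCA -[leRHS]mulr1 ler_wpM2l ?(ltW e0)//.
by rewrite ler_pdivrMr// mul1r lerDl.
Qed.

(** The sets of the countable family which generates the topology: [D s u] is
    close to a test function taken from a dense sequence. *)
Let near_set (w : nat -> nat -> R -> R[i]) (p : nat * nat * (nat * nat)) : set (Hloc R) :=
  [set u | opb (rad p.1.1) (fun g => D (reg p.1.2) (val u) g - bil (w p.1.1 p.2.1) g)
    p.2.2.+1%:R^-1].

Lemma slinear_bil f : schwartz f -> slinear (bil f).
Proof.
move=> sf z g k sg sk.
rewrite /bil -(cintegralZ z measurableT (schwartz_cintegrable (schwartzM sf sg))).
rewrite -(cintegralD measurableT (cintegrableZ z measurableT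
  (schwartz_cintegrable (schwartzM sf sg))) (schwartz_cintegrable (schwartzM sf sk))).
by apply: eq_cintegral => x _; ring.
Qed.

Lemma slinearB v v' : slinear v -> slinear v' -> slinear (fun g => v g - v' g).
Proof.
move=> lv lv' z f g sf sg; rewrite lv// lv'//.
by move: (v f) (v g) (v' f) (v' g) => a b c e; ring.
Qed.

Lemma measurable_near_set w p :
  (forall k j, test_function (rad k) (w k j)) ->
  (forall k g e, test_function (rad k) g -> 0 < e ->
    exists j, Num.sqrt (nrm2 (fun x => g x - w k j x)) <= e) ->
  measurable (near_set w p : set BT).
Proof.
case: p => [[k l] [i j]] tw dw.
pose c : R := j.+1%:R^-1; have c0 : 0 <= c by rewrite invr_ge0.
have -> : near_set w (k, l, (i, j)) = \bigcap_m [set u : BT |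
    normc (val u (Tm (fun n => (jb (reg l) n)%:C) (w k m)) - bil (w k i) (w k m)) <=
    c * Num.sqrt (nrm2 (w k m))].
  apply/seteqP; split=> [u Hu m _ /=|u Hu].
    by rewrite -(DE _ _ (test_schwartz (tw k m))); exact: Hu.
  have [tu _] := Hloc_setP u.
  have [C C0 hC] := Hloc_opb (Hloc_setP u) (reg_lt l) (rad_gt0 k).
  apply: (opb_dense (tw k) (dw k)) => //.
  - apply: slinearB; first exact: tempered_slinear (tempered_D _ tu).
    exact: slinear_bil (test_schwartz (tw k i)).
  - exists (C + Num.sqrt (nrm2 (w k i))); first by rewrite addr_ge0// sqrtr_ge0.
    move=> g tg; apply: le_trans (normcB _ _) _; rewrite mulrDl lerD ?hC//.
    exact: (opb_bil (test_schwartz (tw k i)) tg).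
  - by move=> m; rewrite (DE _ _ (test_schwartz (tw k m))); exact: Hu.
apply: bigcapT_measurable => m.
rewrite -[X in measurable X]setTI; apply: measurable_fun_le => //.
apply: measurable_normc; apply: cmeasurableB; last exact: cmeasurable_cst.
by apply: box_cmeasurable; apply: schwartz_Tm; [exact: slow_jb|exact: test_schwartz (tw k m)].
Qed.

Lemma opb_add r v v' (c c' : R) : opb r v c -> opb r v' c' ->
  opb r (fun g => v g + v' g) (c + c').
Proof.
move=> hv hv' g tg; rewrite mulrDl; apply: le_trans (normcD _ _) _.
exact: lerD (hv _ tg) (hv' _ tg).
Qed.

Lemma opb_sub r v v' (c c' : R) : opb r v c -> opb r v' c' ->
  opb r (fun g => v g - v' g) (c + c').
Proof.
move=> hv hv' g tg; rewrite mulrDl; apply: le_trans (normcB _ _) _.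
exact: lerD (hv _ tg) (hv' _ tg).
Qed.

Lemma eq_opb r v v' (c : R) : (forall g, test_function r g -> v g = v' g) ->
  opb r v c -> opb r v' c.
Proof. by move=> vv hv g tg; rewrite -vv//; exact: hv. Qed.

Let near_sets w (s : seq (nat * nat * (nat * nat))) : set (Hloc R) :=
  foldr (fun p A => near_set w p `&` A) setT s.

Let near_setsP w s u : near_sets w s u <-> forall p, p \in s -> near_set w p u.
Proof.
elim: s => [|p s IH]; first by split.
split=> [[h1 /IH h2] q|H].
  by rewrite in_cons => /orP[/eqP ->//|/h2].
split; first by apply: H; rewrite mem_head.
by apply/IH => q qs; apply: H; rewrite in_cons qs orbT.
Qed.

(** Every open set is a countable union of the sets above, by separability. *)
Lemma open_boxes (U : set (Hloc R)) : open U -> measurable (U : set BT).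
Proof.
move=> oU.
have [w hw] : exists w : nat -> nat -> R -> R[i], forall k,
    (forall j, test_function (rad k) (w k j)) /\
    (forall g e, test_function (rad k) g -> 0 < e ->
      exists j, Num.sqrt (nrm2 (fun x => g x - w k j x)) <= e).
  have H k : exists w : nat -> R -> R[i],
    (forall j, test_function (rad k) (w j)) /\
    (forall g e, test_function (rad k) g -> 0 < e ->
      exists j, Num.sqrt (nrm2 (fun x => g x - w j x)) <= e).
    by have [w ? ?] := separable_test (rad_gt0 k); exists w.
  by have [w hw] := choice H; exists w.
have tw k := (hw k).1; have dw k := (hw k).2.
pose B (c : nat) : set BT := if unpickle c is Some s then
  if `[< near_sets w s `<=` U >] then near_sets w s else set0 else set0.
have mB s : measurable (near_sets w s : set BT).
  elim: s => [|p s IH]; first exact: measurableT.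
  by apply: measurableI => //; exact: measurable_near_set.
suff -> : U = \bigcup_c B c.
  apply: bigcupT_measurable => c; rewrite /B; case: (unpickle c) => [s|//].
  by case: ifP.
apply/seteqP; split=> [u Uu|u [c _]]; last first.
  by rewrite /B; case: (unpickle c) => [s|//]; case: asboolP => // h /h.
have [e e0 He] := oU u Uu.
pose d := e / 17; have d0 : 0 < d by rewrite divr_gt0.
have de : 16 * d < e by rewrite /d; lra.
have [n nd] : exists n, (2 / 3) ^+ n <= d.
  have h : `|2 / 3 : R| < 1 by rewrite ger0_norm//; lra.
  have := @cvg_geometric R 1 _ h => /cvgrPdist_le /(_ d d0)[n _ /(_ n (leqnn n))].
  by rewrite sub0r normrN /geometric /= mul1r ger0_norm ?exprn_ge0//; exists n.
pose j := Num.bound (2 / d).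
have jd : j.+1%:R^-1 + j.+1%:R^-1 <= d.
  have : 2 / d < j%:R by apply: archi_boundP; rewrite divr_ge0// ltW.
  rewrite ltr_pdivrMr// => h; have j0 : 0 < j.+1%:R :> R by [].
  have -> : j.+1%:R^-1 + j.+1%:R^-1 = 2 / j.+1%:R :> R by rewrite mulr_natl mulr2n.
  rewrite ler_pdivrMr//; apply: le_trans (ltW h) _.
  by rewrite mulrC ler_wpM2l ?(ltW d0)// ler_nat.
have H k l : exists i, near_set w (k, l, (i, j)) u.
  have [tu _] := Hloc_setP u.
  have [C C0 hC] := Hloc_opb (Hloc_setP u) (reg_lt l) (rad_gt0 k).
  pose q : R := j.+1%:R^-1; have q0 : 0 < q by rewrite invr_gt0.
  have q2 : 0 < q / 2 by rewrite divr_gt0.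
  have lu := tempered_slinear (tempered_D (reg l) tu).
  have [f tf hf] := riesz_approx lu C0 hC q2.
  have [i hi] := dw k f _ tf q2; exists i; rewrite /near_set /=.
  have sd := test_schwartz (testB tf (tw k i)).
  have := opb_add hf (opb_le hi (opb_bil (r := rad k) sd)).
  rewrite -splitr; apply: eq_opb => g tg.
  rewrite (bilB (test_schwartz tf) (test_schwartz (tw k i)) (test_schwartz tg)).
  by rewrite addrA subrK.
have [F hF] : exists F : nat -> nat -> nat, forall k l, near_set w (k, l, (F k l, j)) u.
  have H' k : exists F : nat -> nat, forall l, near_set w (k, l, (F l, j)) u.
    by have [F hF] := choice (H k); exists F.
  by have [F hF] := choice H'; exists F.
pose s := [seq (k, l, (F k l, j)) | k <- iota 0 n, l <- iota 0 n].
have su : near_sets w s u.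
  by apply/near_setsP => p /allpairsP[[k l] [_ _ ->]]; exact: hF.
exists (pickle s) => //; rewrite /B pickleK asboolT// => v /near_setsP sv.
apply: He; apply: le_lt_trans (_ : _ <= (16 * d)%:E)%E _; last by rewrite lte_fin.
apply: (Hloc_dist_le d0 nd) => -[//|k] [//|l] _ _ kn ln.
apply: (@le_trans _ _ (j.+1%:R^-1 + j.+1%:R^-1)); last exact: jd.
have j0 : 0 <= j.+1%:R^-1 + j.+1%:R^-1 :> R by rewrite addr_ge0.
apply: (dsub_seminorm_le (Hloc_tempered u) (Hloc_tempered v) _ j0) => //.
have vkl : near_set w (k, l, (F k l, j)) v.
  apply: sv; apply/allpairsP; exists (k, l).
  by rewrite !mem_iota.
have := opb_sub (hF k l) vkl; apply: eq_opb => g tg /=.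
by rewrite opprB addrA subrK.
Qed.

Lemma borel_boxes (A : set (borel_Hloc R)) : measurable A -> measurable (A : set BT).
Proof.
apply: smallest_sub; first exact: sigma_algebra_measurable.
exact: open_boxes.
Qed.

Lemma measurable_box (n : nat) (h : nat -> R -> R[i]) (a : nat -> R) :
  (forall i, schwartz (h i)) -> measurable (box n h a : set (borel_Hloc R)).
Proof.
move=> sh; have -> : box n h a =
    \bigcap_(i in [set i | (i < n)%N]) [set u : borel_Hloc R | a i <= Re (val u (h i))].
  by apply/seteqP; split=> u Hu i; exact: Hu.
apply: bigcap_measurableType => i _.
rewrite -[X in measurable X]setTI; apply: measurable_fun_le => //.
exact: measurable_eval.
Qed.

End generation.

(** * Rotation invariance of the Gaussian measure of the plane *)

Section gaussian_plane.
Context {R : realType}.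
Let mu := @lebesgue_measure R.
Let RR := measurableTypeR R.
Implicit Types (f : RR * RR -> \bar R).

Lemma ge0_integral_translate (h : RR -> \bar R) (a : R) :
  measurable_fun setT h -> (forall x, 0 <= h x)%E ->
  (\int[mu]_x h (x + a)%R = \int[mu]_x h x)%E.
Proof.
move=> mh h0.
have mphi : measurable_fun [set: RR] (fun x : RR => x + a : RR).
  by apply: measurable_funD => //; exact: measurable_cst.
pose nu : {measure set RR -> \bar R} :=
  measure_function_pushforward__canonical__measure_function_Measure mu mphi.
have E A : measurable A -> mu A = nu A.
  apply: lebesgue_measure_unique => _ [[u v] _ <-] /=.
  rewrite /pushforward (_ : _ @^-1` _ = `]u - a, v - a]%classic).
    by rewrite !lebesgue_measure_itv /= !lte_fin ltrD2r; case: ifP => // _;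
      rewrite -!EFinB; congr EFin; ring.
  by apply/seteqP; split => x /=; rewrite !in_itv /= ltrBlDr lerBrDr.
have := @ge0_integral_pushforward _ _ RR RR R _ mphi mu setT h measurableT mh (fun x _ => h0 x).
rewrite preimage_setT => <-; apply: eq_measure_integral => A mA _.
exact/esym/E.
Qed.

Let I2 f := (\int[mu]_x \int[mu]_y f (x, y))%E.

Let shear_r (b : R) (z : RR * RR) : RR * RR := (z.1, z.2 + b * z.1).
Let shear_l (b : R) (z : RR * RR) : RR * RR := (z.1 + b * z.2, z.2).

Let mshear_r b : measurable_fun setT (shear_r b).
Proof.
apply: measurable_fun_pair => //; apply: measurable_funD => //.
by apply: measurable_funM => //; exact: measurable_cst.
Qed.

Let mshear_l b : measurable_fun setT (shear_l b).
Proof.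
apply: measurable_fun_pair => //; apply: measurable_funD => //.
by apply: measurable_funM => //; exact: measurable_cst.
Qed.

Let I2_shear_r b f : measurable_fun setT f -> (forall z, 0 <= f z)%E ->
  I2 (f \o shear_r b) = I2 f.
Proof.
move=> mf f0; apply: eq_integral => x _ /=.
apply: (@ge0_integral_translate (fun y => f (x, y)) (b * x)) => //.
exact: measurableT_comp mf (measurable_pair1 x).
Qed.

Let I2_swap f : measurable_fun setT f -> (forall z, 0 <= f z)%E ->
  I2 f = (\int[mu]_y \int[mu]_x f (x, y))%E.
Proof. by move=> mf f0; exact: fubini_tonelli. Qed.

Let I2_shear_l b f : measurable_fun setT f -> (forall z, 0 <= f z)%E ->
  I2 (f \o shear_l b) = I2 f.
Proof.
move=> mf f0; have mfs : measurable_fun setT (f \o shear_l b) by exact: measurableT_comp.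
rewrite (I2_swap mfs (fun z => f0 _)) (I2_swap mf f0).
apply: eq_integral => y _ /=.
apply: (@ge0_integral_translate (fun x => f (x, y)) (b * y)) => //.
exact: measurableT_comp mf (measurable_pair2 y).
Qed.

Definition rot (c s : R) (z : RR * RR) : RR * RR :=
  (c * z.1 - s * z.2, s * z.1 + c * z.2).

Lemma measurable_rot c s : measurable_fun setT (rot c s).
Proof.
have m1 a : measurable_fun setT (fun z : RR * RR => a * z.1 : R).
  by apply: measurable_funM => //; exact: measurable_cst.
have m2 a : measurable_fun setT (fun z : RR * RR => a * z.2 : R).
  by apply: measurable_funM => //; exact: measurable_cst.
by apply: measurable_fun_pair; [apply: measurable_funB|apply: measurable_funD].
Qed.

(** A rotation of angle different from pi is a product of three shears, and
    Lebesgue measure is translation invariant; the half-turn is the square of a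
    quarter-turn. *)
Let I2_rot c s f : c ^+ 2 + s ^+ 2 = 1 -> measurable_fun setT f ->
  (forall z, 0 <= f z)%E -> I2 (f \o rot c s) = I2 f.
Proof.
have H c' s' g : c' ^+ 2 + s' ^+ 2 = 1 -> c' != -1 -> measurable_fun setT g ->
    (forall z, 0 <= g z)%E -> I2 (g \o rot c' s') = I2 g.
  move=> cs c1 mg g0; pose t := s' / (1 + c').
  have c10 : 1 + c' != 0 by rewrite addrC addr_eq0.
  have e2 : t * (1 + c') = s' by rewrite /t divfK.
  have e1 : s' * t = 1 - c'.
    apply: (mulIf c10); rewrite -mulrA e2 -expr2.
    by rewrite -[s' ^+ 2](addKr (c' ^+ 2)) cs; ring.
  have -> : g \o rot c' s' = ((g \o shear_l (- t)) \o shear_r s') \o shear_l (- t).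
    apply/funext => -[x y]; rewrite /= /rot /shear_l /shear_r /=; congr (g (_, _)).
      have -> : x + - t * y + - t * (y + s' * (x + - t * y)) =
        x - (s' * t) * x - t * (1 + (1 - s' * t)) * y by ring.
      rewrite e1; have -> : 1 + (1 - (1 - c')) = 1 + c' by ring.
      by rewrite e2; ring.
    have -> : y + s' * (x + - t * y) = s' * x + (1 - s' * t) * y by ring.
    by rewrite e1; ring.
  have m1 := measurableT_comp mg (mshear_l (- t)).
  have m2 := measurableT_comp m1 (mshear_r s').
  by rewrite (I2_shear_l _ m2 (fun=> g0 _)) (I2_shear_r _ m1 (fun=> g0 _)) (I2_shear_l _ mg g0).
move=> cs mf f0; have [c1|c1] := eqVneq c (-1); last exact: H.
have s0 : s = 0.
  by apply/eqP; rewrite -sqrf_eq0; move/eqP: cs; rewrite c1 sqrrN expr1n -subr_eq0 addrAC subrr add0r.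
have -> : f \o rot c s = (f \o rot 0 1) \o rot 0 1.
  apply/funext => -[x y]; rewrite /= /rot /= c1 s0.
  by congr (f (_, _)); ring.
have q : 0 ^+ 2 + 1 ^+ 2 = 1 :> R by rewrite expr0n expr1n add0r.
have n1 : 0 != -1 :> R by rewrite eq_sym oppr_eq0 oner_eq0.
have m1 := measurableT_comp mf (measurable_rot 0 1).
by rewrite (H _ _ _ q n1 m1 (fun=> f0 _)) (H _ _ _ q n1 mf f0).
Qed.

Variable sigma : R.
Hypothesis sigma0 : sigma != 0.

Let dens (z : RR * RR) : R := normal_pdf 0 sigma z.1 * normal_pdf 0 sigma z.2.

Let mdens : measurable_fun setT dens.
Proof.
by apply: measurable_funM; apply: measurableT_comp => //; exact: measurable_normal_pdf.
Qed.

Let dens_ge0 z : 0 <= dens z.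
Proof. by rewrite mulr_ge0 ?normal_pdf_ge0. Qed.

Let dens_rot c s z : c ^+ 2 + s ^+ 2 = 1 -> dens (rot c s z) = dens z.
Proof.
move=> cs; rewrite /dens !normal_pdfE// /normal_fun /=.
rewrite mulrACA [RHS]mulrACA -!expRD; congr (_ * expR _).
rewrite !subr0 -!mulrDl; congr (_ / _).
have -> : z.1 ^+ 2 = (c ^+ 2 + s ^+ 2) * z.1 ^+ 2 by rewrite cs mul1r.
have -> : z.2 ^+ 2 = (c ^+ 2 + s ^+ 2) * z.2 ^+ 2 by rewrite cs mul1r.
by ring.
Qed.

Definition gauss2 (A : set (RR * RR)) : \bar R :=
  (\int[mu]_x \int[mu]_y (\1_A (x, y) * dens (x, y))%:E)%E.

Let mgauss A : measurable A -> measurable_fun setT (fun z : RR * RR => (\1_A z * dens z)%:E).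
Proof. by move=> mA; apply/measurable_EFinP; apply: measurable_funM. Qed.

Let gauss_ge0 (A : set (RR * RR)) z : (0 <= (\1_A z * dens z)%:E)%E.
Proof. by rewrite lee_fin mulr_ge0// indicE. Qed.

Lemma gauss2_rot c s A : c ^+ 2 + s ^+ 2 = 1 -> measurable A ->
  gauss2 (rot c s @^-1` A) = gauss2 A.
Proof.
move=> cs mA; rewrite -[RHS](I2_rot cs (mgauss mA) (gauss_ge0 A)).
apply: eq_integral => x _; apply: eq_integral => y _ /=.
by rewrite (dens_rot _ cs) !indicE.
Qed.

Lemma gauss2_box (A B : set RR) : measurable A -> measurable B ->
  gauss2 (A `*` B) = (normal_prob 0 sigma A * normal_prob 0 sigma B)%E.
Proof.
move=> mA mB; rewrite /gauss2.
have mp := measurable_normal_pdf (R := R) 0 sigma.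
have nE (C : set RR) : measurable C ->
    normal_prob 0 sigma C = (\int[mu]_y (\1_C y * normal_pdf 0 sigma y)%:E)%E.
  move=> mC; rewrite /normal_prob integral_mkcond; apply: eq_integral => y _.
  by rewrite patchE indicE; case: ifPn; rewrite ?mul1r ?mul0r.
have mi (C : set RR) : measurable C ->
    measurable_fun setT (fun y : RR => (\1_C y * normal_pdf 0 sigma y)%:E).
  by move=> mC; apply/measurable_EFinP; apply: measurable_funM.
have i0 (C : set RR) y : (0 <= (\1_C y * normal_pdf 0 sigma y)%:E)%E.
  by rewrite lee_fin mulr_ge0 ?normal_pdf_ge0// indicE.
rewrite (nE A mA) (nE B mB).
under eq_integral => x _.
  under eq_integral => y _.
    rewrite /dens /= (_ : _ * _ = (\1_A x * normal_pdf 0 sigma x) *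
      (\1_B y * normal_pdf 0 sigma y)); last first.
      by rewrite !indicE in_setX -mulnb natrM mulrACA.
    rewrite EFinM.
  over.
  rewrite ge0_integralZl_EFin//; last 2 first.
  - exact: mi.
  - exact: i0.
over.
rewrite ge0_integralZr//.
- exact: mi.
- by apply: integral_ge0 => y _; exact: i0.
Qed.

Let gauss2E A : measurable A -> gauss2 A = (\int[mu \x mu]_(z in A) (dens z)%:E)%E.
Proof.
move=> mA; rewrite /gauss2 -(fubini_tonelli1 _ (mgauss mA) (gauss_ge0 A)).
rewrite [RHS]integral_mkcond; apply: eq_integral => z _.
by rewrite patchE indicE; case: ifPn; rewrite ?mul1r ?mul0r.
Qed.

Let gauss20 : gauss2 set0 = 0%E.
Proof. by rewrite gauss2E// integral_set0. Qed.

Let gauss2_ge0 A : (0 <= gauss2 A)%E.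
Proof. by apply: integral_ge0 => x _; apply: integral_ge0 => y _; exact: gauss_ge0. Qed.

Let gauss2_sigma_additive : semi_sigma_additive gauss2.
Proof.
move=> F mF tF mUF.
have md : measurable_fun setT (fun z => (dens z)%:E) by exact/measurable_EFinP.
rewrite gauss2E// ge0_integral_bigcup//; last 2 first.
- exact: measurable_funS md.
- by move=> z _; rewrite lee_fin.
under eq_fun do under eq_bigr do rewrite gauss2E//.
by apply: is_cvg_ereal_nneg_natsum_cond => n _ _; apply: integral_ge0 => z _; rewrite lee_fin.
Qed.

HB.instance Definition _ := isMeasure.Build _ _ _ gauss2 gauss20 gauss2_ge0
  gauss2_sigma_additive.

Definition gauss2_measure : {measure set (RR * RR) -> \bar R} := gauss2.

End gaussian_plane.

(** * Joint law of independent Gaussian increments *)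

Section joint_law.
Context {R : realType} d {T : measurableType d} (P : probability T R).
Let RR := measurableTypeR R.

Lemma gauss2_setT (s : R) : s != 0 -> gauss2 s setT = 1%E.
Proof.
move=> s0; rewrite -setXTT gauss2_box//.
by rewrite (probability_setT (normal_prob 0 s)) mule1.
Qed.

Lemma gauss2_fin (s : R) (A : set (RR * RR)) : s != 0 -> measurable A ->
  gauss2 s A = (fine (gauss2 s A))%:E.
Proof.
move=> s0 mA; rewrite fineK// ge0_fin_numE; last exact: (measure_ge0 (gauss2_measure s)).
apply: le_lt_trans (le_measure (gauss2_measure s) _ _ (@subsetT _ A)) _; rewrite ?inE//.
by rewrite /= gauss2_setT// ltry.
Qed.

Variables (n : nat) (X : 'I_n * bool -> T -> R) (s : 'I_n -> R).
Hypothesis mX : forall i, measurable_fun setT (X i).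
Hypothesis s0 : forall i, s i != 0.
Hypothesis iX : mutually_independent P X.
Hypothesis lX : forall i b (B : set R), measurable B ->
  P (X (i, b) @^-1` B) = normal_prob 0 (s i) B.

Let Z i w : RR * RR := (X (i, true) w, X (i, false) w).

Let mZ i : measurable_fun setT (Z i).
Proof.
have mi b : @measurable_fun _ _ T RR setT (X (i, b)) by exact: mX.
exact: measurable_fun_pair (mi true) (mi false).
Qed.

Let joint_box (C : 'I_n -> set (RR * RR)) :
  (forall i, exists A B : set RR, [/\ measurable A, measurable B & C i = A `*` B]) ->
  P [set w | forall i, C i (Z i w)] = (\prod_i gauss2 (s i) (C i))%E.
Proof.
move=> H; have [A hA] := choice H; have [B hB] := choice hA.
pose D (j : 'I_n * bool) := if j.2 then A j.1 else B j.1.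
have mD j : measurable (D j).
  by case: j => i [] /=; have [? ? _] := hB i.
have -> : [set w | forall i, C i (Z i w)] = [set w | forall j, D j (X j w)].
  apply/seteqP; split=> [w h [i b]|w h i].
    by have := h i; have [_ _ ->] := hB i => -[a1 a2]; case: b.
  by have [_ _ ->] := hB i; split; [exact: (h (i, true))|exact: (h (i, false))].
rewrite (iX mD) (eq_bigr (fun j => (fun i b => P (X (i, b) @^-1` D (i, b))) j.1 j.2));
  last by case.
rewrite -(pair_bigA _ (fun i b => P (X (i, b) @^-1` D (i, b)))) /=.
apply: eq_bigr => i _; have [mA mB ->] := hB i.
rewrite gauss2_box// big_bool /= !lX//.
Qed.

(** Dynkin's argument, one index at a time: rectangles generate the Borel sets
    of the plane. *)
Lemma joint_law (C : 'I_n -> set (RR * RR)) : (forall i, measurable (C i)) ->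
  P [set w | forall i, C i (Z i w)] = (\prod_i gauss2 (s i) (C i))%E.
Proof.
have S (m : nat) : forall C : 'I_n -> set (RR * RR), (forall i, measurable (C i)) ->
    (forall i : 'I_n, (m <= i)%N ->
      exists A B : set RR, [/\ measurable A, measurable B & C i = A `*` B]) ->
    P [set w | forall i, C i (Z i w)] = (\prod_i gauss2 (s i) (C i))%E.
  elim: m => [|m IH] {}C mC hC; first by apply: joint_box => i; exact: hC.
  have [mn|nm] := ltnP m n; last first.
    by apply: IH => // i mi; have := ltn_ord i; rewrite ltnNge (leq_trans nm mi).
  pose i0 := Ordinal mn.
  pose Cx D i := if i == i0 then D else C i : set (RR * RR).
  have mCx D i : measurable D -> measurable (Cx D i) by rewrite /Cx; case: ifP.
  pose E := [set w | forall i, i != i0 -> C i (Z i w)].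
  have mE : measurable E.
    have -> : E = \bigcap_(i in [set i | i != i0]) (Z i @^-1` C i).
      by apply/seteqP; split=> w h i; exact: h.
    apply: fin_bigcap_measurable; first exact: finite_finset.
    move=> i _.
    by rewrite -[X in measurable X]setTI; exact: mZ.
  pose K := \prod_(i | i != i0) fine (gauss2 (s i) (C i)).
  have K0 : 0 <= K.
    by apply: prodr_ge0 => i _; rewrite fine_ge0// (measure_ge0 (gauss2_measure (s i))).
  pose m1 : {measure set (RR * RR) -> \bar R} :=
    measure_function_pushforward__canonical__measure_function_Measure (mrestr P mE) (mZ i0).
  pose m2 : {measure set (RR * RR) -> \bar R} := mscale (NngNum K0) (gauss2_measure (s i0)).
  have prodE D : measurable D -> (\prod_i gauss2 (s i) (Cx D i))%E = m2 D.
    move=> mD; rewrite (bigD1 i0)//= {1}/Cx eqxx muleC /m2 /= /mscale /=.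
    congr (_ * _)%E; rewrite /K -prodEFin; apply: eq_bigr => i ii.
    by rewrite /Cx (negbTE ii) -gauss2_fin.
  have setE D : P [set w | forall i, Cx D i (Z i w)] = m1 D.
    rewrite /m1 /= /pushforward /mrestr; congr (P _); apply/seteqP; split=> w.
      move=> h; split; first by have := h i0; rewrite /Cx eqxx.
      by move=> i ii; have := h i; rewrite /Cx (negbTE ii).
    by move=> [h1 h2] i; rewrite /Cx; case: eqP => [->//|/eqP ii]; exact: h2.
  have H D : measurable D -> m1 D = m2 D.
    move=> mD; apply: (measure_unique
      [set A `*` B | A in @measurable _ RR & B in @measurable _ RR] (fun=> setT)) => //.
    - exact: measurable_prod_measurableType.
    - move=> _ _ [A1 mA1 [B1 mB1 <-]] [A2 mA2 [B2 mB2 <-]].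
      by exists (A1 `&` A2); [exact: measurableI|exists (B1 `&` B2);
        [exact: measurableI|rewrite setXI]].
    - by move=> _; exists setT => //; exists setT => //; rewrite setXTT.
    - by rewrite bigcup_const//; exists 0%N.
    - move=> _ [A mA [B mB <-]]; have mAB : measurable (A `*` B) by exact: measurableX.
      rewrite -prodE// -setE; apply: IH => [i|i]; first exact: mCx.
      rewrite /Cx leq_eqVlt => /orP[/eqP mi|mi].
        by have -> : i == i0; [apply/eqP/val_inj|exists A, B].
      by case: eqP => [ii|_]; [move: mi; rewrite ii ltnn|exact: hC].
    - move=> _; rewrite /m1 /= /pushforward /mrestr preimage_setT setTI.
      exact: le_lt_trans (probability_le1 P mE) (ltry 1).
  have := H _ (mC i0); rewrite -setE -(prodE _ (mC i0)).
  have -> : Cx (C i0) = C by apply/funext => i; rewrite /Cx; case: eqP => [->|].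
  by [].
move=> mC; apply: (S n) => // i ni.
by have := ltn_ord i; rewrite ltnNge ni.
Qed.

End joint_law.

Section rotation_law.
Context {R : realType} d {T : measurableType d} (P : probability T R).
Let RR := measurableTypeR R.
Variables (n : nat) (X : 'I_n * bool -> T -> R) (s : 'I_n -> R).
Hypothesis mX : forall i, measurable_fun setT (X i).
Hypothesis s0 : forall i, s i != 0.
Hypothesis iX : mutually_independent P X.
Hypothesis lX : forall i b (B : set R), measurable B ->
  P (X (i, b) @^-1` B) = normal_prob 0 (s i) B.

Let V := ('I_n -> RR * RR)%type.

Let rect : set (set V) := [set A | exists2 C : 'I_n -> set (RR * RR),
  forall i, measurable (C i) & A = [set v : V | forall i, C i (v i)]].

Let VT := g_sigma_algebraType rect.

Let rect_setI : setI_closed rect.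
Proof.
move=> _ _ [C mC ->] [C' mC' ->]; exists (fun i => C i `&` C' i).
  by move=> i; exact: measurableI.
apply/seteqP; split=> [v [h1 h2] i|v h]; first by split.
by split=> i; have [] := h i.
Qed.

Let Z (w : T) : VT := fun i => (X (i, true) w, X (i, false) w).

Let measurable_VT (Y : T -> VT) : (forall i, measurable_fun setT (fun w => Y w i)) ->
  measurable_fun setT Y.
Proof.
move=> mY; apply: (@measurability _ _ T VT setT Y rect) => // _ [_ [C mC ->] <-]; rewrite setTI.
have -> : Y @^-1` [set v : V | forall i, C i (v i)] =
    \bigcap_(i in setT) ((fun w => Y w i) @^-1` C i).
  by apply/seteqP; split=> w h i; [move=> _|]; exact: h.
apply: fin_bigcap_measurable; first exact: finite_finset.
by move=> i _; rewrite -[X in measurable X]setTI; exact: mY.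
Qed.

Let mZi i : measurable_fun setT (fun w => Z w i).
Proof.
have mi b : @measurable_fun _ _ T RR setT (X (i, b)) by exact: mX.
exact: measurable_fun_pair (mi true) (mi false).
Qed.

Let mcoord i : measurable_fun setT (fun v : VT => v i).
Proof.
move=> _ C mC; rewrite setTI; apply: sub_sigma_algebra.
exists (fun j => if j == i then C else setT).
  by move=> j; case: ifP.
apply/seteqP; split=> [v vC j|v /(_ i)]; last by rewrite eqxx.
by case: eqP => [->|].
Qed.

Variables (c t : 'I_n -> R).
Hypothesis ct : forall i, c i ^+ 2 + t i ^+ 2 = 1.

Let U (w : T) : VT := fun i => rot (c i) (t i) (Z w i).

(** The pairs [X (i, _)] are independent with rotation invariant laws, so they
    may be rotated by different angles without changing the joint law. *)
Let rotation_VT (A : set VT) : measurable A -> P (Z @^-1` A) = P (U @^-1` A).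
Proof.
move=> mA; have mZ : measurable_fun setT Z by exact: measurable_VT.
have mU : measurable_fun setT U.
  by apply: measurable_VT => i; exact: measurableT_comp (measurable_rot _ _) (mZi i).
pose m1 : {measure set VT -> \bar R} :=
  measure_function_pushforward__canonical__measure_function_Measure P mZ.
pose m2 : {measure set VT -> \bar R} :=
  measure_function_pushforward__canonical__measure_function_Measure P mU.
apply: (@measure_unique _ R VT rect (fun=> setT) _ _ _ _ m1 m2) => //.
- by move=> _; exists (fun=> setT) => //; apply/seteqP; split.
- by rewrite bigcup_const//; exists 0%N.
- move=> _ [C mC ->]; rewrite /m1 /m2 /= /pushforward.
  have := joint_law mX s0 iX lX mC.
  have mC' i : measurable (rot (c i) (t i) @^-1` C i).
    by rewrite -[X in measurable X]setTI; exact: measurable_rot.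
  have := joint_law mX s0 iX lX mC'.
  rewrite (eq_bigr (fun i => gauss2 (s i) (C i))).
    by move=> <- ->.
  by move=> i _; exact: gauss2_rot.
- by move=> _; rewrite /m1 /= /pushforward preimage_setT probability_setT ltry.
Qed.

Lemma rotation_law (q : nat) (a : nat -> R) (b : 'I_n -> nat -> R[i]) :
  P [set w | forall p, (p < q)%N ->
    a p <= Re (\sum_i (X (i, true) w +i* X (i, false) w) * b i p)] =
  P [set w | forall p, (p < q)%N ->
    a p <= Re (\sum_i (c i +i* t i) * (X (i, true) w +i* X (i, false) w) * b i p)].
Proof.
pose S : set VT := [set v | forall p, (p < q)%N ->
  a p <= Re (\sum_i ((v i).1 +i* (v i).2) * b i p)].
have mS : measurable S.
  have -> : S = \bigcap_(p in [set p | (p < q)%N])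
      [set v : VT | a p <= Re (\sum_i ((v i).1 +i* (v i).2) * b i p)].
    by apply/seteqP; split=> v h p; exact: h.
  apply: bigcap_measurableType => p _.
  rewrite -[X in measurable X]setTI; apply: measurable_fun_le => //.
  have : cmeasurable_fun setT (fun v : VT => \sum_i ((v i).1 +i* (v i).2) * b i p).
    apply: cmeasurable_sum => i; apply: cmeasurableM (cmeasurable_cst _ _).
    by split; apply: measurableT_comp (mcoord i); [exact: measurable_fst|exact: measurable_snd].
  by case.
have := rotation_VT mS; rewrite /S /Z /U /preimage /= => ->.
congr (P _); apply/seteqP; split=> w h p pq; have := h p pq; congr (_ <= Re _);
  by apply: eq_bigr => i _; congr (_ * _); apply: complex_eqP; rewrite ?ReM ?ImM /=; ring.
Qed.

End rotation_law.

(** * Convergence of the pairings *)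

Section continuous_representatives.
Context {R : realType}.
Let mu := @lebesgue_measure R.
Implicit Types (f g h e : R -> R[i]).
Local Notation mR D := (@measurable _ (measurableTypeR R) D).

Lemma ccontinuousB f g : ccontinuous f -> ccontinuous g ->
  ccontinuous (fun x => f x - g x).
Proof.
move=> [f1 f2] [g1 g2]; split.
- rewrite (_ : _ \o _ = (fun x => (Re \o f) x - (Re \o g) x)).
    by move=> x; apply: cvgB; [exact: f1|exact: g1].
  by apply/funext => x /=; rewrite ReB.
- rewrite (_ : _ \o _ = (fun x => (Im \o f) x - (Im \o g) x)).
    by move=> x; apply: cvgB; [exact: f2|exact: g2].
  by apply/funext => x /=; rewrite ImB.
Qed.

Lemma test_bump (x0 d : R) (z : R[i]) : 0 < d -> d <= 1 ->
  test_function (`|x0| + 3) (fun x => z * cut d (x - x0)).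
Proof.
move=> d0 d1; split.
  apply: (@schwartz_compact _ _ (`|x0| + 2)).
    have := csmoothM (csmooth_cst z) (csmooth_affine 1 (- x0) (@csmooth_cut R d)).
    by congr csmooth; apply/funext => x; rewrite mul1r.
  move=> x xr; rewrite cut0 ?mulr0//.
  by have := lerB_dist x x0; move: xr; lra.
exists (`|x0| + 2); first by rewrite ltrD2l ltr_nat.
move=> x xr; rewrite cut0 ?mulr0//.
by have := lerB_dist x x0; move: xr; lra.
Qed.

(** A bump function concentrated where [e] is close to [e x0 != 0] would detect
    it. *)
Lemma ccontinuous_test0 e : ccontinuous e ->
  (forall r g, 0 < r -> test_function r g ->
    cintegral (sym_itv r) (fun x => e x * g x) = 0) ->
  forall x, e x = 0.
Proof.
move=> ce H x0; apply/eqP/negPn/negP => z0; set z := e x0 in z0.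
have nz : 0 < normc z.
  by rewrite lt_neqAle normc_ge0 andbT eq_sym; apply/eqP => /normc_eq0/eqP; exact/negP.
have [d [d0 d1 hd]] : exists d, [/\ 0 < d, d <= 1 & forall x, `|x - x0| < 2 * d ->
    normc (e x - z) <= normc z / 2].
  have n4 : 0 < normc z / 4 by rewrite divr_gt0.
  have [c1 c2] := ce.
  have /cvgrPdist_le/(_ _ n4)[d1 /= d10 h1] := c1 x0.
  have /cvgrPdist_le/(_ _ n4)[d2 /= d20 h2] := c2 x0.
  exists (Num.min 1 (Num.min d1 d2) / 2); split.
  - by rewrite divr_gt0// !lt_min ltr01 d10 d20.
  - have : Num.min 1 (Num.min d1 d2) <= 1 by rewrite ge_min lexx.
    by lra.
  move=> x; rewrite mulrCA mulfV// mulr1 !lt_min => /and3P[_ xd1 xd2].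
  apply: le_trans (normc_le _) _; rewrite ReB ImB.
  have := h1 x; rewrite /ball_ /= distrC => /(_ xd1) l1.
  have := h2 x; rewrite /ball_ /= distrC => /(_ xd2) l2.
  rewrite distrC in l1; rewrite distrC in l2.
  have E : normc z / 2 = normc z / 4 + normc z / 4 by field.
  by rewrite E; exact: lerD.
have tb := test_bump x0 (conjc z) d0 d1; set b := (fun x => _) in tb.
pose r := `|x0| + 3 : R; have r0 : 0 < r by rewrite ltr_wpDl.
have := H r b r0 tb; rewrite -cintegral_support; last first.
  by move=> x xr; rewrite (test_support tb xr) mulr0.
move=> /(congr1 (fun w => Re w)); rewrite /cintegral /= => I0.
pose G x := Re (e x * b x).
have GE x : G x = cutoff (d^-1 * (x - x0)) * Re (e x * conjc z).
  by rewrite /G /b /cut mulrA; case: (e x * conjc z) => p q; rewrite ReM /= mulr0 subr0 mulrC.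
have Gl x : `|x - x0| < 2 * d -> normc z ^+ 2 / 2 <= Re (e x * conjc z).
  move=> xd; have -> : e x * conjc z = z * conjc z + (e x - z) * conjc z by ring.
  rewrite ReD mul_conj /=.
  have := le_Re_normc ((e x - z) * conjc z); rewrite normcM normc_conj => h.
  have h2 : normc (e x - z) * normc z <= normc z / 2 * normc z.
    by rewrite ler_wpM2r ?normc_ge0// hd.
  have := le_trans h h2; rewrite ler_norml => /andP[h3 _]; rewrite expr2.
  by move: h3; lra.
have G0 x : 0 <= G x.
  rewrite GE; have [xd|xd] := ltP `|x - x0| (2 * d).
    rewrite mulr_ge0 ?cutoff_ge0//; apply: le_trans (Gl x xd).
    by rewrite divr_ge0 ?sqr_ge0.
  rewrite cutoff0 ?mul0r// normrM gtr0_norm ?invr_gt0//.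
  by rewrite mulrC ler_pdivlMr.
have cb : ccontinuous b by exact: schwartz_continuous (test_schwartz tb).
have [c c0 hc] := ccontinuous_bounded (ltW r0) ce.
have ib := integrableZl measurableT c
  (integrable_normc measurableT (schwartz_cintegrable (test_schwartz tb))).
have [iG _] : cintegrable setT (fun x => e x * b x).
  apply: cintegrable_le ib => //.
    exact: ccontinuous_measurable (ccontinuousM ce cb).
  move=> x _; rewrite normcM; have [xr|rx] := leP `|x| r.
    by rewrite ler_wpM2r ?normc_ge0// hc.
  by rewrite (test_vanish tb) ?normc0 ?mulr0// ltW.
pose J := `[x0 - d, x0 + d]%classic : set R.
have iJ : mu.-integrable setT (EFin \o (\1_J : R -> R)).
  exact: (integrable_indic_itv (x0 - d) (x0 + d) true false).
have iJ2 := integrableZl measurableT (normc z ^+ 2 / 2) iJ.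
have : \int[mu]_x (normc z ^+ 2 / 2 * \1_J x) <= \int[mu]_x G x.
  apply: le_Rintegral => // x _; rewrite indicE.
  case: (boolP (x \in J)) => [|_]; last by rewrite mulr0; exact: G0.
  rewrite mulr1 inE /J /= in_itv /= => /andP[h1 h2].
  have xd : `|x - x0| <= d by rewrite ler_norml; apply/andP; split; lra.
  rewrite GE cutoff1 ?mul1r; first by apply: Gl; apply: le_lt_trans xd _; lra.
  rewrite normrM gtr0_norm ?invr_gt0// mulrC ler_pdivrMr//.
  by rewrite mul1r.
rewrite I0 (RintegralZl _ measurableT iJ) /Rintegral integral_indic//; last exact: measurable_itv.
rewrite setIT; have := @lebesgue_measure_itv R `[x0 - d, x0 + d].
rewrite /= lte_fin (_ : x0 - d < x0 + d); last by lra.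
move=> -> /=; apply/negP; rewrite -ltNge mulr_gt0 ?divr_gt0 ?exprn_gt0//.
by lra.
Qed.

Lemma L2_representative_unique (u : functional R) f g :
  ccontinuous f -> ccontinuous g ->
  (forall r, 0 < r -> locally_L2 r u f) ->
  (forall r, 0 < r -> forall h, test_function r h ->
    u h = cintegral (sym_itv r) (fun x => g x * h x)) -> f = g.
Proof.
move=> cf cg uf ug; apply/funext => x; apply/eqP; rewrite -subr_eq0; apply/eqP.
apply: (ccontinuous_test0 (ccontinuousB cf cg)) => r h r0 th.
have [_ _ /(_ h th)] := uf r r0; rewrite (ug r r0 h th) => E.
have mI := measurable_sym_itv r.
have I k : ccontinuous k -> cintegrable (sym_itv r) (fun x => k x * h x).
  move=> ck; have [c c0 hc] := ccontinuous_bounded (ltW r0) ck.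
  have ih := integrableZl measurableT c
    (integrable_normc measurableT (schwartz_cintegrable (test_schwartz th))).
  apply: (cintegrable_le (h := fun x => c * normc (h x))) => //.
  - apply: ccontinuous_measurable => //.
    exact: ccontinuousM ck (schwartz_continuous (test_schwartz th)).
  - move=> x'; rewrite /sym_itv /= in_itv /= -ltr_norml => /ltW xr.
    by rewrite normcM ler_wpM2r ?normc_ge0// hc.
  - exact: integrableS ih.
have := cintegralB mI (I _ cf) (I _ cg); rewrite E subrr => <-.
by apply: eq_cintegral => y _; rewrite mulrBl.
Qed.

End continuous_representatives.

Section pairings.
Context {R : realType}.
Let mu := @lebesgue_measure R.
Implicit Types (f g h : R -> R[i]).
Local Notation mR D := (@measurable _ (measurableTypeR R) D).

Lemma cintegral_sum (I : Type) (r : seq I) (F : I -> R -> R[i]) :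
  (forall i, cintegrable setT (F i)) ->
  cintegrable setT (fun x => \sum_(i <- r) F i x) /\
  cintegral setT (fun x => \sum_(i <- r) F i x) = \sum_(i <- r) cintegral setT (F i).
Proof.
move=> iF; elim: r => [|i r [IH1 IH2]].
  have s0 := schwartz_cintegrable (@schwartz0 R).
  rewrite big_nil; under [X in cintegrable _ X]funext do rewrite big_nil.
  under [X in cintegral _ X]funext do rewrite big_nil.
  split=> //; rewrite -[RHS](mul0r (cintegral setT (fun=> 0))).
  rewrite -(cintegralZ 0 measurableT s0).
  by apply: eq_cintegral => x _; rewrite mul0r.
rewrite big_cons; under [X in cintegrable _ X]funext do rewrite big_cons.
under [X in cintegral _ X]funext do rewrite big_cons.
split; first exact: cintegrableD.
by rewrite (cintegralD measurableT (iF i) IH1) IH2.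
Qed.

Lemma trig_pairing (n : nat) (a : 'I_n -> R[i]) (xi : 'I_n -> R) h : schwartz h ->
  cintegral setT (fun x => (\sum_i a i * expi (xi i * x)) * h x) =
  \sum_i a i * fourier h (- xi i).
Proof.
move=> sh.
have iF i : cintegrable setT (fun x => a i * (expi (xi i * x) * h x)).
  by apply: (cintegrableZ _ measurableT); apply: schwartz_cintegrable;
    apply: schwartz_slow sh; exact: slow_expi.
have E i : cintegral setT (fun x => a i * (expi (xi i * x) * h x)) =
    a i * fourier h (- xi i).
  rewrite (cintegralZ (a i) measurableT (schwartz_cintegrable
    (schwartz_slow (slow_expi (xi i)) sh))).
  by congr (_ * _); apply: eq_cintegral => x _; rewrite mulNr opprK.
have [_ S] := cintegral_sum (index_enum 'I_n) iF.
rewrite -(eq_bigr _ (fun i _ => E i)) -S.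
apply: eq_cintegral => x _; rewrite mulr_suml.
by apply: eq_bigr => i _; rewrite mulrA.
Qed.

Lemma fourier_Tm m h (xi : R) : slow m -> schwartz h ->
  fourier (Tm m h) (- xi) = m xi * fourier h (- xi).
Proof.
move=> sm sh; have := inv_fourier_Tm sm sh => /(congr1 (fun f => f xi)).
rewrite !inv_fourierE mulrCA => /mulfI; apply.
by apply/eqP => /(congr1 (fun w => Re w)) /= /eqP; rewrite invr_eq0 mulf_eq0
  pnatr_eq0 /= gt_eqF// pi_gt0.
Qed.

Lemma fourier_cut_cvg h (xi : R) : schwartz h ->
  normc (fourier h xi - fourier (fun x => cut n.+1%:R x * h x) xi) @[n --> \oo] --> (0 : R).
Proof.
move=> sh; have sc n : schwartz (fun x => cut n.+1%:R x * h x).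
  by apply: test_schwartz (test_cut _ sh).
have sd n : schwartz (fun x => (1 - cut n.+1%:R x) * h x).
  by apply: schwartz_slow => //; exists 0; exact: symbol_cutC.
have zf := scont_szero scont_fourier sd (szero_cut sh).
apply/cvgrPdist_le => e e0; apply: filterS (zf 0%N 0 e e0) => n hn.
rewrite sub0r normrN ger0_norm ?normc_ge0//.
have := sym_bound hn (I : setT xi); rewrite jb0 mulr1; congr (normc _ <= _).
apply/eqP; rewrite eq_sym subr_eq; apply/eqP.
rewrite -(schwartz_fourierD xi (sd n) (sc n)); congr (fourier _ xi).
by apply/funext => x; rewrite -mulrDl subrK mul1r.
Qed.

Lemma normc_pairing_le r f g h : 0 < r -> ccontinuous f -> test_function r h ->
  cmeasurable_fun (sym_itv r) g -> (L2norm mu (sym_itv r) g < +oo)%E ->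
  ((normc (cintegral (sym_itv r) (fun x => f x * h x)
    - cintegral (sym_itv r) (fun x => g x * h x)))%:E <=
  \int[mu]_(x in sym_itv r) (normc (f x - g x) * normc (h x))%:E)%E.
Proof.
move=> r0 cf th mg g2; have mI := measurable_sym_itv r; have sh := test_schwartz th.
have mh := ccontinuous_measurable mI (schwartz_continuous sh).
have mf := ccontinuous_measurable mI cf.
have h2 : mu.-integrable (sym_itv r) (EFin \o (fun x => normc (h x) ^+ 2)).
  by apply: integrableS (schwartz_sq_integrable sh).
have h1 := integrable_normc measurableT (schwartz_cintegrable sh).
have i2 : mu.-integrable (sym_itv r) (EFin \o (fun x => normc (g x) ^+ 2)).
  apply/integrableP; split.
    by apply/measurable_EFinP; apply: measurable_funX; exact: measurable_normc.
  under eq_integral do rewrite /= ger0_norm ?sqr_ge0//.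
  by apply: lty_poweRy g2; rewrite invr_neq0.
have ig : cintegrable (sym_itv r) (fun x => g x * h x).
  apply: (cintegrable_le (h := fun x => normc (g x) ^+ 2 + normc (h x) ^+ 2)) => //.
  - exact: cmeasurableM.
  - move=> x _; rewrite normcM.
    have := sqr_ge0 (normc (g x) - normc (h x)).
    have := mulr_ge0 (normc_ge0 (g x)) (normc_ge0 (h x)).
    by rewrite sqrrB; lra.
  - exact: (integrableD mI i2 h2).
have if_ : cintegrable (sym_itv r) (fun x => f x * h x).
  have [c c0 hc] := ccontinuous_bounded (ltW r0) cf.
  apply: (cintegrable_le (h := fun x => c * normc (h x))) => //.
  - exact: cmeasurableM.
  - move=> x'; rewrite /sym_itv /= in_itv /= -ltr_norml => /ltW xr.
    by rewrite normcM ler_wpM2r ?normc_ge0// hc.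
  - exact: integrableS (integrableZl measurableT c h1).
rewrite -(cintegralB mI if_ ig).
have ii : cintegrable (sym_itv r) (fun x => (f x - g x) * h x).
  have := cintegrableD mI if_ (cintegrableZ (-1) mI ig).
  by apply: eq_cintegrable => // x _; rewrite mulrBl mulN1r.
have -> : cintegral (sym_itv r) (fun x => f x * h x - g x * h x) =
    cintegral (sym_itv r) (fun x => (f x - g x) * h x).
  by apply: eq_cintegral => x _; rewrite mulrBl.
have in_ := integrable_normc mI ii.
have -> : (\int[mu]_(x in sym_itv r) (normc (f x - g x) * normc (h x))%:E)%E =
    (\int[mu]_(x in sym_itv r) normc ((f x - g x) * h x))%:E.
  rewrite /Rintegral fineK; last exact: integrable_fin_num in_.
  by apply: eq_integral => x _; rewrite normcM.
by rewrite lee_fin; exact: normc_cintegral.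
Qed.

End pairings.

Lemma L1_le_L2 {R : realType} d (T : measurableType d) (P : probability T R)
    (Y : T -> R[i]) : cmeasurable_fun setT Y ->
  (\int[P]_w (normc (Y w))%:E <= L2norm P setT Y)%E.
Proof.
move=> mY; have mn := measurable_normc mY.
have [->|] := eqVneq (L2norm P setT Y) +oo%E; first exact: leey.
rewrite -ltey => fY.
have i2 : P.-integrable setT (EFin \o (fun w => normc (Y w) ^+ 2)).
  apply/integrableP; split; first by apply/measurable_EFinP; exact: measurable_funX.
  under eq_integral do rewrite /= ger0_norm ?sqr_ge0//.
  by apply: lty_poweRy fY; rewrite invr_neq0.
have ic (c : R) : P.-integrable setT (EFin \o (fun=> c)) by exact: finite_measure_integrable_cst.
have i1 : P.-integrable setT (EFin \o (fun w => normc (Y w))).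
  apply: le_integrable (integrableD measurableT (ic 1) i2) => //; first exact/measurable_EFinP.
  move=> w _ /=; rewrite lee_fin ger0_norm ?normc_ge0// ger0_norm ?addr_ge0 ?sqr_ge0//.
  have := sqr_ge0 (normc (Y w) - 1); rewrite sqrrB expr1n mulr1.
  by have := normc_ge0 (Y w); lra.
set A := \int[P]_w (normc (Y w) ^+ 2); set X := \int[P]_w normc (Y w).
have A0 : 0 <= A by apply: Rintegral_ge0 => w _; exact: sqr_ge0.
have X0 : 0 <= X by apply: Rintegral_ge0 => w _; exact: normc_ge0.
have EX : (\int[P]_w (normc (Y w))%:E)%E = X%:E.
  by rewrite /X /Rintegral fineK//; exact: integrable_fin_num i1.
have EA : (\int[P]_w (normc (Y w) ^+ 2)%:E)%E = A%:E.
  by rewrite /A /Rintegral fineK//; exact: integrable_fin_num i2.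
rewrite EX /L2norm EA poweR_EFin powR12_sqrt// lee_fin -[leRHS]mulr1 -[X in _ <= _ * X](sqrtr1 R).
apply: discriminant_le => // t.
have B1 : 1 = \int[P]_w (1 : R).
  rewrite /Rintegral integral_cst// mul1e.
  exact: (congr1 fine (esym (probability_setT P))).
have i3 := integrableZl measurableT (t ^+ 2) i2; have i4 := integrableZl measurableT (2 * t) i1.
have -> : t ^+ 2 * A - 2 * t * X + 1 =
    \int[P]_w (t ^+ 2 * normc (Y w) ^+ 2 - 2 * t * normc (Y w) + 1).
  rewrite (RintegralD measurableT (integrableB measurableT i3 i4) (ic 1)) -B1.
  rewrite (RintegralB measurableT i3 i4).
  by rewrite (RintegralZl _ measurableT i2) (RintegralZl _ measurableT i1).
apply: Rintegral_ge0 => w _.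
rewrite (_ : _ + _ = (t * normc (Y w) - 1) ^+ 2) ?sqr_ge0//; ring.
Qed.

Section L1_convergence.
Context {R : realType} d {T : measurableType d} (P : probability T R).
Let mu := @lebesgue_measure R.
Let RR := measurableTypeR R.
Implicit Types (h : R -> R[i]).
Local Notation mR D := (@measurable _ (measurableTypeR R) D).

Definition wmass h : R := \int[mu]_x (normc (h x) * jb 1 x).

Lemma integrable_wmass h : schwartz h ->
  mu.-integrable setT (EFin \o (fun x => normc (h x) * jb 1 x)).
Proof.
move=> sh; have [c c0 hc] := schwartz_bound (-3) sh.
apply: le_integrable (integrableZl measurableT c integrable_jb) => //.
  apply/measurable_EFinP; apply: measurable_funM.
    exact: measurable_normc (ccontinuous_measurable measurableT (schwartz_continuous sh)).
  by apply: continuous_measurable; exact: jb_continuous.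
move=> x _ /=; rewrite lee_fin ger0_norm ?mulr_ge0 ?normc_ge0 ?jb_ge0//.
apply: le_trans (ler_norm _); apply: le_trans (ler_wpM2r (jb_ge0 1 x) (hc x)) _.
by rewrite -mulrA -jbD (_ : -3 + 1 = -2)//; ring.
Qed.

Lemma wmass_ge0 h : 0 <= wmass h.
Proof. by apply: Rintegral_ge0 => x _; rewrite mulr_ge0 ?normc_ge0 ?jb_ge0. Qed.

Lemma wmass_cut rho h : 0 < rho -> schwartz h ->
  wmass (fun x => cut rho x * h x) <= wmass h.
Proof.
move=> r0 sh; apply: le_Rintegral => //.
- by apply: integrable_wmass; apply: test_schwartz (test_cut r0 sh).
- exact: integrable_wmass.
- move=> x _; rewrite ler_wpM2r ?jb_ge0// normcM ler_piMl ?normc_ge0//.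
  exact: normc_cut.
Qed.

(** Tonelli and the Cauchy-Schwarz inequality in the probability space turn the
    pointwise bound in L2 into a bound of the pairing in L1. *)
Lemma L1_test (f F : T -> RR -> R[i]) (v p : T -> R[i]) r h (eta : R) :
  0 < r -> test_function r h -> 0 <= eta ->
  (forall w, ccontinuous (f w)) ->
  cmeasurable_fun setT (fun z : T * RR => f z.1 z.2) ->
  cmeasurable_fun setT (fun z : T * RR => F z.1 z.2) ->
  cmeasurable_fun setT v -> cmeasurable_fun setT p ->
  (forall w, p w = cintegral (sym_itv r) (fun x => f w x * h x)) ->
  {ae P, forall w, (L2norm mu (sym_itv r) (F w) < +oo)%E /\
    v w = cintegral (sym_itv r) (fun x => F w x * h x)} ->
  (forall x, ((jb 1 x)^-1%:E * L2norm P setT (fun w => (f w x - F w x)%R) <= eta%:E)%E) ->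
  (\int[P]_w (normc (p w - v w))%:E <= (eta * wmass h)%:E)%E.
Proof.
move=> r0 th e0 cf mf mF mv mp pE aev He; have mI := measurable_sym_itv r.
have sh := test_schwartz th.
pose K (z : T * RR) : \bar R := (normc (f z.1 z.2 - F z.1 z.2) * normc (h z.2))%:E.
have K0 z : (0 <= K z)%E by rewrite lee_fin mulr_ge0 ?normc_ge0.
have mh : measurable_fun [set: RR] (fun x : RR => normc (h x)).
  exact: measurable_normc (ccontinuous_measurable measurableT (schwartz_continuous sh)).
have md := cmeasurableB mf mF.
have mK : measurable_fun setT K.
  apply/measurable_EFinP; apply: measurable_funM; first exact: measurable_normc md.
  exact: measurableT_comp mh (measurable_snd).
have KI w : (\int[mu]_(x in sym_itv r) K (w, x) = \int[mu]_x K (w, x))%E.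
  rewrite integral_mkcond; apply: eq_integral => x _; rewrite patchE; case: ifPn => // /negP xI.
  by rewrite /K /= (test_support th) ?normc0 ?mulr0// => hx; apply: xI; rewrite inE.
have mFw w : cmeasurable_fun (sym_itv r) (F w).
  have [m1 m2] := mF; split.
    by apply: (@measurable_funS _ _ RR _ setT) => //; apply: (measurableT_comp m1 (measurable_pair1 w)).
  by apply: (@measurable_funS _ _ RR _ setT) => //; apply: (measurableT_comp m2 (measurable_pair1 w)).
apply: (@le_trans _ _ (\int[P]_w \int[mu]_x K (w, x))%E).
  apply: ae_ge0_le_integral => //.
  - by move=> w _; rewrite lee_fin normc_ge0.
  - by apply/measurable_EFinP; apply: measurable_normc; exact: cmeasurableB.
  - by move=> w _; exact: integral_ge0.
  - exact: measurable_fun_fubini_tonelli_F.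
  - apply: filterS aev => w [Fw vE] _; rewrite pE vE -KI.
    exact: (normc_pairing_le r0 (cf w) th (mFw w) Fw).
rewrite (_ : (\int[P]_w \int[mu]_x K (w, x))%E = (\int[mu]_x \int[P]_w K (w, x))%E); last first.
  exact: fubini_tonelli.
have iw := integrable_wmass sh.
have -> : (eta * wmass h)%:E = (\int[mu]_x (eta * (normc (h x) * jb 1 x))%:E)%E.
  rewrite -(RintegralZl eta measurableT iw) /Rintegral fineK//.
  exact: integrable_fin_num (integrableZl measurableT eta iw).
apply: ge0_le_integral => //.
- by move=> x _; apply: integral_ge0 => w _; exact: K0.
- exact: measurable_fun_fubini_tonelli_G.
- exact: (measurable_int mu (integrableZl measurableT eta iw)).
move=> x _; rewrite /K /=.
have mY : cmeasurable_fun setT (fun w => f w x - F w x).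
  have [m1 m2] := md.
  by split; [apply: (measurableT_comp m1 (measurable_pair2 x))|
             apply: (measurableT_comp m2 (measurable_pair2 x))].
under eq_integral do rewrite EFinM.
rewrite ge0_integralZr//; last 3 first.
- by apply/measurable_EFinP; exact: measurable_normc.
- by move=> w _; rewrite lee_fin normc_ge0.
- by rewrite lee_fin normc_ge0.
have H : (L2norm P setT (fun w => (f w x - F w x)%R) <= (eta * jb 1 x)%:E)%E.
  have := He x; rewrite lee_pdivrMl ?jb_gt0//.
  by rewrite -EFinM mulrC.
rewrite (_ : eta * (normc (h x) * jb 1 x) = eta * jb 1 x * normc (h x)); last by ring.
rewrite EFinM; apply: lee_wpmul2r; first by rewrite lee_fin normc_ge0.
exact: le_trans (L1_le_L2 P mY) H.
Qed.

End L1_convergence.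

Lemma cvg_normc_dist {R : realType} (z_ : nat -> R[i]) (z : R[i]) :
  normc (z - z_ n) @[n --> \oo] --> (0 : R) ->
  normc (z_ n) @[n --> \oo] --> normc z.
Proof.
move=> /cvgrPdist_le H; apply/cvgrPdist_le => e e0; apply: filterS (H e e0) => n.
rewrite sub0r normrN ger0_norm ?normc_ge0//; apply: le_trans.
have h1 : normc z <= normc (z - z_ n) + normc (z_ n).
  by apply: le_trans (normcD _ _); rewrite subrK.
have h2 : normc (z_ n) <= normc (z - z_ n) + normc z.
  by rewrite normc_distC; apply: le_trans (normcD _ _); rewrite subrK.
by rewrite ler_norml; apply/andP; split; lra.
Qed.

Lemma cvg0_normc_sum {R : realType} (I : Type) (r : seq I) (c : I -> R[i])
    (D : I -> nat -> R[i]) :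
  (forall i, normc (D i n) @[n --> \oo] --> (0 : R)) ->
  normc (\sum_(i <- r) c i * D i n) @[n --> \oo] --> (0 : R).
Proof.
move=> D0.
have S : (\sum_(i <- r) normc (c i) * normc (D i n)) @[n --> \oo] --> (0 : R).
  elim: r => [|i r IH].
    by under eq_fun do rewrite big_nil; exact: cvg_cst.
  under eq_fun do rewrite big_cons.
  have h := cvgD (cvgMl_tmp (a := normc (c i)) (D0 i)) IH.
  by move: h; rewrite mulr0 addr0; apply.
apply: (squeeze_cvgr _ (cvg_cst 0) S); near=> n; rewrite normc_ge0 /=.
apply: le_trans (normc_sum _ _) _.
by rewrite (eq_bigr (fun i => normc (c i) * normc (D i n)))// => i _; exact: normcM.
Unshelve. all: by end_near. Qed.

Section partial_sums.
Context {R : realType} d {T : measurableType d} (P : probability T R).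
Variables (W : R -> T -> R[i]) (phi : {RV P >-> borel_Hloc R}).
Let mu := @lebesgue_measure R.
Let RR := measurableTypeR R.
Implicit Types (h : R -> R[i]).

Definition node (N M i : nat) : R := (i%:R - (N * M)%:R) / N%:R.

Definition incr (N M i : nat) (w : T) : R[i] := W (node N M i.+1) w - W (node N M i) w.

Definition amp (N M i : nat) : R[i] :=
  ((1 + (i%:R - (N * M)%:R) ^+ 2 / N%:R ^+ 2) `^ (- 2^-1))%:C.

Lemma phi_NRE N M w (x : R) : phi_NR W N M w x =
  \sum_(i < (N * M).*2) (incr N M i w * amp N M i) * expi (node N M i * x).
Proof.
rewrite /phi_NR; apply: eq_bigr => i _ /=; rewrite /incr /node -addrA [- _ + 1]addrC addrA natr1.
by congr (_ * _ * expi _); rewrite mulrAC.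
Qed.

(** The pairing of [phi_NR] with [h]. *)
Definition pairing (N M : nat) h (w : T) : R[i] :=
  \sum_(i < (N * M).*2) (incr N M i w * amp N M i) * fourier h (- node N M i).

Lemma pairingE N M h w : schwartz h ->
  cintegral setT (fun x => phi_NR W N M w x * h x) = pairing N M h w.
Proof.
move=> sh; apply: etrans (trig_pairing (fun i : 'I_((N * M).*2) => incr N M i w * amp N M i)
  (fun i : 'I_((N * M).*2) => node N M i) sh).
by apply: eq_cintegral => x _; rewrite phi_NRE.
Qed.

Lemma pairing_wave N M h (t : R) w : schwartz h ->
  pairing N M (Tm (wave t) h) w =
  \sum_(i < (N * M).*2) (wave t (node N M i) * incr N M i w) *
    (amp N M i * fourier h (- node N M i)).
Proof.
move=> sh; apply: eq_bigr => i _; rewrite (fourier_Tm _ (slow_wave t) sh).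
by move: (incr N M i w) (amp N M i) (wave _ _) (fourier _ _) => a b c e; ring.
Qed.

Lemma node_lt N M i : (0 < N)%N -> node N M i < node N M i.+1.
Proof. by move=> N0; rewrite ltr_pM2r ?invr_gt0 ?ltr0n// ltrD2r ltr_nat. Qed.

Hypothesis mW : forall a, cmeasurable_fun setT (W a).

Lemma measurable_incr N M i : cmeasurable_fun setT (incr N M i).
Proof. exact: cmeasurableB. Qed.

Lemma measurable_pairing N M h : cmeasurable_fun setT (pairing N M h).
Proof.
apply: cmeasurable_sum => i; apply: cmeasurableM (cmeasurable_cst _ _).
exact: cmeasurableM (measurable_incr _ _ _) (cmeasurable_cst _ _).
Qed.

Lemma continuous_phi_NR N M w : ccontinuous (phi_NR W N M w).
Proof.
rewrite (_ : phi_NR W N M w = fun x => \sum_(i < (N * M).*2)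
    (incr N M i w * amp N M i) * expi (node N M i * x)); last first.
  by apply/funext => x; rewrite phi_NRE.
elim: (index_enum _) => [|i r IH].
  under [X in ccontinuous X]funext do rewrite big_nil.
  exact: schwartz_continuous (@schwartz0 R).
under [X in ccontinuous X]funext do rewrite big_cons.
have c1 := is_cder_continuous (is_cderZ (incr N M i w * amp N M i)
  (is_cder_expi_linear (node N M i))).
have cN := is_cder_continuous (@is_cder_cst R (-1)).
apply: ccontinuous_ext (ccontinuousB c1 (ccontinuousM cN IH)) => x.
by rewrite mulN1r opprK.
Qed.

Lemma measurable_phi_NR N M :
  cmeasurable_fun setT (fun z : T * RR => phi_NR W N M z.1 z.2).
Proof.
have H i : cmeasurable_fun setT (fun z : T * RR =>
    (incr N M i z.1 * amp N M i) * expi (node N M i * z.2)).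
  apply: cmeasurableM.
    apply: cmeasurableM (cmeasurable_cst _ _).
    have [m1 m2] := measurable_incr N M i; split.
      exact: measurableT_comp m1 measurable_fst.
    exact: measurableT_comp m2 measurable_fst.
  have [m1 m2] : cmeasurable_fun [set: RR] (fun x : RR => expi (node N M i * x)).
    exact: ccontinuous_measurable measurableT (ccontinuous_expi _).
  split; [exact: measurableT_comp m1 measurable_snd|exact: measurableT_comp m2 measurable_snd].
apply: cmeasurable_ext (cmeasurable_sum (index_enum 'I_((N * M).*2)) (fun i => H i)) => z.
by rewrite phi_NRE.
Qed.

Lemma measurable_phi h : schwartz h -> cmeasurable_fun setT (fun w => val (phi w) h).
Proof.
move=> sh; have mRe k : schwartz k -> measurable_fun setT (fun w => Re (val (phi w) k)).
  by move=> sk; exact: measurableT_comp (measurable_eval sk) (measurable_funPT phi).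
split; first exact: mRe.
have := mRe _ (schwartzZ (0 -i* 1) sh); apply: eq_measurable_fun => w _ /=.
rewrite (slinearZ _ (tempered_slinear (Hloc_tempered (phi w))) sh) ReM /=; ring.
Qed.

Hypothesis lim : is_limit P (fun k => phi_NR W (2 ^ k)%N k) (fun w => val (phi w)).

Lemma pairing_L1 h (e : R) : schwartz h -> 0 < e -> \forall k \near \oo,
  (\int[P]_w (normc (pairing (2 ^ k) k h w - val (phi w) h))%:E <= e%:E)%E.
Proof.
move=> sh e0.
have s0 : (0 : R) < 2^-1 by rewrite invr_gt0.
have [F_ [F [hF_ mF aeF cF]]] := lim s0.
have FE k w : F_ k w = phi_NR W (2 ^ k) k w.
  have [cFk LFk] := hF_ k w.
  apply: (L2_representative_unique cFk (continuous_phi_NR _ _ _) LFk) => r r0 g tg.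
  rewrite (D0E _ (test_schwartz tg)) /distr_of /on_schwartz.
  rewrite (asboolT (test_schwartz tg)).
  by apply: cintegral_support => x xr; rewrite (test_support tg xr) mulr0.
pose eta := e / (wmass h + 1).
have w1 : 0 < wmass h + 1 by rewrite ltr_wpDl// wmass_ge0.
have eta0 : 0 < eta by rewrite divr_gt0.
have etaw : eta * wmass h <= e.
  by rewrite /eta mulrAC ler_pdivrMr// ler_pM2l// lerDl.
have /fine_cvgP[finF /cvgrPdist_le/(_ _ eta0) fineF] := cF.
pose dl j : \bar R := (ereal_sup (range (fun x : R => ((Num.sqrt (1 + x ^+ 2))^-1)%:E *
  L2norm P setT (fun w => (F_ j w x - F w x)%R))))%E.
apply: filterS2 finF fineF => k f1' f2'.
have f1 : dl k \is a fin_num := f1'.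
have f2 : `|0 - fine (dl k)| <= eta := f2'.
have He x : ((jb 1 x)^-1%:E * L2norm P setT (fun w => (phi_NR W (2 ^ k) k w x - F w x)%R)
    <= eta%:E)%E.
  rewrite jb1; apply: (@le_trans _ _ (dl k)).
    apply: ereal_sup_ubound; exists x => //=; congr (_ * L2norm _ _ _)%E.
    by apply/funext => w; rewrite FE.
  rewrite -(fineK f1) lee_fin; apply: le_trans (ler_norm _) _.
  by move: f2; rewrite sub0r normrN.
have L1 r g : 0 < r -> test_function r g ->
    (\int[P]_w (normc (pairing (2 ^ k) k g w - val (phi w) g))%:E <=
      (eta * wmass g)%:E)%E.
  move=> r0 tg; have sg := test_schwartz tg.
  apply: (L1_test (f := fun w => phi_NR W (2 ^ k) k w) (F := F) r0 tg (ltW eta0)) => //.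
  - by move=> w; exact: continuous_phi_NR.
  - exact: measurable_phi_NR.
  - exact: measurable_phi.
  - exact: measurable_pairing.
  - move=> w; rewrite -(pairingE _ _ _ sg); apply: cintegral_support => x xr.
    by rewrite (test_support tg xr) mulr0.
  - apply: filterS aeF => w /(_ r r0) [_ h2 h3]; split=> //.
    by rewrite -(D0E _ sg); exact: h3.
have c0 (n : nat) : 0 < n.+1%:R :> R by [].
apply: le_trans (_ : (eta * wmass h)%:E <= _)%E; last by rewrite lee_fin.
pose hc n := fun x => cut n.+1%:R x * h x.
have thc n : test_function (2 * n.+1%:R + 1) (hc n) := test_cut (c0 n) sh.
apply: (@fatou_bound _ _ _ P setT measurableT
    (fun n w => normc (pairing (2 ^ k) k (hc n) w - val (phi w) (hc n))) _
    (fun=> eta * wmass h)) => //.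
- move=> n; apply: measurable_normc; apply: cmeasurableB; first exact: measurable_pairing.
  exact: measurable_phi (test_schwartz (thc n)).
- apply: measurable_normc; apply: cmeasurableB; first exact: measurable_pairing.
  exact: measurable_phi.
- by move=> n w _; exact: normc_ge0.
- by move=> w _; exact: normc_ge0.
- apply: aeW => w _; apply: cvg_normc_dist.
  have c1 : normc (pairing (2 ^ k) k h w - pairing (2 ^ k) k (hc n) w) @[n --> \oo] --> (0 : R).
    rewrite /pairing; under eq_fun do rewrite -sumrB.
    under eq_fun do under eq_bigr do rewrite -mulrBr.
    by apply: cvg0_normc_sum => i; exact: fourier_cut_cvg.
  have c2 := cut_eval_cvg (Hloc_tempered (phi w)) sh.
  have c12 : normc (pairing (2 ^ k) k h w - pairing (2 ^ k) k (hc n) w) +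
      normc (val (phi w) h - val (phi w) (hc n)) @[n --> \oo] --> (0 : R).
    by have := cvgD c1 c2; rewrite addr0; apply.
  apply: (squeeze_cvgr _ (cvg_cst 0) c12); near=> n; rewrite normc_ge0 /=.
  move: (pairing _ _ h w) (pairing _ _ (hc n) w) (val (phi w) h) => x y z.
  rewrite (_ : x - z - (y - val (phi w) (hc n)) = (x - y) - (z - val (phi w) (hc n))).
    exact: normcB.
  by move: (val _ (hc n)) => u; ring.
- move=> n; apply: le_trans (L1 _ _ _ (thc n)) _; first by rewrite ltr_wpDl.
  by rewrite lee_fin ler_wpM2l ?(ltW eta0)//; exact: wmass_cut.
- exact: cvg_cst.
Unshelve. all: by end_near. Qed.

End partial_sums.

Section half_spaces.
Context {R : realType} d {T : measurableType d} (P : probability T R) (q : nat).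
Implicit Types (U V X Y : nat -> T -> R) (a : nat -> R).

Let A U a : set T := [set w | forall p, (p < q)%N -> a p <= U p w].

Let mA U a : (forall p, measurable_fun setT (U p)) -> measurable (A U a).
Proof.
move=> mU; have -> : A U a = \bigcap_(p in [set p | (p < q)%N]) [set w | a p <= U p w].
  by apply/seteqP; split=> w h p; exact: h.
apply: bigcap_measurableType => p _.
by rewrite -[X in measurable X]setTI; apply: measurable_fun_le.
Qed.

(** Markov's inequality for the sum of the deviations. *)
Let near_event U V a (e : R) : 0 < e ->
  (forall p, measurable_fun setT (U p)) -> (forall p, measurable_fun setT (V p)) ->
  (forall p, (p < q)%N ->
    \int[P]_w `|U p w - V p w|%:E <= (e ^+ 2 / q.+1%:R)%:E)%E ->
  (P (A U a) <= P (A V (fun p => (a p - e)%R)) + e%:E)%E.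
Proof.
move=> e0 mU mV H.
pose S w := \sum_(p < q) `|U p w - V p w|.
have mUV p : measurable_fun setT (fun w => `|U p w - V p w|).
  by apply: measurableT_comp => //; exact: measurable_funB.
have mS : measurable_fun setT S.
  by apply: (measurable_sum (index_enum 'I_q) (fun p : 'I_q => mUV p)).
have S0 w : 0 <= S w by apply: sumr_ge0.
pose B := [set w | (e%:E <= `|(S w)%:E|)%E].
have mB : measurable B.
  have -> : B = [set w | e <= S w].
    by apply/seteqP; split=> w; rewrite /B /= lee_fin ger0_norm.
  by rewrite -[X in measurable X]setTI; apply: measurable_fun_le.
have q0 : 0 < q.+1%:R :> R by [].
have PB : (P B <= e%:E)%E.
  have mSE : measurable_fun setT (fun w => (S w)%:E) by exact/measurable_EFinP.
  have := le_integral_abse P measurableT mSE e0; rewrite setTI -/B => h.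
  have hS : (\int[P]_w `|(S w)%:E| <= (e ^+ 2)%:E)%E.
    under eq_integral do rewrite abse_EFin ger0_norm// /S -sumEFin.
    rewrite ge0_integral_sum//; last by move=> p; exact/measurable_EFinP.
    apply: (@le_trans _ _ (\sum_(p < q) (e ^+ 2 / q.+1%:R)%:E)%E).
      by apply: lee_sum => p _; exact: H.
    rewrite sumEFin lee_fin sumr_const card_ord -[leLHS]mulr_natr -mulrA.
    by rewrite ler_piMr ?sqr_ge0// mulrC ler_pdivrMr// mul1r ler_nat.
  have := le_trans h hS; rewrite expr2 EFinM lee_pmul2l//.
apply: (@le_trans _ _ (P (A V (fun p => a p - e) `|` B))).
  apply: le_measure; rewrite ?inE; [exact: mA|by apply: measurableU => //; exact: mA|].
  move=> w Aw; have [eS|Se] := leP e (S w); [right|left].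
    by rewrite /B /= lee_fin ger0_norm.
  move=> p pq; have := Aw p pq.
  have : `|U p w - V p w| <= S w.
    by rewrite /S (bigD1 (Ordinal pq))//= lerDl sumr_ge0.
  by rewrite ler_norml => /andP[_]; lra.
apply: le_trans (measureU2 _ _ _) _ => //; first exact: mA.
by rewrite leeD2l.
Qed.

(** Laws of half-spaces pass to limits in L1, up to an enlargement of the
    half-spaces which is then removed by continuity from above. *)
Lemma half_space_le X Y (Xk Yk : nat -> nat -> T -> R) a :
  (forall p, measurable_fun setT (X p)) -> (forall p, measurable_fun setT (Y p)) ->
  (forall k p, measurable_fun setT (Xk k p)) ->
  (forall k p, measurable_fun setT (Yk k p)) ->
  (forall p e, 0 < e -> \forall k \near \oo,
    (\int[P]_w `|Xk k p w - X p w|%:E <= e%:E)%E) ->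
  (forall p e, 0 < e -> \forall k \near \oo,
    (\int[P]_w `|Yk k p w - Y p w|%:E <= e%:E)%E) ->
  (forall k b, P [set w | forall p, (p < q)%N -> b p <= Xk k p w] =
    P [set w | forall p, (p < q)%N -> b p <= Yk k p w]) ->
  (P [set w | forall p, (p < q)%N -> (a p <= X p w)%R] <=
   P [set w | forall p, (p < q)%N -> (a p <= Y p w)%R])%E.
Proof.
move=> mX mY mXk mYk cX cY law.
have all_near (Q : nat -> nat -> Prop) m : (forall p, \forall k \near \oo, Q p k) ->
    \forall k \near \oo, forall p, (p < m)%N -> Q p k.
  move=> HQ; elim: m => [|m IH]; first exact: nearW.
  apply: filterS2 IH (HQ m) => k h1 h2 p; rewrite ltnS leq_eqVlt => /orP[/eqP ->//|].
  exact: h1.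
have step (e : R) : 0 < e ->
    (P (A X a) <= P (A Y (fun p => (a p - e - e)%R)) + (e + e)%:E)%E.
  move=> e0; have e2 : 0 < e ^+ 2 / q.+1%:R by rewrite divr_gt0// exprn_gt0.
  have [k [h1 h2]] := filter_ex (filterI (all_near _ q (fun p => cX p _ e2))
    (all_near _ q (fun p => cY p _ e2))).
  have n1 := @near_event X (Xk k) a e e0 mX (mXk k).
  have n2 := @near_event (Yk k) Y (fun p => a p - e) e e0 (mYk k) mY h2.
  have {}n1 := n1 _; rewrite EFinD addeA; apply: le_trans (n1 _) _.
    move=> p pq; have := h1 p pq; congr (_ <= _)%E.
    by apply: eq_integral => w _; rewrite distrC.
  by rewrite leeD2r// {1}/A law.
pose e_ (n : nat) : R := n.+1%:R^-1.
have e0 n : 0 < e_ n by rewrite invr_gt0.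
pose B n := A Y (fun p => a p - e_ n - e_ n).
have BE : A Y a = \bigcap_n B n.
  apply/seteqP; split=> [w Aw n _ p pq|w Bw p pq].
    by apply: le_trans (Aw p pq); have := e0 n; lra.
  apply/ler_addgt0Pr => e ep.
  have [n hn] : exists n, e_ n + e_ n <= e.
    exists (Num.bound (2 / e)); rewrite /e_.
    have : 2 / e < (Num.bound (2 / e))%:R by apply: archi_boundP; rewrite divr_ge0// ltW.
    set m := Num.bound _; rewrite ltr_pdivrMr// => h; have m0 : 0 < m.+1%:R :> R by [].
    have -> : m.+1%:R^-1 + m.+1%:R^-1 = 2 / m.+1%:R :> R by rewrite mulr_natl mulr2n.
    rewrite ler_pdivrMr//; apply: le_trans (ltW h) _.
    by rewrite mulrC ler_wpM2l ?(ltW ep)// ler_nat.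
  by have := Bw n I p pq; move: hn; lra.
have mB n : measurable (B n) by exact: mA.
have cB : P (B n) @[n --> \oo] --> P (\bigcap_n B n).
  apply: nonincreasing_cvg_mu => //.
  - by apply: le_lt_trans (probability_le1 P (mB 0%N)) (ltry 1).
  - exact: bigcapT_measurable.
  - move=> m n mn; apply/subsetPset => w Bw p pq; apply: le_trans (Bw p pq).
    have : e_ n <= e_ m by rewrite /e_ lef_pV2 ?posrE// ler_nat.
    by lra.
have ce : (e_ n + e_ n)%:E @[n --> \oo] --> (0 : \bar R).
  apply: cvg_EFin; first exact: nearW.
  have h := @cvg_harmonic R; have := cvgD h h; rewrite addr0; apply.
rewrite -/(A X a) -/(A Y a) BE.
have fin : (P (\bigcap_n B n) +? 0)%E by apply: fin_num_adde_defl.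
have c : (P (B n) + (e_ n + e_ n)%:E)%E @[n --> \oo] --> P (\bigcap_n B n).
  by rewrite -[X in _ --> X]adde0; exact: cvgeD.
rewrite -(cvg_lim (@ereal_hausdorff R) c); apply: lime_ge; first exact: cvgP c.
by apply: nearW => n; exact: step.
Qed.

End half_spaces.

(** * Invariance of the law *)

Section invariance.
Context {R : realType} d {T : measurableType d} (P : probability T R).
Variables (W : R -> T -> R[i]) (phi : {RV P >-> borel_Hloc R}).
Hypothesis BM : complex_brownian_motion P W.
Hypothesis lim : is_limit P (fun k => phi_NR W (2 ^ k)%N k) (fun w => val (phi w)).

Let mW a : cmeasurable_fun setT (W a). Proof. by case: BM. Qed.

(** The flow multiplies the independent increments by numbers of modulus one. *)
Let pairing_law N M (t : R) (q : nat) (h : nat -> R -> R[i]) (a : nat -> R) : (0 < N)%N ->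
  (forall p, schwartz (h p)) ->
  P [set w | forall p, (p < q)%N -> a p <= Re (pairing W N M (h p) w)] =
  P [set w | forall p, (p < q)%N -> a p <= Re (pairing W N M (Tm (wave t) (h p)) w)].
Proof.
move=> N0 sh; have [_ _ indep law] := BM.
pose n := (N * M).*2.
pose X (j : 'I_n * bool) w := part j.2 (incr W N M j.1 w).
have mX j : measurable_fun setT (X j).
  by case: j => i []; have [m1 m2] := measurable_incr mW N M i.
pose s (i : 'I_n) : R := Num.sqrt ((node N M i.+1 - node N M i) / 2).
have s0 i : s i != 0.
  by rewrite gt_eqF// sqrtr_gt0 divr_gt0// subr_gt0 node_lt.
have homo : {homo (node N M : nat -> R) : i j / (i < j)%N >-> i < j}.
  by move=> i j ij; rewrite ltr_pM2r ?invr_gt0 ?ltr0n// ltrD2r ltr_nat.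
have iX : mutually_independent P X := indep _ homo n.
have lX i b (B : set R) : measurable B ->
    P (X (i, b) @^-1` B) = normal_prob 0 (s i) B.
  by move=> mB; exact: (law _ _ (node_lt M i N0) b B mB).
pose c (i : 'I_n) : R := Re (wave t (node N M i)).
pose e (i : 'I_n) : R := Im (wave t (node N M i)).
have ce i : c i ^+ 2 + e i ^+ 2 = 1.
  by rewrite -sqr_normc normc_wave expr1n.
have := rotation_law mX s0 iX lX ce q a
  (fun i p => amp N M i * fourier (h p) (- node N M i)).
have XE w (i : 'I_n) : X (i, true) w +i* X (i, false) w = incr W N M i w.
  by rewrite /X /=; case: (incr W N M i w).
have waveE' (i : 'I_n) : c i +i* e i = wave t (node N M i).
  by rewrite /c /e; case: (wave t _).
have E1 w p : \sum_(i < n) (X (i, true) w +i* X (i, false) w) *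
    (amp N M i * fourier (h p) (- node N M i)) = pairing W N M (h p) w.
  by apply: eq_bigr => i _; rewrite XE mulrA.
have E2 w p : \sum_(i < n) (c i +i* e i) * (X (i, true) w +i* X (i, false) w) *
    (amp N M i * fourier (h p) (- node N M i)) = pairing W N M (Tm (wave t) (h p)) w.
  by rewrite (pairing_wave _ _ _ _ _ (sh p)); apply: eq_bigr => i _; rewrite XE waveE'.
have S1 : [set w | forall p, (p < q)%N -> a p <= Re (\sum_(i < n)
    (X (i, true) w +i* X (i, false) w) *
    (amp N M i * fourier (h p) (- node N M i)))] =
    [set w | forall p, (p < q)%N -> a p <= Re (pairing W N M (h p) w)].
  by apply/seteqP; split=> w H p pq; have := H p pq; rewrite E1.
have S2 : [set w | forall p, (p < q)%N -> a p <= Re (\sum_(i < n)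
    (c i +i* e i) * (X (i, true) w +i* X (i, false) w) *
    (amp N M i * fourier (h p) (- node N M i)))] =
    [set w | forall p, (p < q)%N -> a p <= Re (pairing W N M (Tm (wave t) (h p)) w)].
  by apply/seteqP; split=> w H p pq; have := H p pq; rewrite E2.
by rewrite S1 S2.
Qed.

Let Re_pairing_L1 h (e : R) : schwartz h -> 0 < e -> \forall k \near \oo,
  (\int[P]_w `|Re (pairing W (2 ^ k) k h w) - Re (val (phi w) h)|%:E <= e%:E)%E.
Proof.
move=> sh e0; apply: filterS (pairing_L1 mW lim sh e0) => k; apply: le_trans.
have mp := measurable_pairing mW (2 ^ k) k h; have mf := measurable_phi phi sh.
apply: ge0_le_integral => //.
- by apply/measurable_EFinP; apply: measurableT_comp => //; apply: measurable_funB;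
    [exact: mp.1|exact: mf.1].
- by apply/measurable_EFinP; apply: measurable_normc; exact: cmeasurableB.
- by move=> w _; rewrite lee_fin -ReB; exact: le_Re_normc.
Qed.

Let phi_law (t : R) (q : nat) (h : nat -> R -> R[i]) (a : nat -> R) :
  (forall p, schwartz (h p)) ->
  P [set w | forall p, (p < q)%N -> a p <= Re (val (phi w) (h p))] =
  P [set w | forall p, (p < q)%N -> a p <= Re (val (phi w) (Tm (wave t) (h p)))].
Proof.
move=> sh; have sT p : schwartz (Tm (wave t) (h p)).
  by apply: schwartz_Tm => //; exact: slow_wave.
have mR (k : nat -> R -> R[i]) : (forall p, schwartz (k p)) ->
    forall p, measurable_fun setT (fun w => Re (val (phi w) (k p))).
  by move=> sk p; have [] := measurable_phi phi (sk p).
have mRk (k : nat -> R -> R[i]) j p :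
    measurable_fun setT (fun w => Re (pairing W (2 ^ j) j (k p) w)).
  by have [] := measurable_pairing mW (2 ^ j) j (k p).
have law k b := @pairing_law (2 ^ k) k t q h b (expn_gt0 2 k) sh.
have L1 p e : 0 < e -> \forall k \near \oo, (\int[P]_w
    `|Re (pairing W (2 ^ k) k (h p) w) - Re (val (phi w) (h p))|%:E <= e%:E)%E.
  exact: Re_pairing_L1.
have L2 p e : 0 < e -> \forall k \near \oo, (\int[P]_w
    `|Re (pairing W (2 ^ k) k (Tm (wave t) (h p)) w) -
      Re (val (phi w) (Tm (wave t) (h p)))|%:E <= e%:E)%E.
  exact: Re_pairing_L1.
have h1 := half_space_le a (mR h sh) (mR _ sT) (mRk h)
  (mRk (fun p => Tm (wave t) (h p))) L1 L2 law.
have h2 := half_space_le a (mR _ sT) (mR h sh) (mRk (fun p => Tm (wave t) (h p)))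
  (mRk h) L2 L1 (fun k b => esym (law k b)).
by apply/eqP; rewrite eq_le; apply/andP; split; [exact: h1|exact: h2].
Qed.

Lemma law_invariant (t : R) (B : set (borel_Hloc R)) : measurable B ->
  measurable (Hflow t @^-1` B) /\
  distribution P phi (Hflow t @^-1` B) = distribution P phi B.
Proof.
move=> mB; pose BT := g_sigma_algebraType (@boxes R).
have sT (h : nat -> R -> R[i]) : (forall i, schwartz (h i)) ->
    forall i, schwartz (Tm (wave t) (h i)).
  by move=> sh i; apply: schwartz_Tm => //; exact: slow_wave.
have pre n (h : nat -> R -> R[i]) a : (forall i, schwartz (h i)) ->
    Hflow t @^-1` (box n h a) = box n (fun i => Tm (wave t) (h i)) a.
  by move=> sh; apply/seteqP; split=> u Hu i im; have := Hu i im; rewrite /= (LE _ _ (sh i)).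
have mflow : @measurable_fun _ _ (borel_Hloc R) BT setT (Hflow t).
  apply: (@measurability _ _ (borel_Hloc R) BT setT _ (@boxes R)) => //.
  move=> _ [_ [n [h [a [sh ->]]]] <-]; rewrite setTI (pre n h a sh).
  by apply: measurable_box; exact: sT.
have mphi : @measurable_fun _ _ T BT setT phi.
  apply: (@measurability _ _ T BT setT _ (@boxes R)) => //.
  move=> _ [_ [n [h [a [sh ->]]]] <-].
  by apply: (measurable_funPT phi) => //; exact: measurable_box.
have mBT := borel_boxes mB.
have mpre : measurable (Hflow t @^-1` B) by rewrite -[X in measurable X]setTI; exact: mflow.
split=> //.
pose m1 : {measure set BT -> \bar R} :=
  measure_function_pushforward__canonical__measure_function_Measure P
    (measurableT_comp mflow (measurable_funPT phi)).
pose m2 : {measure set BT -> \bar R} :=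
  measure_function_pushforward__canonical__measure_function_Measure P mphi.
change (m1 B = m2 B).
apply: (@measure_unique _ R BT (@boxes R) (fun=> setT) _ _ _ _ m1 m2) => //.
- exact: boxes_setI.
- move=> _; exists 0%N, (fun=> fun=> 0), (fun=> 0); split.
    by move=> _; exact: schwartz0.
  by apply/seteqP; split.
- by rewrite bigcup_const//; exists 0%N.
- move=> _ [n [h [a [sh ->]]]]; rewrite /m1 /m2 /= /pushforward.
  rewrite [LHS](_ : _ = P [set w | forall p, (p < n)%N ->
      a p <= Re (val (phi w) (Tm (wave t) (h p)))]).
    by rewrite -(phi_law t n a sh).
  by congr (P _); have := congr1 (fun S => phi @^-1` S) (pre n h a sh).
- by move=> _; rewrite /m1 /= /pushforward preimage_setT probability_setT ltry.
Qed.

End invariance.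

Theorem theorem2p11 (R : realType) (d : measure_display)
    (T : measurableType d) (P : probability T R) (W : R -> T -> R[i])
    (phi : {RV P >-> borel_Hloc R}) :
  complex_brownian_motion P W ->
  is_limit P (fun k => phi_NR W (2 ^ k)%N k) (fun w => val (phi w)) ->
  forall (t : R) (A : set (borel_Hloc R)), measurable A ->
    measurable (L_preimage t A) /\
    distribution P phi (L_preimage t A) = distribution P phi A.
Proof. by move=> BM lim t A mA; rewrite L_preimageE; exact: law_invariant BM lim t A mA. Qed.
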